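(* Let $\Gamma$ be a finite subgroup of $\mathbb{T}=(\mathbb{R}/2\pi\mathbb{Z})^2$ with associated data $Q=\frac pq\in(0,1)$ and $(\mu,\nu)\in\mathbb{Z}_{>0}^2$ (see context), and assume that at least one of $\mu,\nu$ is larger than $1$, and that $\frac pq\ne\frac12$ whenever $\mu=1$ or $\nu=1$. Then the top-dimensional ($3$-dimensional) faces of the convex hull of $\iota(\Gamma)\subset\mathbb{R}^4$ come in the following three types, the faces being the cells listed below pushed forward by the action of $\Gamma$. (1) If $A=\frac\alpha a,B=\frac\beta b\in[0,1]$ is an admissible pair, there is a tetrahedron spanned by the images under $\iota$ of $$(0,0),\quad \left(\tfrac{a}{q\mu}2\pi,\tfrac{ap-\alpha q}{q\nu}2\pi\right),\quad \left(\tfrac{b}{q\mu}2\pi,\tfrac{bp-\beta q}{q\nu}2\pi\right),\quad \left(\tfrac{a+b}{q\mu}2\pi,\tfrac{(a+b)p-(\alpha+\beta)q}{q\nu}2\pi\right),$$ which are four points of $\Gamma$. They form a parallelogram whose center is $c=\left(\frac{a+b}{q\mu}\pi,\frac{(a+b)p-(\alpha+\beta)q}{q\nu}\pi\right)$. (2) If $\nu>1$, there is an extra tetrahedron given by the same formula as in (1) for the pair $\{A,B\}=\{\frac01,\frac11\}$. Similarly, if $\mu>1$, there is an extra tetrahedron given by the same formula for $\{A,B\}$ equal to the unique pair of Farey neighbors $\frac\alpha a,\frac\beta b$ such that $\frac{\alpha+\beta}{a+b}=\frac pq$. (If $\frac pq=\frac12$ and $\mu,\nu\ge2$, these two extra tetrahedra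 are the same one.) (3) If $\nu>1$, there is an extra cell spanned by the $2\nu$ vertices that are the images under $\iota$ of $$\left\{\left(0,\tfrac k\nu 2\pi\right)\;\middle|\;0\le k<\nu\right\}\cup\left\{\left(\tfrac1{q\mu}2\pi,\tfrac{p+kq}{q\nu}2\pi\right)\;\middle|\;0\le k<\nu\right\}.$$ If $\nu>2$, this cell is an antiprism with regular $\nu$-gonal basis; it degenerates to a tetrahedron when $\nu=2$. Similarly, if $\mu>1$, there is an extra cell spanned by the $2\mu$ vertices that are the images under $\iota$ of $$\left\{\left(\tfrac k\mu 2\pi,0\right)\;\middle|\;0\le k<\mu\right\}\cup\left\{\left(\tfrac{p+kq}{q\mu}2\pi,\tfrac1{q\nu}2\pi\right)\;\middle|\;0\le k<\mu\right\}.$$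
   Context: Let $\mathbb{T}=(\mathbb{R}/2\pi\mathbb{Z})^2$ and $\iota:\mathbb{T}\to\mathbb{R}^4$, $\iota(u,v)=(\cos u,\sin u,\cos v,\sin v)$. $\mathbb{T}$ acts on $\mathbb{R}^4\simeq\mathbb{C}^2$ by $(s,t)\cdot(z,z')=(e^{is}z,e^{it}z')$, and $\Gamma\subset\mathbb{T}$ acts by restriction, preserving $\iota(\Gamma)$. For any finite subgroup $\Gamma$ of $\mathbb{T}$ there exist a unique rational $Q=\frac pq\in[0,1)$ (in reduced form) and a unique pair $(\mu,\nu)\in\mathbb{Z}_{>0}^2$ such that $\Gamma$ is the preimage of $\{(\frac{k}{q}2\pi,\frac{kp}{q}2\pi)\mid 0\le k<q\}$ under $\psi_{\mu\nu}:\mathbb{T}\to\mathbb{T}$, $(s,t)\mapsto(\mu s,\nu t)$; here $\mu$ and $\nu$ are the cardinalities of $\Gamma\cap(\mathbb{R}/2\pi\mathbb{Z}\times\{0\})$ and $\Gamma\cap(\{0\}\times\mathbb{R}/2\pi\mathbb{Z})$ respectively, and $\Gamma$ has order $q\mu\nu$. The case $\frac pq=0$ is put aside. Two rationals $\frac us,\frac vt$ in reduced form (with $\infty=\frac10$ allowed) are Farey neighbors if $|ut-vs|=1$. A pair of rationals $A=\frac{\alpha}{a},B=\frac{\beta}{b}\in[0,1]$ (in reduced form, $a,b\ge1$) is called admissible if $A,B$ are Farey neighbors, $Q$ lies strictly between $A$ and $B$, at most one of $A,B$ is a Farey neighbor of $Q$, and at most one of $A,B$ is a Farey neighbor of $\infty$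 (i.e. belongs to $\{0,1\}$). ''The cell spanned by'' a set of points means their convex hull.
   Formalization: In (3), second family (μ>1), the points ((p+kq)/(qμ)·2π, 1/(qν)·2π) lie in Γ only if p²≡1 mod q (fails for p/q=2/5); the formal statement replaces p there by any integer p′ with pp′≡1 mod q, which gives the printed formula when p²≡1 mod q. *)

(* Defs.v *)
From HB Require Import structures.
From mathcomp Require Import all_boot all_order all_algebra.
From mathcomp Require Import generic_quotient ring_quotient.
From mathcomp Require Import all_classical all_reals all_analysis.

Set Implicit Arguments.
Unset Strict Implicit.
Unset Printing Implicit Defensive.

Import Order.TTheory GRing.Theory Num.Theory.
Local Open Scope classical_set_scope.
Local Open Scope ring_scope.
Local Open Scope quotient_scope.

Definition two_pi_Z (R : realType) : {pred R} :=
  [pred x | x / (2 * pi) \is a Num.int].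

Lemma two_pi_Z_zmod (R : realType) : zmod_closed (@two_pi_Z R).
Proof.
by split=> [|x y]; rewrite !inE ?mul0r ?rpred0 // mulrBl; exact: rpredB.
Qed.

HB.instance Definition _ (R : realType) :=
  GRing.isZmodClosed.Build R (@two_pi_Z R) (two_pi_Z_zmod R).

Definition circle (R : realType) := Quotient.quot (@two_pi_Z R).
HB.instance Definition _ (R : realType) := GRing.Zmodule.on (circle R).

Definition torus (R : realType) : zmodType := (circle R * circle R)%type.

Definition angle (R : realType) (x : R) : circle R :=
  \pi_(Quotient.quot (@two_pi_Z R)) x.

Definition proj (R : realType) (x : R * R) : torus R := (angle x.1, angle x.2).

(* These do not depend on the representative: see cos_angle and sin_angle. *)
Definition cos_c (R : realType) (u : circle R) : R := cos (repr u).
Definition sin_c (R : realType) (u : circle R) : R := sin (repr u).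

Lemma angle_repr (R : realType) (x : R) :
  exists k : int, repr (angle x) = x + (2 * pi) * k%:~R.
Proof.
have /eqP : (angle (repr (angle x)) == angle x) by rewrite /angle reprK.
rewrite /angle => /eqP; rewrite -Quotient.idealrBE inE => /intrP[k hk].
exists k; have p0 : (2 * pi : R) != 0.
  by rewrite mulf_neq0 ?pnatr_eq0// gt_eqF ?pi_gt0.
by rewrite -hk mulrC divfK// addrC subrK.
Qed.

Lemma cos_angle (R : realType) (x : R) : cos_c (angle x) = cos x.
Proof.
rewrite /cos_c; have [k ->] := angle_repr x.
have H n (y : R) : cos (y + (2 * pi) * n%:R) = cos y.
  elim: n y => [|n IH] y; first by rewrite mulr0 addr0.
  by rewrite -[n.+1%:R]natr1 mulrDr mulr1 addrA [X in _ + X]mulr_natl cosD2pi IH.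
case: k => n; first exact: H.
by rewrite -[LHS](H n.+1) NegzE mulrNz mulrN subrK.
Qed.

Lemma sin_angle (R : realType) (x : R) : sin_c (angle x) = sin x.
Proof.
rewrite /sin_c; have [k ->] := angle_repr x.
have H n (y : R) : sin (y + (2 * pi) * n%:R) = sin y.
  elim: n y => [|n IH] y; first by rewrite mulr0 addr0.
  by rewrite -[n.+1%:R]natr1 mulrDr mulr1 addrA [X in _ + X]mulr_natl sinD2pi IH.
case: k => n; first exact: H.
by rewrite -[LHS](H n.+1) NegzE mulrNz mulrN subrK.
Qed.

Definition vec4 (R : realType) (a b c d : R) : 'rV[R]_4 :=
  \row_(i < 4) [:: a; b; c; d]`_i.

Definition iotaT (R : realType) (g : torus R) : 'rV[R]_4 :=
  vec4 (cos_c g.1) (sin_c g.1) (cos_c g.2) (sin_c g.2).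

(* (s, t) . (z, z') = (e^{is} z, e^{it} z'), where (z, z') in C^2 is
   (x 0 0, x 0 1, x 0 2, x 0 3) in R^4. *)
Definition act (R : realType) (g : torus R) (x : 'rV[R]_4) : 'rV[R]_4 :=
  vec4 (cos_c g.1 * x 0 0 - sin_c g.1 * x 0 1)
       (sin_c g.1 * x 0 0 + cos_c g.1 * x 0 1)
       (cos_c g.2 * x 0 2 - sin_c g.2 * x 0 3)
       (sin_c g.2 * x 0 2 + cos_c g.2 * x 0 3).

Definition hull (R : realType) (n : nat) (A : set 'rV[R]_n) : set 'rV[R]_n :=
  smallest (@convex_set R 'rV[R]_n) A.

Definition dot (R : realType) (n : nat) (x y : 'rV[R]_n) : R :=
  \sum_(i < n) x 0 i * y 0 i.

Definition aff_independent (R : realType) (n k : nat)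
    (x : 'I_k.+1 -> 'rV[R]_n) : bool :=
  row_free (\matrix_(i < k) (x (lift ord0 i) - x ord0)).

(* The affine span of A has dimension k. *)
Definition has_dim (R : realType) (n k : nat) (A : set 'rV[R]_n) : Prop :=
  (exists2 x : 'I_k.+1 -> 'rV[R]_n, (forall i, A (x i)) & aff_independent x) /\
  (forall x : 'I_k.+2 -> 'rV[R]_n, (forall i, A (x i)) -> ~~ aff_independent x).

(* F is a face of K of dimension k: the intersection of K with a hyperplane
   bounding a half-space that contains K (l = 0 gives K itself). *)
Definition face_of_dim (R : realType) (n k : nat) (K F : set 'rV[R]_n) : Prop :=
  has_dim k F /\
  exists (l : 'rV[R]_n) (c : R),
    (forall x, K x -> dot l x <= c) /\ F = K `&` [set x | dot l x = c].

Definition vertices (R : realType) (n : nat) (K : set 'rV[R]_n) : set 'rV[R]_n :=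
  [set x | face_of_dim 0 K [set x]].

Definition is_tetrahedron (R : realType) (n : nat) (C : set 'rV[R]_n) : Prop :=
  exists2 x : 'I_4 -> 'rV[R]_n, aff_independent x & C = hull (range x).

(* For e, f orthogonal of equal norm, k |-> ngon m o e f t k (periodic in k)
   runs through the vertices of a regular m-gon of center o in the plane
   directed by e and f, the vertex k = 0 being at angle t from e. *)
Definition ngon (R : realType) (n m : nat) (o e f : 'rV[R]_n) (t : R) (k : nat)
    : 'rV[R]_n :=
  o + cos (t + 2 * pi * k%:R / m%:R) *: e + sin (t + 2 * pi * k%:R / m%:R) *: f.

(* An antiprism with regular m-gonal bases: the 3-dimensional convex hull of two
   directly congruent regular m-gons P, P' in parallel planes, whose lateral
   faces are an alternating band of 2m triangles.  Neither the twist t of P'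
   relative to P nor the isosceles shape of the triangles is prescribed. *)
Definition is_antiprism (R : realType) (n m : nat) (C : set 'rV[R]_n) : Prop :=
  exists (o o' e f : 'rV[R]_n) (t : R),
    let P := ngon m o e f 0 in
    let P' := ngon m o' e f t in
    [/\ [/\ dot e f = 0, dot e e = dot f f & 0 < dot e e],
        C = hull (range P `|` range P'),
        has_dim 3 C &
        forall F, face_of_dim 2 C F <->
          [\/ F = hull (range P), F = hull (range P'),
              exists k, F = hull [set P k; P k.+1; P' k] |
              exists k, F = hull [set P k.+1; P' k; P' k.+1]]].

(* P0, P1, P3, P2 is a nondegenerate parallelogram, with diagonals P0 P3 and
   P1 P2 meeting at c. *)
Definition parallelogram_center (R : realType) (P0 P1 P2 P3 c : R * R) : Prop :=
  [/\ P0 + P3 = c *+ 2, P1 + P2 = c *+ 2 &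
      (P1 - P0).1 * (P2 - P0).2 - (P1 - P0).2 * (P2 - P0).1 != 0].

(* Some r is the rational r in reduced form, None is infinity = 1/0. *)
Definition fnum (x : option rat) : int := if x is Some r then numq r else 1.
Definition fden (x : option rat) : int := if x is Some r then denq r else 0.

Definition farey (x y : option rat) : bool :=
  `|fnum x * fden y - fnum y * fden x| == 1.

Definition admissible (Q A B : rat) : bool :=
  [&& 0 <= A <= 1, 0 <= B <= 1, farey (Some A) (Some B),
      (A < Q < B) || (B < Q < A),
      ~~ (farey (Some A) (Some Q) && farey (Some B) (Some Q)) &
      ~~ (farey (Some A) None && farey (Some B) None)].

Definition farey_parents (Q A B : rat) : bool :=
  farey (Some A) (Some B) &&
  ((numq A + numq B)%:~R / (denq A + denq B)%:~R == Q).

Definition finite_subgroup (R : realType) (G : set (torus R)) : Prop :=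
  [/\ finite_set G, G 0 & forall g h, G g -> G h -> G (g - h)].

Definition psi (R : realType) (mu nu : nat) (g : torus R) : torus R :=
  (g.1 *+ mu, g.2 *+ nu).

Definition has_data (R : realType) (G : set (torus R)) (Q : rat) (mu nu : nat)
    : Prop :=
  [/\ 0 <= Q < 1, (0 < mu)%N, (0 < nu)%N &
      G = psi mu nu @^-1`
        [set g | exists2 k : int, 0 <= k < denq Q &
           g = proj (k%:~R / (denq Q)%:~R * (2 * pi),
                     (k * numq Q)%:~R / (denq Q)%:~R * (2 * pi))]].

Section Cells.
Variables (R : realType) (Q : rat) (mu nu : nat).
Local Notation p := ((numq Q)%:~R : R).
Local Notation q := ((denq Q)%:~R : R).

(* The lift to the plane of the point attached to the pair (x, a), which stands
   for the fraction x / a. *)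
Definition lift_pt (x a : int) : R * R :=
  (a%:~R / (q * mu%:R) * (2 * pi),
   (a%:~R * p - x%:~R * q) / (q * nu%:R) * (2 * pi)).

Definition lift_pt_frac (A : rat) : R * R := lift_pt (numq A) (denq A).

Definition lift_pt_mediant (A B : rat) : R * R :=
  lift_pt (numq A + numq B) (denq A + denq B).

Definition tetra_center (A B : rat) : R * R :=
  ((denq A + denq B)%:~R / (q * mu%:R) * pi,
   ((denq A + denq B)%:~R * p - (numq A + numq B)%:~R * q) / (q * nu%:R) * pi).

Definition tetra_pts (A B : rat) : set (torus R) :=
  [set proj (0, 0); proj (lift_pt_frac A); proj (lift_pt_frac B);
       proj (lift_pt_mediant A B)].

Definition nu_pts : set (torus R) :=
  [set proj (0, k%:R / nu%:R * (2 * pi)) | k in `I_nu] `|`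
  [set proj (1 / (q * mu%:R) * (2 * pi),
             (p + k%:R * q) / (q * nu%:R) * (2 * pi)) | k in `I_nu].

(* p' is meant to be an inverse of p modulo q: the second family lies in the
   subgroup exactly in this case. *)
Definition mu_pts (p' : int) : set (torus R) :=
  [set proj (k%:R / mu%:R * (2 * pi), 0) | k in `I_mu] `|`
  [set proj ((p'%:~R + k%:R * q) / (q * mu%:R) * (2 * pi),
             1 / (q * nu%:R) * (2 * pi)) | k in `I_mu].

End Cells.

Arguments tetra_pts : clear implicits.
Arguments nu_pts : clear implicits.
Arguments mu_pts : clear implicits.

Definition spanned_cell (R : realType) (S : set (torus R)) : set 'rV[R]_4 :=
  hull (@iotaT R @` S).

(* S is the set of points of the torus whose images span a cell of the list. *)
Variant cell_pts (R : realType) (Q : rat) (mu nu : nat) (p' : int)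
    (S : set (torus R)) : Prop :=
| Cell_admissible (A B : rat) of admissible Q A B & S = tetra_pts R Q mu nu A B
| Cell_tetra_nu of (1 < nu)%N & S = tetra_pts R Q mu nu 0 1
| Cell_tetra_mu (A B : rat) of (1 < mu)%N & farey_parents Q A B
    & S = tetra_pts R Q mu nu A B
| Cell_nu of (1 < nu)%N & S = nu_pts R Q mu nu
| Cell_mu of (1 < mu)%N & S = mu_pts R Q mu nu p'.

Definition tetra_cell (R : realType) (G : set (torus R)) (Q : rat) (mu nu : nat)
    (A B : rat) : Prop :=
  [/\ tetra_pts R Q mu nu A B `<=` G,
      is_tetrahedron (spanned_cell (tetra_pts R Q mu nu A B)) &
      parallelogram_center (0, 0) (lift_pt_frac R Q mu nu A)
        (lift_pt_frac R Q mu nu B) (lift_pt_mediant R Q mu nu A B)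
        (tetra_center R Q mu nu A B)].

Definition antiprism_cell (R : realType) (G : set (torus R)) (m : nat)
    (S : set (torus R)) : Prop :=
  [/\ S `<=` G,
      (@iotaT R @` S #= `I_(2 * m)%N)%card /\
      vertices (spanned_cell S) = @iotaT R @` S,
      (2 < m)%N -> is_antiprism m (spanned_cell S) &
      m = 2%N -> is_tetrahedron (spanned_cell S)].

(* Main.v *)
Require Import Defs.
From mathcomp Require Import all_boot all_order all_algebra.
From mathcomp Require Import generic_quotient ring_quotient.
From mathcomp Require Import all_classical all_reals all_analysis.
From mathcomp Require Import ring lra zify.

Set Implicit Arguments.
Unset Strict Implicit.
Unset Printing Implicit Defensive.

Import Order.TTheory GRing.Theory Num.Theory.
Import numFieldNormedType.Exports.
Local Open Scope classical_set_scope.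
Local Open Scope quotient_scope.
Local Open Scope ring_scope.

(** The points of the subgroup are the (2 pi x / (q mu), 2 pi y / (q nu)) with
    (x, y) in the lattice q | y - p x, taken modulo the periods q mu and q nu.
    At such a point a linear functional of R^4 is a wave
    r1 cos (2 pi x / (q mu) - s0) + r2 cos (2 pi y / (q nu) - t0), so a facet is
    the set of maximizers of a wave on the lattice.

    Assume r1, r2 > 0 and lift the maximizers to phases in [- pi, pi].  If z lies
    in the box of two maximizers P1, P2 and z' = P1 + P2 - z, the sum formulas for
    the cosine give f z + f z' >= f P1 + f P2 as soon as the middle phases have
    nonnegative cosines; hence the box has no other lattice point.  When a middle
    phase is on the wrong side, one passes to the lift on the other side of the
    circle: this is contradictory if the multiplicity mu or nu in that direction
    is above 1, and if it is 1 the lattice points of the box are on a line on which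
    the wave has the form S cos (z - e) - T cos (n z), a unimodal function on the
    relevant interval (maximizers_empty).  Lattice points with pairwise empty boxes
    are distinct modulo twice the lattice, as a lattice point at the middle of two of
    them would be in their box, so there are at most four of them.  If there are four,
    they are the leftmost, the rightmost, the lowest and the highest one, and they form
    a parallelogram with sides (a, c) and (b, - d) such that a, b, c, d > 0 and
    a d + b c = q (empty_family_parallelogram).

    Conversely, such a parallelogram is the set of maximizers of some wave
    (parallelogram_supported): no lattice point lies in an open box around its
    centre, so an edge of the convex hull of the points (cos X, cos Y), phases being
    measured from the centre, provides a wave with four maximizers symmetric about
    the centre; they form a parallelogram, which can only be the given one.  Its
    vertices are affinely independent, since otherwise a perturbation of the wave
    would have five maximizers (parallelogram_nondegenerate).

    If r2 = 0, the wave is maximal on one column of the lattice or on two consecutive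
    ones.  A column lies in a plane, so the facet consists of two columns, which are two
    regular nu-gons in parallel planes; the exchange of the two circles treats
    r1 = 0.  This proves facetsP.  The two-dimensional faces of the cell of
    two columns are found in the same way (band_antiprism): on each base a functional
    is a cosine, maximal at one vertex or along one edge.

    Finally (a, c) is attached to the fraction alpha / a with c = a p - alpha q, and
    a d + b c = q says that the two fractions around p / q are Farey neighbors.  The
    four vertices are distinct in the subgroup if and only if a + b < q mu and
    c + d < q nu.  As a + b <= q with equality only if c = d = 1, and c + d <= q with
    equality only if a = b = 1, these bounds fail only for the parents of p / q when
    mu = 1 and for the pair 0 / 1, 1 / 1 when nu = 1 (cell_ptsP). *)

(** * Lattice points with pairwise empty boxes *)

Definition lat (q p x y : int) : Prop := exists k : int, y = p * x + q * k.

Definition between (a b z : int) : Prop := a <= z <= b \/ b <= z <= a.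

Definition empty_box (q p x1 y1 x2 y2 : int) : Prop :=
  forall x y, lat q p x y -> between x1 x2 x -> between y1 y2 y ->
    (x = x1 /\ y = y1) \/ (x = x2 /\ y = y2).

Lemma latD q p x y x' y' : lat q p x y -> lat q p x' y' -> lat q p (x + x') (y + y').
Proof. by move=> [k ->] [l ->]; exists (k + l); ring. Qed.

Lemma latB q p x y x' y' : lat q p x y -> lat q p x' y' -> lat q p (x - x') (y - y').
Proof. by move=> [k ->] [l ->]; exists (k - l); ring. Qed.

Lemma latZ q p n x y : lat q p x y -> lat q p (n * x) (n * y).
Proof. by move=> [k ->]; exists (n * k); ring. Qed.

Lemma lat0 q p : lat q p 0 0.
Proof. by exists 0; ring. Qed.

(** Two lattice vectors of determinant q form a basis of the lattice. *)
Lemma lat_decomp q p a c b d x y : 0 < q -> lat q p a c -> lat q p b (- d) -> a * d + b * c = q ->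
  lat q p x y -> exists i j, x = i * a + j * b /\ y = i * c - j * d.
Proof.
move=> q0 [k1 ec] [k2 ed] D [k ek].
have qI z z' : q * z = q * z' -> z = z' by apply: mulfI; exact: lt0r_neq0.
have ed' : d = - (p * b + q * k2) by rewrite -ed opprK.
exists (b * k - x * k2), (k1 * x - a * k); split; apply: qI; rewrite -{1}D ?ek ed' ec; ring.
Qed.

Lemma weighted_sum (a c b d : int) : 0 < a -> 0 < c -> 0 < b -> 0 < d ->
  a + b <= a * d + b * c /\ (a + b = a * d + b * c -> c = 1 /\ d = 1).
Proof.
move=> a0 c0 b0 d0; have e : a * d + b * c = a + b + a * (d - 1) + b * (c - 1) by ring.
have h1 : 0 <= a * (d - 1) by rewrite mulr_ge0 ?subr_ge0 // ltW.
have h2 : 0 <= b * (c - 1) by rewrite mulr_ge0 ?subr_ge0 // ltW.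
split=> [|e2]; first by clear - e h1 h2; lia.
have z1 : a * (d - 1) = 0 by clear - e e2 h1 h2; lia.
have z2 : b * (c - 1) = 0 by clear - e e2 h1 h2; lia.
move/eqP: z1; move/eqP: z2; rewrite !mulf_eq0 (gt_eqF a0) (gt_eqF b0) !subr_eq0.
by move=> /eqP -> /eqP ->.
Qed.

(** In the equality cases a diagonal of the parallelogram with sides (a, c) and
    (b, - d) is (q, 0) or (0, q). *)
Lemma area_bounds (a b c d q : int) : 0 < a -> 0 < c -> 0 < b -> 0 < d -> a * d + b * c = q ->
  [/\ a + b <= q, c + d <= q, a + b = q -> c = 1 /\ d = 1 & c + d = q -> a = 1 /\ b = 1].
Proof.
move=> a0 c0 b0 d0 <-; have [l1 e1] := weighted_sum a0 c0 b0 d0.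
have [l2 e2] := weighted_sum c0 a0 d0 b0.
by have e : c * b + d * a = a * d + b * c by [ring]; rewrite e in l2 e2; split.
Qed.

Section Family.
Variables (q p : int) (E : int -> int -> Prop).
Hypothesis Elat : forall x y, E x y -> lat q p x y.
Hypothesis Eempty : forall x y x' y', E x y -> E x' y' -> empty_box q p x y x' y'.

(** Of four points of E lying to the left, to the right, below and above (x, y), two
    lie in opposite closed quadrants around (x, y), and their box contains it. *)
Lemma bounding_box x y xl yl xr yr xd yd xu yu : lat q p x y ->
  E xl yl -> E xr yr -> E xd yd -> E xu yu ->
  xl <= x -> x <= xr -> yd <= y -> y <= yu -> E x y.
Proof.
move=> hz hl hr hd hu xlx xxr ydy yyu.
have key x1 y1 x2 y2 : E x1 y1 -> E x2 y2 -> between x1 x2 x -> between y1 y2 y -> E x y.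
  by move=> e1 e2 b1 b2; have [[-> ->]|[-> ->]] := Eempty e1 e2 hz b1 b2.
have [xu1|xu1] := lerP x xu; have [xd1|xd1] := lerP x xd;
have [yl1|yl1] := lerP y yl; have [yr1|yr1] := lerP y yr;
try (by apply: (key _ _ _ _ hd hu); rewrite /between; lia);
try (by apply: (key _ _ _ _ hl hr); rewrite /between; lia);
try (by apply: (key _ _ _ _ hl hd); rewrite /between; lia);
try (by apply: (key _ _ _ _ hl hu); rewrite /between; lia);
try (by apply: (key _ _ _ _ hr hd); rewrite /between; lia);
by apply: (key _ _ _ _ hr hu); rewrite /between; lia.
Qed.

End Family.

Lemma independent_combination (x1 y1 x2 y2 i j : int) : x1 * y2 - x2 * y1 != 0 ->
  i * x1 + j * x2 = 0 -> i * y1 + j * y2 = 0 -> i = 0 /\ j = 0.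
Proof.
move=> D e1 e2.
have h1 : i * (x1 * y2 - x2 * y1) = 0.
  rewrite (_ : _ * _ = (i * x1 + j * x2) * y2 - (i * y1 + j * y2) * x2); last by ring.
  by rewrite e1 e2; ring.
have h2 : j * (x1 * y2 - x2 * y1) = 0.
  rewrite (_ : _ * _ = (i * y1 + j * y2) * x1 - (i * x1 + j * x2) * y1); last by ring.
  by rewrite e1 e2; ring.
by move/eqP: h1; move/eqP: h2; rewrite !mulf_eq0 (negbTE D) !orbF => /eqP -> /eqP ->.
Qed.

Lemma seq_argmax (R : realDomainType) (T : eqType) (s : seq T) (f : T -> R) x0 : x0 \in s ->
  exists2 x, x \in s & forall y, y \in s -> f y <= f x.
Proof.
elim: s x0 => // a s IH x0 _.
case: s IH => [_|b s IH]; first by exists a => [|y]; rewrite !inE // => /eqP ->.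
have [x xs hx] := IH b (mem_head _ _).
have [h|h] := lerP (f a) (f x).
  exists x => [|y]; first by rewrite inE xs orbT.
  by rewrite inE => /orP[/eqP -> //|]; exact: hx.
exists a => [|y]; first exact: mem_head.
by rewrite inE => /orP[/eqP -> //|/hx h']; exact: le_trans h' (ltW h).
Qed.

(** Reducing the coordinates of a lattice point in the basis of the two vectors puts it into the
    half-open parallelogram.  As this only contains the origin, the coordinates are
    integers.  If the determinant is q k, this applied to (1, p) and (0, q) shows that k ^ 2
    divides k. *)
Lemma basis_determinant (q p x1 y1 x2 y2 : int) : 0 < q ->
  lat q p x1 y1 -> lat q p x2 y2 -> 0 < x1 * y2 - x2 * y1 ->
  (forall x y i j K, lat q p x y -> 0 <= i -> i < K -> 0 <= j -> j < K ->
     K * x = i * x1 + j * x2 -> K * y = i * y1 + j * y2 -> i = 0 /\ j = 0) ->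
  x1 * y2 - x2 * y1 = q.
Proof.
move=> q0 l1 l2 + tri; have [k1 e1] := l1; have [k2 e2] := l2.
pose k := x1 * k2 - x2 * k1.
have -> : x1 * y2 - x2 * y1 = q * k by rewrite e1 e2 /k; ring.
rewrite pmulr_rgt0 // => k0.
have main (x y i j : int) : lat q p x y -> k * x = i * x1 + j * x2 ->
    k * y = i * y1 + j * y2 -> exists i' j', i = k * i' /\ j = k * j'.
  move=> l ex ey; exists (i %/ k)%Z, (j %/ k)%Z.
  have [] := tri (x - (i %/ k)%Z * x1 - (j %/ k)%Z * x2) (y - (i %/ k)%Z * y1 - (j %/ k)%Z * y2)
    (i %% k)%Z (j %% k)%Z k; rewrite ?modz_ge0 ?ltz_pmod ?lt0r_neq0 //.
  - by apply: latB; [apply: latB => //|]; exact: latZ.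
  - by rewrite !mulrBr ex {1}(divz_eq i k) {1}(divz_eq j k); ring.
  - by rewrite !mulrBr ey {1}(divz_eq i k) {1}(divz_eq j k); ring.
  by move=> hi hj; rewrite {1}(divz_eq i k) {1}(divz_eq j k) hi hj !addr0 ![k * _]mulrC.
have [|||i1 [j1 [f1 f2]]] := main 1 p k2 (- k1).
- by exists 0; ring.
- by rewrite /k; ring.
- by rewrite /k e1 e2; ring.
have [|||i2 [j2 [f3 f4]]] := main 0 q (- x2) x1.
- by exists 1; ring.
- by ring.
- by rewrite /k e1 e2; ring.
have : k * 1 = k * (k * (j2 * i1 - i2 * j1)).
  by rewrite mulr1 {1}/k f1 f4 -[x2]opprK f3 -[k1]opprK f2; ring.
move=> /(mulfI (lt0r_neq0 k0)) e; have : (k %| 1)%Z by apply/dvdzP; eexists; rewrite mulrC; exact: e.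
by rewrite dvdz1 => h; have -> : k = 1 by [clear - h k0; lia]; rewrite mulr1.
Qed.

Lemma neq_pair (u v : int * int) : u != v -> u.1 <> v.1 \/ u.2 <> v.2.
Proof.
by case: u v => [x y] [x' y']; rewrite xpair_eqE negb_and => /orP[] /eqP; [left|right].
Qed.

Section Family.
Variables (q p : int) (E : int -> int -> Prop).
Hypothesis q0 : 0 < q.
Hypothesis Elat : forall x y, E x y -> lat q p x y.
Hypothesis Eempty : forall x y x' y', E x y -> E x' y' -> empty_box q p x y x' y'.

(** For a, b, c, d > 0 one side has positive slope and the other negative slope. *)
Definition in_parallelogram (x0 y0 a c b d x y : int) : Prop :=
  [\/ x = x0 /\ y = y0, x = x0 + a /\ y = y0 + c, x = x0 + b /\ y = y0 - d |
      x = x0 + (a + b) /\ y = y0 + (c - d)].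

Lemma midpoint_in x y x' y' u v : E x y -> E x' y' -> lat q p u v ->
  u + u = x + x' -> v + v = y + y' -> x = x' /\ y = y'.
Proof.
move=> e e' l hu hv; have := Eempty e e' l.
by rewrite /between; clear - hu hv; lia.
Qed.

(** Two points in the same class modulo twice the lattice would have a lattice point at their
    middle, in their box; there are four classes. *)
Lemma at_most_four (s : seq (int * int)) : (forall z : int * int, z \in s -> E z.1 z.2) -> uniq s ->
  (size s <= 4)%N.
Proof.
move=> sE us; pose cls (z : int * int) := (odd `|z.1|, odd `|((z.2 - p * z.1) %/ q)%Z|).
have clsI : {in s &, injective cls}.
  move=> [x y] [x' y'] /sE /= e /sE /= e'.
  have [k ek] := Elat e; have [k' ek'] := Elat e'.
  have dE (z w : int) : ((p * z + q * w - p * z) %/ q)%Z = w by rewrite addrAC subrr add0r mulKz // lt0r_neq0.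
  rewrite /cls /= ek ek' !dE => -[h1 h2].
  have [u hu] : exists u, u + u = x + x' by exists ((x + x') %/ 2)%Z; clear - h1; lia.
  have [w hw] : exists w, w + w = k + k' by exists ((k + k') %/ 2)%Z; clear - h2; lia.
  rewrite -ek -ek'; have [|||-> -> //] := @midpoint_in x y x' y' u (p * u + q * w) e e'.
  - by exists w.
  - exact: hu.
  - transitivity (p * (u + u) + q * (w + w)); first by ring.
    by rewrite hu hw ek ek'; ring.
by rewrite -(size_map cls) -(card_uniqP _) ?map_inj_in_uniq // (leq_trans (max_card _)) // card_prod card_bool.
Qed.

(** If z0 is weakly extreme in both directions, the other three points are pairwise
    incomparable, so one of them is in the box of the two others. *)
Lemma no_corner (z0 z1 z2 z3 : int * int) (s t : int) : uniq [:: z0; z1; z2; z3] ->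
  (forall z : int * int, z \in [:: z0; z1; z2; z3] -> [/\ E z.1 z.2, s * z0.1 <= s * z.1 & t * z0.2 <= t * z.2]) ->
  s = 1 \/ s = -1 -> t = 1 \/ t = -1 -> False.
Proof.
move=> + H hs ht.
have [[e0 _ _] [e1 x1 y1] [e2 x2 y2] [e3 x3 y3]] : [/\ [/\ E z0.1 z0.2, s * z0.1 <= s * z0.1 & t * z0.2 <= t * z0.2],
  [/\ E z1.1 z1.2, s * z0.1 <= s * z1.1 & t * z0.2 <= t * z1.2],
  [/\ E z2.1 z2.2, s * z0.1 <= s * z2.1 & t * z0.2 <= t * z2.2] &
  [/\ E z3.1 z3.2, s * z0.1 <= s * z3.1 & t * z0.2 <= t * z3.2]].
  by split; apply: H; rewrite !inE eqxx ?orbT.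
have cmp u v : E u.1 u.2 -> E v.1 v.2 -> s * z0.1 <= s * u.1 -> t * z0.2 <= t * u.2 ->
    u != z0 -> u != v -> s * v.1 < s * u.1 \/ t * v.2 < t * u.2.
  move=> eu ev hx hy /neq_pair n0 /neq_pair nv.
  have := Eempty e0 ev (Elat eu); rewrite /between.
  by case: hs hx => ->; case: ht hy => ->; clear - n0 nv; lia.
have mid u v w : E u.1 u.2 -> E v.1 v.2 -> E w.1 w.2 -> v != u -> v != w ->
    s * u.1 < s * v.1 -> s * v.1 < s * w.1 -> t * v.2 < t * u.2 -> t * w.2 < t * v.2 -> False.
  move=> eu ev ew /neq_pair n0 /neq_pair nv.
  have := Eempty eu ew (Elat ev); rewrite /between.
  by case: hs => ->; case: ht => ->; clear - n0 nv; lia.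
rewrite /= !inE !negb_or => /and4P[/and3P[n01 n02 n03] /andP[n12 n13] n23 _].
have c12 := cmp z1 z2 e1 e2 x1 y1; have c21 := cmp z2 z1 e2 e1 x2 y2.
have c13 := cmp z1 z3 e1 e3 x1 y1; have c31 := cmp z3 z1 e3 e1 x3 y3.
have c23 := cmp z2 z3 e2 e3 x2 y2; have c32 := cmp z3 z2 e3 e2 x3 y3.
have m123 := mid z1 z2 z3 e1 e2 e3; have m321 := mid z3 z2 z1 e3 e2 e1.
have m213 := mid z2 z1 z3 e2 e1 e3; have m312 := mid z3 z1 z2 e3 e1 e2.
have m132 := mid z1 z3 z2 e1 e3 e2; have m231 := mid z2 z3 z1 e2 e3 e1.
rewrite ![_ == z0]eq_sym ![z2 == z1]eq_sym ![z3 == z1]eq_sym ![z3 == z2]eq_sym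
  in c12 c21 c13 c31 c23 c32 m123 m321 m213 m312 m132 m231.
have {}c12 := c12 n01 n12; have {}c21 := c21 n02 n12; have {}c13 := c13 n01 n13.
have {}c31 := c31 n03 n13; have {}c23 := c23 n02 n23; have {}c32 := c32 n03 n23.
have {}m123 := m123 n12 n23; have {}m321 := m321 n23 n12; have {}m213 := m213 n12 n13.
have {}m312 := m312 n13 n12; have {}m132 := m132 n13 n23; have {}m231 := m231 n23 n13.
clear - c12 c21 c13 c31 c23 c32 m123 m321 m213 m312 m132 m231; lia.
Qed.

(** By no_corner the leftmost, rightmost, lowest and highest points A, B, C, D are distinct.
    One of A + B - C and A + B - D is in the bounding box, hence in E by bounding_box, and it
    can only be D, respectively C.  The parallelogram is in the bounding box, so it contains no
    other lattice point. *)
Lemma empty_family_parallelogram x0 y0 x1 y1 x2 y2 x3 y3 :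
  E x0 y0 -> E x1 y1 -> E x2 y2 -> E x3 y3 ->
  x0 <> x1 \/ y0 <> y1 -> x0 <> x2 \/ y0 <> y2 -> x0 <> x3 \/ y0 <> y3 ->
  x1 <> x2 \/ y1 <> y2 -> x1 <> x3 \/ y1 <> y3 -> x2 <> x3 \/ y2 <> y3 ->
  exists xo yo a c b d, [/\ [/\ 0 < a, 0 < c, 0 < b & 0 < d],
    [/\ lat q p a c, lat q p b (- d) & a * d + b * c = q] &
    forall x y, E x y <-> in_parallelogram xo yo a c b d x y].
Proof.
move=> e0 e1 e2 e3 n01 n02 n03 n12 n13 n23.
pose P := [:: (x0, y0); (x1, y1); (x2, y2); (x3, y3)].
have np (x y x' y' : int) : x <> x' \/ y <> y' -> (x, y) != (x', y').
  by move=> h; apply/eqP => -[ex ey]; clear - h ex ey; lia.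
have uP : uniq P.
  by rewrite /P /= !inE !negb_or (np _ _ _ _ n01) (np _ _ _ _ n02) (np _ _ _ _ n03)
    (np _ _ _ _ n12) (np _ _ _ _ n13) (np _ _ _ _ n23).
have PE z : z \in P -> E z.1 z.2 by rewrite !inE => /or4P[] /eqP ->.
have corner (A : int * int) (s t : int) : A \in P ->
    (forall z : int * int, z \in P -> s * A.1 <= s * z.1 /\ t * A.2 <= t * z.2) ->
    s = 1 \/ s = -1 -> t = 1 \/ t = -1 -> False.
  move=> AP hA; have pe := perm_to_rem AP; have := size_rem AP.
  case: (rem A P) pe => [|z1 [|z2 [|z3 []]]] // pe _.
  apply: (@no_corner A z1 z2 z3 s t); first by rewrite -(perm_uniq pe).
  by move=> z; rewrite -(perm_mem pe) => zP; have [] := hA z zP; split=> //; exact: PE.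
have ext (f : int * int -> int) : exists2 A : int * int, A \in P &
    forall z : int * int, z \in P -> f z <= f A.
  exact: (seq_argmax f (mem_head _ _)).
have [A AP hA] := ext (fun z => - z.1).
have [B BP hB] := ext (fun z => z.1).
have [C CP hC] := ext (fun z => - z.2).
have [D DP hD] := ext (fun z => z.2).
have nAC : A != C.
  apply/eqP => e; apply: (corner A 1 1); rewrite ?AP //; [|by left|by left].
  by move=> z zP; have := hA z zP; have := hC z zP; rewrite -e; clear; lia.
have nAD : A != D.
  apply/eqP => e; apply: (corner A 1 (-1)); rewrite ?AP //; [|by left|by right].
  by move=> z zP; have := hA z zP; have := hD z zP; rewrite -e; clear; lia.
have nBC : B != C.
  apply/eqP => e; apply: (corner B (-1) 1); rewrite ?BP //; [|by right|by left].
  by move=> z zP; have := hB z zP; have := hC z zP; rewrite -e; clear; lia.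
have nBD : B != D.
  apply/eqP => e; apply: (corner B (-1) (-1)); rewrite ?BP //; [|by right|by right].
  by move=> z zP; have := hB z zP; have := hD z zP; rewrite -e; clear; lia.
(* a flat family would have a corner *)
have nAB : A != B.
  apply/eqP => e; apply: (corner C 1 1); rewrite ?CP //; [|by left|by left].
  by move=> z zP; have := hA z zP; have := hB C CP; have := hC z zP; rewrite -e; clear; lia.
have nCD : C != D.
  apply/eqP => e; apply: (corner A 1 1); rewrite ?AP //; [|by left|by left].
  by move=> z zP; have := hA z zP; have := hD A AP; have := hC z zP; rewrite -e; clear; lia.
have fs (u : int * int) (x y : int) : (x, y) = u -> x = u.1 /\ y = u.2 by move=> <-.
have four x y : E x y -> (x, y) \in [:: A; B; C; D].
  move=> e; apply: contraT => nz.
  have : (size [:: (x, y); A; B; C; D] <= 4)%N; last by [].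
  apply: at_most_four.
    by move=> z; rewrite inE => /orP[/eqP -> //|]; rewrite !inE => /or4P[] /eqP ->; exact: PE.
  by rewrite [uniq _]/= nz /= !inE !negb_or nAB nAC nAD nBC nBD nCD.
have [eA eB eC eD] : [/\ E A.1 A.2, E B.1 B.2, E C.1 C.2 & E D.1 D.2] by split; exact: PE.
have := (hA B BP, hA C CP, hA D DP, hB C CP, hB D DP).
have := (hC A AP, hC B BP, hC D DP, hD A AP, hD B BP).
move=> [] [] [] [] c1 c2 c3 d1 d2 [] [] [] [] a1 a2 a3 b1 b2.
move/neq_pair: nAB => mAB; move/neq_pair: nAC => mAC; move/neq_pair: nAD => mAD.
move/neq_pair: nBC => mBC; move/neq_pair: nBD => mBD; move/neq_pair: nCD => mCD.
have other (V W : int * int) : E V.1 V.2 -> A.1 <> V.1 \/ A.2 <> V.2 -> B.1 <> V.1 \/ B.2 <> V.2 ->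
    E (A.1 + B.1 - V.1) (A.2 + B.2 - V.2) -> [:: A; B; V; W] =i [:: A; B; C; D] ->
    A.1 + B.1 = V.1 + W.1 /\ A.2 + B.2 = V.2 + W.2.
  move=> eV nA nB /four z sW; move: z; rewrite -sW !inE => /or4P[] /eqP/fs[h1 h2].
  - by clear - nB h1 h2; lia.
  - by clear - nA nB h1 h2; lia.
  - have [] := midpoint_in eA eB (Elat eV) (ltac:(clear - h1; lia)) (ltac:(clear - h2; lia)).
    by clear - mAB; lia.
  - by clear - h1 h2; lia.
have [s1 s2] : A.1 + B.1 = C.1 + D.1 /\ A.2 + B.2 = C.2 + D.2.
  have lz (V : int * int) : E V.1 V.2 -> lat q p (A.1 + B.1 - V.1) (A.2 + B.2 - V.2).
    by move=> eV; apply: latB (Elat eV); exact: latD (Elat eA) (Elat eB).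
  have [h|h] := lerP (A.2 + B.2) (C.2 + D.2).
    apply: (other C D) => //.
    by apply: (bounding_box Eempty (lz C eC) eA eB eC eD); clear - a2 b1 c1 c2 h; lia.
  rewrite (addrC C.1) (addrC C.2); apply: (other D C) => //; last first.
    by move=> z; rewrite !inE (orbC (z == D)).
  by apply: (bounding_box Eempty (lz D eD) eA eB eC eD); clear - a3 b2 d1 d2 h; lia.
have posA : 0 < D.1 - A.1 /\ 0 < C.1 - A.1.
  have := Eempty eC eD (Elat eA); rewrite /between; clear - a2 a3 c1 d1 mAC mAD; lia.
have posC : 0 < D.2 - A.2.
  have := Eempty eA eB (Elat eD); rewrite /between; clear - a3 b2 d1 s2 c2 mAD mBD; lia.
have posD : 0 < A.2 - C.2.
  have := Eempty eA eB (Elat eC); rewrite /between; clear - a2 b1 c1 c2 mAC mBC; lia.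
exists A.1, A.2, (D.1 - A.1), (D.2 - A.2), (C.1 - A.1), (A.2 - C.2).
have lac := latB (Elat eD) (Elat eA).
have lbd : lat q p (C.1 - A.1) (- (A.2 - C.2)) by rewrite opprB; exact: latB (Elat eC) (Elat eA).
case: posA => a0 b0; split=> // [|x y].
  split=> //; rewrite -[RHS](@basis_determinant q p (C.1 - A.1) (- (A.2 - C.2)) (D.1 - A.1) (D.2 - A.2) q0 lbd lac).
  - by ring.
  - rewrite mulrN opprK addr_gt0 // mulr_gt0 //.
  move=> x y i j k l i0 ik j0 jk ex ey; have k0 : 0 < k by exact: le_lt_trans ik.
  set a := D.1 - A.1 in a0 ex *; set b := C.1 - A.1 in b0 ex *.
  set c := D.2 - A.2 in posC ey *; set d := A.2 - C.2 in posD ey *.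
  have [h1 h2 h3 h4] : [/\ 0 <= i * b, 0 <= j * a, 0 <= i * d & 0 <= j * c].
    by split; apply: mulr_ge0 => //; exact: ltW.
  have [h5 h6 h7 h8] : [/\ i * b <= k * b, j * a <= k * a, i * d <= k * d & j * c <= k * c].
    by rewrite !ler_pM2r //; split; exact: ltW.
  have hx1 : 0 <= x by rewrite -(ler_pM2l k0) mulr0 ex addr_ge0.
  have hx2 : x <= a + b by rewrite -(ler_pM2l k0) ex; clear - h5 h6; lia.
  have hy1 : - d <= y by rewrite -(ler_pM2l k0) ey; clear - h4 h7; lia.
  have hy2 : y <= c by rewrite -(ler_pM2l k0) ey; clear - h3 h8; lia.
  have /four : E (A.1 + x) (A.2 + y).
    apply: (bounding_box Eempty (latD (Elat eA) l) eA eB eC eD);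
      clear - hx1 hx2 hy1 hy2 s1 s2; lia.
  have ind (u v : int) : u * b + v * a = 0 -> u * - d + v * c = 0 -> u = 0 /\ v = 0.
    apply: independent_combination; rewrite mulrN opprK lt0r_neq0 //.
    by rewrite addr_gt0 // mulr_gt0.
  rewrite !inE => /or4P[] /eqP/fs[v1 v2].
  - have [xE yE] : x = 0 /\ y = 0 by clear - v1 v2; lia.
    by apply: ind; rewrite -?ex -?ey ?xE ?yE mulr0.
  - have [xE yE] : x = a + b /\ y = c - d by clear - v1 v2 s1 s2; lia.
    have [] := ind (i - k) (j - k); rewrite xE in ex; rewrite yE in ey.
    + by clear - ex; lia.
    + by clear - ey; lia.
    by clear - ik; lia.
  - have [xE yE] : x = b /\ y = - d by clear - v1 v2; lia.
    have [] := ind (i - k) j; rewrite xE in ex; rewrite yE in ey.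
    + by clear - ex; lia.
    + by clear - ey; lia.
    by clear - ik; lia.
  have [xE yE] : x = a /\ y = c by clear - v1 v2; lia.
  have [] := ind i (j - k); rewrite xE in ex; rewrite yE in ey.
  + by clear - ex; lia.
  + by clear - ey; lia.
  by clear - jk; lia.
split=> [/four|[] [-> ->]].
- rewrite !inE => /or4P[] /eqP/fs[-> ->];
    [constructor 1|constructor 4|constructor 3|constructor 2]; clear - s1 s2; lia.
- exact: eA.
- by rewrite !(addrC A.1) !(addrC A.2) !subrK.
- by rewrite (addrC A.1) subrK subKr.
have -> : A.1 + (D.1 - A.1 + (C.1 - A.1)) = B.1 by clear - s1; lia.
by have -> : A.2 + (D.2 - A.2 - (A.2 - C.2)) = B.2 by clear - s2; lia.
Qed.

End Family.

(** * Trigonometric inequalities *)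

Section Trig.
Variable R : realType.
Implicit Types x y z : R.

Lemma cosD2piz x (k : int) : cos (x + 2 * pi * k%:~R) = cos x.
Proof.
have H (n : nat) y : cos (y + (2 * pi) * n%:R) = cos y.
  elim: n y => [|n IH] y; first by rewrite mulr0 addr0.
  by rewrite -[n.+1%:R]natr1 mulrDr mulr1 addrA [X in _ + X]mulr_natl cosD2pi IH.
case: k => n; first exact: H.
by rewrite -[LHS](H n.+1) NegzE mulrNz mulrN subrK.
Qed.

Lemma sinD2piz x (k : int) : sin (x + 2 * pi * k%:~R) = sin x.
Proof.
have H (n : nat) y : sin (y + (2 * pi) * n%:R) = sin y.
  elim: n y => [|n IH] y; first by rewrite mulr0 addr0.
  by rewrite -[n.+1%:R]natr1 mulrDr mulr1 addrA [X in _ + X]mulr_natl sinD2pi IH.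
case: k => n; first exact: H.
by rewrite -[LHS](H n.+1) NegzE mulrNz mulrN subrK.
Qed.

Lemma cos_lt x y : `|x| < `|y| -> `|y| <= pi -> cos y < cos x.
Proof.
move=> xy yp; rewrite -(cos_norm x) -(cos_norm y) ltr_cos // in_itv /= normr_ge0 //=.
exact: le_trans (ltW xy) yp.
Qed.

Lemma cos_le x y : `|x| <= `|y| -> `|y| <= pi -> cos y <= cos x.
Proof.
rewrite le_eqVlt => /orP[/eqP xy|xy yp]; last exact/ltW/cos_lt.
by rewrite -(cos_norm x) -(cos_norm y) xy.
Qed.

Lemma cos_eq x y : `|x| <= pi -> `|y| <= pi -> cos x = cos y -> `|x| = `|y|.
Proof.
move=> xp yp e; have [xy|yx|//] := ltgtP `|x| `|y|.
  by have := cos_lt xy yp; rewrite e ltxx.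
by have := cos_lt yx xp; rewrite e ltxx.
Qed.

Lemma cos_sum x y : cos x + cos y = 2 * cos ((x + y) / 2) * cos ((x - y) / 2).
Proof.
have H (m d : R) : cos (m + d) + cos (m - d) = 2 * cos m * cos d.
  by rewrite cosD cosB; ring.
by rewrite -H; congr (cos _ + cos _); field.
Qed.

Lemma reduce_angle x : exists k : int, `|x + 2 * pi * k%:~R| <= pi.
Proof.
have p0 := pi_gt0 R.
pose k := Num.floor ((x + pi) / (2 * pi)).
exists (- k).
have /andP[h1 h2] : k%:~R <= (x + pi) / (2 * pi) < (k + 1)%:~R by rewrite Num.Theory.floor_itv.
move: h1 h2; rewrite intrD intrN ler_pdivlMr ?mulr_gt0 // ltr_pdivrMr ?mulr_gt0 // => h1 h2.
by rewrite ler_norml; apply/andP; split; nra.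
Qed.

Lemma cos_eq1 x : cos x = 1 -> exists k : int, x = 2 * pi * k%:~R.
Proof.
have [k hk] := reduce_angle x.
rewrite -(cosD2piz x k) => e; exists (- k).
have : `|x + 2 * pi * k%:~R| = `|0 : R|.
  by apply: cos_eq; rewrite ?normr0 ?pi_ge0 // cos0.
by rewrite normr0 => /normr0P /eqP; rewrite intrN mulrN; lra.
Qed.

Lemma cos_sin_inj x y : cos x = cos y -> sin x = sin y -> exists k : int, x = y + 2 * pi * k%:~R.
Proof.
move=> ec es; have [|k hk] := @cos_eq1 (x - y); last by exists k; rewrite -hk addrC subrK.
by rewrite cosB ec es -!expr2 cos2Dsin2.
Qed.

Lemma polar (a b : R) : exists r t, [/\ 0 <= r, a = r * cos t & b = r * sin t].
Proof.
pose r := Num.sqrt (a ^+ 2 + b ^+ 2).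
have h2 : 0 <= a ^+ 2 + b ^+ 2 by rewrite addr_ge0 ?sqr_ge0.
have r0 : 0 <= r by exact: sqrtr_ge0.
have r2 : r ^+ 2 = a ^+ 2 + b ^+ 2 by rewrite sqr_sqrtr.
have [re|rn] := eqVneq r 0.
  exists 0, 0; rewrite lexx !mul0r; move: r2; rewrite re expr0n /= => /esym/eqP.
  by rewrite paddr_eq0 ?sqr_ge0 // !expf_eq0 /= => /andP[/eqP-> /eqP->].
have rp : 0 < r by rewrite lt_neqAle eq_sym rn.
have ar : -1 <= a / r <= 1.
  rewrite -ler_norml normrM normfV (ger0_norm r0) ler_pdivrMr // mul1r.
  by rewrite -(ger0_norm r0) -ler_sqr ?nnegrE ?normr_ge0 // !real_normK ?num_real // r2 lerDl sqr_ge0.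
pose t := acos (a / r).
have ct : cos t = a / r by rewrite /t acosK // in_itv.
have ea : a = r * cos t by rewrite ct mulrC divfK.
have sb : (r * sin t) ^+ 2 = b ^+ 2.
  rewrite exprMn sin2cos2 mulrBr mulr1 -exprMn -ea r2; ring.
move/eqP: sb; rewrite eqf_sqr => /orP[/eqP e|/eqP e].
  by exists r, t; split.
by exists r, (- t); split=> //; rewrite ?cosN // sinN mulrN e opprK.
Qed.

(** sin (n z) / sin z decreases on ]0, pi / n[. *)
Lemma sin_ratio_decr (n : nat) x y : (0 < n)%N -> 0 < x -> x < y -> n%:R * y <= pi ->
  sin (n%:R * y) * sin x <= sin (n%:R * x) * sin y /\
  ((1 < n)%N -> sin (n%:R * y) * sin x < sin (n%:R * x) * sin y).
Proof.
case: n => // n _; elim: n => [|n IH] x0 xy nyp.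
  by rewrite !mul1r mulrC; split.
have y0 : 0 < y by exact: lt_trans xy.
have p0 := pi_gt0 R.
have m1 : (1 : R) <= n.+1%:R by rewrite ler1n.
have nyp' : n.+1%:R * y + y <= pi by move: nyp; rewrite -[n.+2%:R]natr1 mulrDl mul1r.
have nyp1 : n.+1%:R * y < pi by lra.
have [IH1 _] := IH x0 xy (ltW nyp1).
have nxy : n.+1%:R * x < n.+1%:R * y by rewrite ltr_pM2l // ltr0n.
have nx0 : 0 < n.+1%:R * x by rewrite mulr_gt0 // ltr0n.
have ly : y <= n.+1%:R * y by rewrite ler_peMl // ltW.
have yh : y <= pi / 2 by lra.
have sx : 0 < sin x by apply: sin_gt0_pi; apply/andP; split; lra.
have sy : 0 < sin y by apply: sin_gt0_pi; apply/andP; split; lra.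
have snx : 0 < sin (n.+1%:R * x) by apply: sin_gt0_pi; apply/andP; split; lra.
have sny : 0 < sin (n.+1%:R * y) by apply: sin_gt0_pi; apply/andP; split; lra.
have cx : cos y < cos x by apply: cos_lt; rewrite !ger0_norm //; lra.
have cy : 0 <= cos y by apply: cos_ge0_pihalf; apply/andP; split; lra.
have cn : cos (n.+1%:R * y) < cos (n.+1%:R * x).
  by apply: cos_lt; rewrite !ger0_norm //; lra.
have E z : sin (n.+2%:R * z) = sin (n.+1%:R * z) * cos z + cos (n.+1%:R * z) * sin z.
  by rewrite -[n.+2%:R]natr1 mulrDl mul1r sinD.
suff h : sin (n.+2%:R * y) * sin x < sin (n.+2%:R * x) * sin y by split=> [|_]; [exact: ltW|exact: h].
rewrite !E !mulrDl.
have h1 : sin (n.+1%:R * y) * cos y * sin x <= sin (n.+1%:R * x) * cos x * sin y.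
  rewrite -!mulrA (mulrC (cos y)) (mulrC (cos x)) !mulrA.
  apply: le_trans (_ : sin (n.+1%:R * x) * sin y * cos y <= _).
    by rewrite ler_wpM2r.
  by rewrite ler_wpM2l ?(ltW cx) // mulr_ge0 // ltW.
have h2 : cos (n.+1%:R * y) * sin y * sin x < cos (n.+1%:R * x) * sin x * sin y.
  by rewrite -!mulrA (mulrC (sin x)) ltr_pM2r // mulr_gt0.
by rewrite ler_ltD.
Qed.

Lemma sin_shift_ratio (n : nat) (e x y : R) : (1 < n)%N -> 0 <= e -> e < x -> x < y ->
  n%:R * y <= pi -> sin (x - e) * sin (n%:R * y) < sin (y - e) * sin (n%:R * x).
Proof.
move=> n1 e0 ex xy nyp.
have p0 := pi_gt0 R.
have x0 : 0 < x by exact: le_lt_trans ex.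
have n0 : (0 < n)%N by exact: ltnW.
have n2 : (2 : R) <= n%:R by rewrite ler_nat.
have [_ /(_ n1) h] := sin_ratio_decr n0 x0 xy nyp.
have y0 : 0 < y by exact: lt_trans xy.
have yh : 2 * y <= pi by apply: le_trans nyp; rewrite ler_pM2r.
have sx : 0 < sin x by apply: sin_gt0_pi; apply/andP; split; lra.
have sy : 0 < sin y by apply: sin_gt0_pi; apply/andP; split; lra.
have sxe : 0 < sin (x - e) by apply: sin_gt0_pi; apply/andP; split; lra.
have nxy : n%:R * x < n%:R * y by rewrite ltr_pM2l // ltr0n.
have nx0 : 0 < n%:R * x by rewrite mulr_gt0 // ltr0n.
have snx : 0 < sin (n%:R * x) by apply: sin_gt0_pi; apply/andP; split; lra.
have h2 : sin (x - e) * sin y <= sin (y - e) * sin x.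
  have : 0 <= sin e * sin (y - x).
    by rewrite mulr_ge0 //; apply: sin_ge0_pi; apply/andP; split; lra.
  by rewrite !sinB; nra.
rewrite -(ltr_pM2r sy) -(mulrA (sin (y - e))).
apply: le_lt_trans (_ : sin (y - e) * sin x * sin (n%:R * y) < _).
  by rewrite mulrAC ler_wpM2r // sin_ge0_pi //; apply/andP; split=> //; lra.
rewrite -mulrA ltr_pM2l 1?mulrC ?(mulrC (sin x)) //.
by apply: sin_gt0_pi; apply/andP; split; lra.
Qed.

Section Unimodal.
Variables (n : nat) (S T C e : R).
Hypotheses (n1 : (1 < n)%N) (S0 : 0 < S) (T0 : 0 < T) (e0 : 0 <= e) (ep : e <= pi).

(** Otherwise the derivative would be nonpositive at some point and nonnegative at a
    later one, where sin (z - e) / sin (n z) is larger by sin_shift_ratio. *)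
Lemma two_harmonics_unimodal (z1 z z2 : R) : 0 <= z1 -> z1 < z -> z < z2 -> n%:R * z2 <= pi ->
  C <= S * cos (z1 - e) - T * cos (n%:R * z1) ->
  C <= S * cos (z2 - e) - T * cos (n%:R * z2) ->
  C < S * cos (z - e) - T * cos (n%:R * z).
Proof.
move=> z10 z1z zz2 z2p h1 h2; rewrite ltNge; apply/negP => h.
pose f x := S * cos (x - e) - T * cos (n%:R * x).
pose df x := - (S * sin (x - e)) + T * n%:R * sin (n%:R * x).
have D x : is_derive x (1 : R) f (df x).
  rewrite /f /df; apply: is_derive_eq.
  rewrite /GRing.scale /=; ring.
have cf a b : {within `[a, b], continuous f}%classic.
  apply: continuous_subspaceT => x; apply: differentiable_continuous.
  by apply/derivable1_diffP; have := D x; case.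
have [c1 c1i e1] := MVT z1z (fun x _ => D x) (cf _ _).
have [c2 c2i e2] := MVT zz2 (fun x _ => D x) (cf _ _).
move: c1i c2i; rewrite !in_itv /= => /andP[c1l c1r] /andP[c2l c2r].
have d1 : df c1 <= 0.
  have : df c1 * (z - z1) <= 0 by rewrite -e1 /f; lra.
  by rewrite pmulr_lle0 // subr_gt0.
have d2 : 0 <= df c2.
  have : 0 <= df c2 * (z2 - z) by rewrite -e2 /f; lra.
  by rewrite pmulr_lge0 // subr_gt0.
have p0 := pi_gt0 R.
have n2 : (2 : R) <= n%:R by rewrite ler_nat.
have z20 : 0 < z2 by lra.
have z2h : 2 * z2 <= pi by apply: le_trans z2p; rewrite ler_pM2r.
have nc1 : n%:R * c1 < pi by apply: lt_le_trans z2p; rewrite ltr_pM2l ?ltr0n ?(ltnW n1) //; lra.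
have nc2 : n%:R * c2 < pi by apply: lt_le_trans z2p; rewrite ltr_pM2l ?ltr0n ?(ltnW n1) //; lra.
have c10 : 0 < n%:R * c1 by rewrite mulr_gt0 ?ltr0n ?(ltnW n1) //; lra.
have c20 : 0 < n%:R * c2 by rewrite mulr_gt0 ?ltr0n ?(ltnW n1) //; lra.
have s1 : 0 < sin (n%:R * c1) by apply: sin_gt0_pi; apply/andP.
have s2 : 0 < sin (n%:R * c2) by apply: sin_gt0_pi; apply/andP.
have Tn : 0 < T * n%:R by rewrite mulr_gt0 ?ltr0n ?(ltnW n1).
have q1 : T * n%:R * sin (n%:R * c1) <= S * sin (c1 - e) by move: d1; rewrite /df; lra.
have q2 : S * sin (c2 - e) <= T * n%:R * sin (n%:R * c2) by move: d2; rewrite /df; lra.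
have sc1 : 0 < sin (c1 - e).
  by rewrite -(pmulr_rgt0 _ S0); apply: lt_le_trans q1; rewrite mulr_gt0.
have ec1 : e < c1.
  rewrite ltNge; apply/negP => c1e.
  have : 0 <= sin (e - c1).
    by apply: sin_ge0_pi; rewrite subr_ge0 c1e lerBlDr (le_trans ep) // lerDl (le_trans z10) // ltW.
  by rewrite -(opprB c1 e) sinN oppr_ge0 leNgt sc1.
have := sin_shift_ratio n1 e0 ec1 (lt_trans c1r c2l) (ltW nc2).
rewrite ltNge => /negP; apply.
rewrite -(ler_pM2l S0) !mulrA.
apply: le_trans (_ : T * n%:R * sin (n%:R * c2) * sin (n%:R * c1) <= _).
  by rewrite ler_wpM2r // ltW.
by rewrite mulrAC ler_wpM2r // ltW.
Qed.
End Unimodal.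

End Trig.

Section Line.
Variable R : realType.

Lemma round_to (d a : R) : 0 < d -> exists k : int, `|a + d * k%:~R| <= d / 2.
Proof.
move=> d0; pose k := Num.floor ((a + d / 2) / d).
exists (- k).
have /andP[h1 h2] : k%:~R <= (a + d / 2) / d < (k + 1)%:~R by rewrite Num.Theory.floor_itv.
move: h1 h2; rewrite intrD intrN ler_pdivlMr // ltr_pdivrMr // => h1 h2.
by rewrite ler_norml; apply/andP; split; nra.
Qed.

(** If e <= 0, the function is unimodal between - z2 and - z1.  If e > 0, its values at
    z1 and z2 are larger than at - z1 and - z2, and it is unimodal between z1 and z2.  In both
    cases a point of the progression of step w lies strictly inside the interval. *)
Lemma two_harmonics_gap (n h : nat) (S T C w z1 z2 e : R) :
  (1 < n)%N -> (1 < h)%N -> 0 < S -> 0 < T -> 0 < w -> 0 <= z1 -> z2 = z1 + h%:R * w ->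
  n%:R * z2 <= pi -> - pi <= e -> e <= pi ->
  (forall k : int, S * cos (k%:~R * w - z2 - e) - T * cos (n%:R * (k%:~R * w - z2)) <= C) ->
  C <= S * cos (- z2 - e) - T * cos (n%:R * - z2) ->
  C <= S * cos (- z1 - e) - T * cos (n%:R * - z1) -> False.
Proof.
move=> n1 h1 S0 T0 w0 z10 z2E nz2 eN ep F F0 Fh.
have p0 := pi_gt0 R.
have h2 : (2 : R) <= h%:R by rewrite ler_nat.
have n2 : (2 : R) <= n%:R by rewrite ler_nat.
have hw : 2 * w <= h%:R * w by rewrite ler_pM2r.
have z12 : z1 + 2 * w <= z2 by rewrite z2E lerD2l.
have z20 : 0 < z2 by lra.
have z2h : 2 * z2 <= pi by apply: le_trans nz2; rewrite ler_pM2r.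
have [e0|e0] := lerP e 0.
  have z1w : z1 < z1 + w by lra.
  have wz2 : z1 + w < z2 by lra.
  have Ne0 : 0 <= - e by lra.
  have Nep : - e <= pi by lra.
  have f1 : C <= S * cos (z1 - - e) - T * cos (n%:R * z1).
    by move: Fh; rewrite mulrN cosN -opprD cosN opprK.
  have f2 : C <= S * cos (z2 - - e) - T * cos (n%:R * z2).
    by move: F0; rewrite mulrN cosN -opprD cosN opprK.
  have := two_harmonics_unimodal n1 S0 T0 Ne0 Nep z10 z1w wz2 nz2 f1 f2.
  rewrite ltNge => /negP; apply; have := F (h%:Z - 1).
  rewrite intrD intrN -pmulrn mulrBl mul1r z2E.
  rewrite (_ : h%:R * w - w - (z1 + h%:R * w) = - (z1 + w)); last by ring.
  by rewrite mulrN cosN -opprD cosN opprK.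
pose k := Num.floor ((z1 + z2) / w).
have /andP[k1 k2] : k%:~R <= (z1 + z2) / w < (k + 1)%:~R by rewrite Num.Theory.floor_itv.
have := F (k + 1).
move: k1 k2; rewrite intrD ler_pdivlMr // ltr_pdivrMr // mulrDl mul1r => k1 k2.
set z := (_ - z2) => Fz.
have z1z : z1 < z by rewrite /z; lra.
have zz2 : z < z2 by rewrite /z; lra.
have refl x : 0 <= x -> x <= pi -> C <= S * cos (- x - e) - T * cos (n%:R * - x) ->
    C <= S * cos (x - e) - T * cos (n%:R * x).
  move=> x0 xp hx; apply: le_trans hx _.
  rewrite mulrN cosN lerB // ler_pM2l // -opprD cosN cosD cosB lerBlDr -addrA lerDl.
  by rewrite addr_ge0 // mulr_ge0 // sin_ge0_pi //; apply/andP; split=> //; lra.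
have f1 := refl z1 z10 (ltac:(lra)) Fh.
have f2 := refl z2 (ltW z20) (ltac:(lra)) F0.
have := two_harmonics_unimodal n1 S0 T0 (ltW e0) ep z10 z1z zz2 nz2 f1 f2.
by rewrite ltNge => /negP; apply.
Qed.
End Line.

(** * Waves on the lattice *)

(** Here p and p' are inverse to each other modulo q. *)
Lemma latC q p p' x y : lat q p p' 1 -> lat q p x y -> lat q p' y x.
Proof.
move=> [k0 e] [k ->]; exists (k0 * x - p' * k).
have -> : q * (k0 * x - p' * k) = (q * k0) * x - q * p' * k by ring.
by rewrite (_ : q * k0 = 1 - p * p'); [ring|rewrite e; ring].
Qed.

Lemma lat_inv q p p' : lat q p p' 1 -> lat q p' p 1.
Proof. by move=> [k e]; exists k; rewrite mulrC. Qed.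

Lemma lat_opp q p x y : lat q p x y -> lat q (- p) (- x) y.
Proof. by move=> [k ->]; exists k; ring. Qed.

Lemma lat_horizontal q p p' x : lat q p p' 1 -> lat q p x 0 -> exists k, x = q * k.
Proof. by move=> h /(latC h) [k ->]; exists k; ring. Qed.

Section Wave.
Variable R : realType.

(** The angle of one unit in a coordinate that has period q m. *)
Definition angle_step (q : int) (m : nat) : R := 2 * pi / (q%:~R * m%:R).
Local Notation step := angle_step.

(** The value of a linear functional at a lattice point, in terms of amplitudes and phases. *)
Definition wave (q : int) (mu nu : nat) (Rr Ss s0 t0 : R) (x y : int) : R :=
  Rr * cos (step q mu * x%:~R - s0) + Ss * cos (step q nu * y%:~R - t0).

Lemma waveC q mu nu Rr Ss s0 t0 x y :
  wave q mu nu Rr Ss s0 t0 x y = wave q nu mu Ss Rr t0 s0 y x.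
Proof. exact: addrC. Qed.

Lemma wave_opp q mu nu Rr Ss s0 t0 x y :
  wave q mu nu Rr Ss s0 t0 x y = wave q mu nu Rr Ss (- s0) t0 (- x) y.
Proof. by rewrite /wave intrN mulrN -opprD cosN. Qed.

(** Standing assumptions: p and p' are inverse modulo q, and each projection of the
    subgroup to a circle has at least three points. *)
Definition good (q p p' : int) (mu nu : nat) : Prop :=
  [/\ [/\ 1 < q, lat q p p' 1, (0 < mu)%N & (0 < nu)%N],
      (1 < mu)%N \/ (1 < nu)%N, 2 < q * mu%:Z & 2 < q * nu%:Z].

Lemma goodC q p p' mu nu : good q p p' mu nu -> good q p' p nu mu.
Proof. by move=> [[? ? ? ?] h ? ?]; split=> //; [split=> //; exact: lat_inv|case: h; [right|left]]. Qed.

Lemma good_opp q p p' mu nu : good q p p' mu nu -> good q (- p) (- p') mu nu.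
Proof. by move=> [[? h ? ?] ? ? ?]; split=> //; split=> //; exact: lat_opp. Qed.

Definition bounded (q p : int) (mu nu : nat) (Rr Ss s0 t0 C : R) : Prop :=
  forall x y, lat q p x y -> wave q mu nu Rr Ss s0 t0 x y <= C.

Lemma boundedC q p p' mu nu Rr Ss s0 t0 C : lat q p p' 1 ->
  bounded q p mu nu Rr Ss s0 t0 C -> bounded q p' nu mu Ss Rr t0 s0 C.
Proof. by move=> h b x y /(latC (lat_inv h)) l; rewrite -waveC; exact: b. Qed.

Lemma bounded_opp q p mu nu Rr Ss s0 t0 C :
  bounded q p mu nu Rr Ss s0 t0 C -> bounded q (- p) mu nu Rr Ss (- s0) t0 C.
Proof.
by move=> b x y /lat_opp; rewrite opprK => l; rewrite -[x]opprK -wave_opp; exact: b.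
Qed.

(** The phases of a maximizer are lifted to [- pi, pi]; a point with a phase pi modulo
    2 pi has several lifts. *)
Definition maximizer (q p : int) (mu nu : nat) (Rr Ss s0 t0 C : R) (x y : int) : Prop :=
  [/\ lat q p x y, wave q mu nu Rr Ss s0 t0 x y = C,
      `|step q mu * x%:~R - s0| <= pi & `|step q nu * y%:~R - t0| <= pi].

Lemma maximizerC q p p' mu nu Rr Ss s0 t0 C x y : lat q p p' 1 ->
  maximizer q p mu nu Rr Ss s0 t0 C x y -> maximizer q p' nu mu Ss Rr t0 s0 C y x.
Proof. by move=> h [l f hx hy]; split=> //; [exact: latC h l|rewrite -waveC]. Qed.

Lemma maximizer_opp q p mu nu Rr Ss s0 t0 C x y : maximizer q p mu nu Rr Ss s0 t0 C x y ->
  maximizer q (- p) mu nu Rr Ss (- s0) t0 C (- x) y.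
Proof.
move=> [l f hx hy]; split; rewrite -?wave_opp //; first exact: lat_opp.
by rewrite intrN mulrN -opprD normrN.
Qed.

Lemma step_gt0 q m : 0 < q -> (0 < m)%N -> 0 < step q m.
Proof. by move=> q0 m0; rewrite divr_gt0 ?mulr_gt0 ?pi_gt0 ?ltr0z ?ltr0n. Qed.

Lemma step_period q m : 0 < q -> (0 < m)%N -> step q m * (q * m%:Z)%:~R = 2 * pi.
Proof.
move=> q0 m0; rewrite intrM -pmulrn divfK //.
by rewrite mulf_eq0 negb_or intr_eq0 pnatr_eq0 -lt0n m0 andbT gt_eqF.
Qed.

(** Some x has its phase within pi / 3 of 0 and, as nu > 1, one of the points
    (x, p x + q k) has its second phase within pi / 2 of 0. *)
Lemma max_pos_nu q p p' mu nu Rr Ss s0 t0 C : good q p p' mu nu -> (1 < nu)%N ->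
  0 < Rr -> 0 <= Ss -> bounded q p mu nu Rr Ss s0 t0 C -> 0 < C.
Proof.
move=> [[q1 hp mu0 nu0] _ qmu qnu] nu1 R0 S0 b.
have p0 := pi_gt0 R.
have q0 : 0 < q by lia.
have st := step_gt0 q0 mu0; have sp := step_period q0 mu0.
have sn := step_period q0 nu0.
have [x hx] := round_to (- s0) st.
have d0 : 0 < step q nu * q%:~R by rewrite mulr_gt0 ?step_gt0 ?ltr0z.
have [k hk] := round_to (step q nu * (p * x)%:~R - t0) d0.
have lk : lat q p x (p * x + q * k) by exists k.
have qmu3 : (3 : R) <= (q * mu%:Z)%:~R by rewrite (ler_int R 3).
have nu2 : (2 : R) <= nu%:R by rewrite ler_nat.
have cx : 0 < cos (step q mu * x%:~R - s0).
  apply: cos_gt0_pihalf; rewrite -ltr_norml addrC; apply: le_lt_trans hx _.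
  rewrite ltr_pM2r //; nra.
have cy : 0 <= cos (step q nu * (p * x + q * k)%:~R - t0).
  apply: cos_ge0_pihalf; rewrite -ler_norml intrD mulrDr addrAC (intrM _ q k) mulrA.
  apply: le_trans hk _; rewrite ler_pM2r //.
  have : step q nu * q%:~R * nu%:R = 2 * pi by rewrite -sn intrM -pmulrn mulrA.
  nra.
apply: lt_le_trans (b _ _ lk); rewrite /wave.
by rewrite ltr_pwDl ?mulr_gt0 // mulr_ge0.
Qed.

Lemma max_pos q p p' mu nu Rr Ss s0 t0 C : good q p p' mu nu ->
  0 < Rr -> 0 < Ss -> bounded q p mu nu Rr Ss s0 t0 C -> 0 < C.
Proof.
move=> g R0 S0 b; have [[_ hp _ _] [mu1|nu1] _ _] := g.
  exact: max_pos_nu (goodC g) mu1 S0 (ltW R0) (boundedC hp b).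
exact: max_pos_nu g nu1 R0 (ltW S0) b.
Qed.

Lemma between_sym_norm (x1 x2 z : int) : between x1 x2 z -> `|z + z - x1 - x2| <= `|x1 - x2|.
Proof. by rewrite /between; lia. Qed.

Lemma between_sym_eq (x1 x2 z : int) : `|z + z - x1 - x2| = `|x1 - x2| -> z = x1 \/ z = x2.
Proof. by lia. Qed.

(** If m is the middle of the two phases, the cosines of two points symmetric about m have
    sum 2 cos m cos e, where e is their distance to m. *)
Lemma arc_sum (d s : R) (x1 x2 z : int) : 0 < d -> between x1 x2 z ->
  `|(d * x1%:~R - s) - (d * x2%:~R - s)| <= 2 * pi ->
  0 <= cos (((d * x1%:~R - s) + (d * x2%:~R - s)) / 2) ->
  let A := (cos (d * z%:~R - s) + cos (d * (x1 + x2 - z)%:~R - s)) -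
     (cos (d * x1%:~R - s) + cos (d * x2%:~R - s)) in
  0 <= A /\ (0 < cos (((d * x1%:~R - s) + (d * x2%:~R - s)) / 2) -> A = 0 -> z = x1 \/ z = x2).
Proof.
move=> d0 bz hw c0 A.
pose m := ((d * x1%:~R - s) + (d * x2%:~R - s)) / 2.
pose ez := d / 2 * (z + z - x1 - x2)%:~R; pose dx := d / 2 * (x1 - x2)%:~R.
have AE : A = 2 * cos m * (cos ez - cos dx).
  rewrite /A !cos_sum mulrBr; congr (_ * cos _ * cos _ - _ * cos _ * cos _);
  by rewrite /m /ez /dx !(intrD, intrN); field.
have d2 : 0 < d / 2 by rewrite divr_gt0.
have nd (k : int) : `|d / 2 * k%:~R| = d / 2 * `|k|%:~R.
  by rewrite normrM (gtr0_norm d2) intr_norm.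
have ed : `|ez| <= `|dx|.
  by rewrite !nd ler_pM2l // ler_int between_sym_norm.
have dp : `|dx| <= pi.
  rewrite -(ler_pM2l (_ : 0 < 2)) //; apply: le_trans hw.
  rewrite -[X in X * _](@ger0_norm R 2) // -normrM le_eqVlt; apply/orP; left; apply/eqP.
  by congr `| _ |; rewrite /dx intrD intrN; field.
have cc : 0 <= cos ez - cos dx by rewrite subr_ge0 cos_le.
split; first by rewrite AE mulr_ge0 // mulr_ge0.
move=> cp; rewrite AE => /eqP; rewrite !mulf_eq0 pnatr_eq0 /= (gt_eqF cp) /= subr_eq0 => /eqP e.
have : `|ez| = `|dx| by apply: cos_eq => //; exact: le_trans dp.
rewrite !nd => /(mulfI (lt0r_neq0 d2)) /eqP; rewrite eqr_int => /eqP.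
exact: between_sym_eq.
Qed.

Section MaxPair.
Variables (q p p' : int) (mu nu : nat) (Rr Ss s0 t0 C : R).
Hypotheses (g : good q p p' mu nu) (R0 : 0 < Rr) (S0 : 0 < Ss).
Hypothesis b : bounded q p mu nu Rr Ss s0 t0 C.
Local Notation X x := (step q mu * x%:~R - s0).
Local Notation Y y := (step q nu * y%:~R - t0).
Local Notation F := (wave q mu nu Rr Ss s0 t0).

(** The values at z and at its mirror image in the centre of the box add up to at least 2 C,
    so both are C and the inequalities of arc_sum are equalities. *)
Lemma box_edges x1 y1 x2 y2 x y : lat q p x1 y1 -> lat q p x2 y2 ->
  F x1 y1 = C -> F x2 y2 = C ->
  `|X x1 - X x2| <= 2 * pi -> `|Y y1 - Y y2| <= 2 * pi ->
  0 <= cos ((X x1 + X x2) / 2) -> 0 <= cos ((Y y1 + Y y2) / 2) ->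
  lat q p x y -> between x1 x2 x -> between y1 y2 y ->
  [/\ F x y = C, 0 < cos ((X x1 + X x2) / 2) -> x = x1 \/ x = x2 &
      0 < cos ((Y y1 + Y y2) / 2) -> y = y1 \/ y = y2].
Proof.
move=> l1 l2 f1 f2 hx hy cx cy l bx by_.
have [[q1 _ mu0 nu0] _ _ _] := g; have q0 : 0 < q by lia.
have [A0 Az] := arc_sum (step_gt0 q0 mu0) bx hx cx.
have [B0 Bz] := arc_sum (step_gt0 q0 nu0) by_ hy cy.
have l' : lat q p (x1 + x2 - x) (y1 + y2 - y) by apply: latB => //; exact: latD.
have h1 := b l; have h2 := b l'.
set A := (X in 0 <= X) in A0; set B := (X in 0 <= X) in B0.
have AB : F x y + F (x1 + x2 - x) (y1 + y2 - y) = C + C + Rr * A + Ss * B.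
  by rewrite -{1}f1 -f2 /A /B /wave; ring.
have RA : 0 <= Rr * A by rewrite mulr_ge0 // ltW.
have SB : 0 <= Ss * B by rewrite mulr_ge0 // ltW.
have RA0 : Rr * A = 0 by clearbody A B; lra.
have SB0 : Ss * B = 0 by clearbody A B; lra.
split; first by clearbody A B; lra.
  move=> c; apply: Az c _; apply/eqP; move/eqP: RA0; rewrite mulf_eq0 gt_eqF //.
move=> c; apply: Bz c _; apply/eqP; move/eqP: SB0; rewrite mulf_eq0 gt_eqF //.
Qed.

End MaxPair.
End Wave.

(** * The box of two maximizers is empty *)

Lemma empty_boxC q p p' x1 y1 x2 y2 : lat q p p' 1 ->
  empty_box q p' y1 x1 y2 x2 -> empty_box q p x1 y1 x2 y2.
Proof. by move=> h e x y /(latC h) l bx by_; have := e _ _ l by_ bx; tauto. Qed.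

Lemma empty_box_opp q p x1 y1 x2 y2 :
  empty_box q (- p) (- x1) y1 (- x2) y2 -> empty_box q p x1 y1 x2 y2.
Proof.
move=> e x y /lat_opp l bx by_.
have bx' : between (- x1) (- x2) (- x) by move: bx; rewrite /between; lia.
by have := e _ _ l bx' by_; lia.
Qed.

Lemma empty_box_sym q p x1 y1 x2 y2 :
  empty_box q p x2 y2 x1 y1 -> empty_box q p x1 y1 x2 y2.
Proof.
move=> e x y l bx by_.
have bx' : between x2 x1 x by move: bx; rewrite /between; lia.
have by' : between y2 y1 y by move: by_; rewrite /between; lia.
by have := e _ _ l bx' by'; tauto.
Qed.

Lemma large_multiple (q k : int) : 0 < q -> k != 0 -> q <= `|q * k|.
Proof.
by move=> q0 k0; rewrite normrM (gtr0_norm q0) ler_peMr ?(ltW q0) // -gtz0_ge1 normr_gt0.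
Qed.

Lemma small_multiple (q k x : int) : 0 < q -> q * k = x -> `|x| < q -> x = 0.
Proof.
move=> q0 <-; have [->|k0] := eqVneq k 0; first by rewrite mulr0.
by rewrite ltNge large_multiple.
Qed.

Section Good.
Variables (q p p' : int) (mu nu : nat).
Hypothesis g : good q p p' mu nu.
Lemma gq1 : 1 < q. Proof. by case: g => -[]. Qed.
Lemma gq0 : 0 < q. Proof. exact: lt_trans gq1. Qed.
Lemma gmu0 : (0 < mu)%N. Proof. by case: g => -[]. Qed.
Lemma gnu0 : (0 < nu)%N. Proof. by case: g => -[]. Qed.
Lemma ghp : lat q p p' 1. Proof. by case: g => -[]. Qed.
End Good.

Section Wave.
Variable R : realType.

Lemma cos_half_ge0 (s : R) : `|s| <= pi -> 0 <= cos (s / 2).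
Proof.
move=> h; apply: cos_ge0_pihalf; rewrite -ler_norml normrM (@ger0_norm _ 2^-1) ?invr_ge0 //.
by rewrite ler_pM2r // invr_gt0.
Qed.

Lemma cos_half_gt0 (s : R) : `|s| < pi -> 0 < cos (s / 2).
Proof.
move=> h; apply: cos_gt0_pihalf; rewrite -ltr_norml normrM (@ger0_norm _ 2^-1) ?invr_ge0 //.
by rewrite ltr_pM2r // invr_gt0.
Qed.

Lemma cos_half_eq0 (s : R) : `|s| = pi -> cos (s / 2) = 0.
Proof.
by move=> h; rewrite -cos_norm normrM h (@ger0_norm _ 2^-1) ?invr_ge0 // cos_pihalf.
Qed.

(** The arc from u to v is centred at pi / 2 or - pi / 2 and has length at most pi. *)
Lemma half_arc_inj (u v w : R) : `|u| <= pi -> `|v| <= pi -> `|u + v| = pi ->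
  (u <= w <= v) \/ (v <= w <= u) -> cos w = cos u -> w = u.
Proof.
move=> hu hv huv hw e.
have p0 := pi_gt0 R.
have wp : `|w| <= pi.
  move: hu hv; rewrite !ler_norml => /andP[a1 a2] /andP[a3 a4]; apply/andP.
  by case: hw => /andP[a5 a6]; split; lra.
have := cos_eq wp hu e.
move: hu hv; rewrite !ler_norml => /andP[a1 a2] /andP[a3 a4].
have [uv|uv] := lerP 0 (u + v).
  rewrite ger0_norm // in huv.
  rewrite !ger0_norm //; first by lra.
  by case: hw => /andP[a5 a6]; lra.
rewrite ltr0_norm // in huv.
rewrite !ler0_norm; first by lra.
  by lra.
by case: hw => /andP[a5 a6]; lra.
Qed.

Local Notation step := (@angle_step R).

Section MaxPair.
Variables (q p p' : int) (mu nu : nat) (Rr Ss s0 t0 C : R).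
Hypotheses (g : good q p p' mu nu) (R0 : 0 < Rr) (S0 : 0 < Ss).
Hypothesis b : bounded q p mu nu Rr Ss s0 t0 C.
Local Notation X x := (step q mu * x%:~R - s0).
Local Notation Y y := (step q nu * y%:~R - t0).
Local Notation F := (wave q mu nu Rr Ss s0 t0).
Local Notation E := (maximizer q p mu nu Rr Ss s0 t0 C).

Lemma phase_between x1 x2 x : between x1 x2 x ->
  (X x1 <= X x <= X x2) \/ (X x2 <= X x <= X x1).
Proof.
have st := step_gt0 R (gq0 g) (gmu0 g).
by rewrite /between => -[/andP[h1 h2]|/andP[h1 h2]]; [left|right]; apply/andP; split;
  rewrite lerB // ler_pM2l // ler_int.
Qed.

Lemma phase_inj x1 x2 : X x1 = X x2 -> x1 = x2.
Proof.
have st := step_gt0 R (gq0 g) (gmu0 g).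
by move=> /addIr /(mulfI (lt0r_neq0 st)) /eqP; rewrite eqr_int => /eqP.
Qed.

Lemma width (u v : R) : `|u| <= pi -> `|v| <= pi -> `|u - v| <= 2 * pi.
Proof. by rewrite !ler_norml => /andP[? ?] /andP[? ?]; apply/andP; split; lra. Qed.

(** The middle of the first phases is pi / 2 or - pi / 2, so box_edges only restricts the
    second coordinate; the first one is determined by its cosine. *)
Lemma direct_half x1 y1 x2 y2 : E x1 y1 -> E x2 y2 ->
  `|X x1 + X x2| = pi -> `|Y y1 + Y y2| <= pi -> empty_box q p x1 y1 x2 y2.
Proof.
move=> [l1 f1 hx1 hy1] [l2 f2 hx2 hy2] hx hy x y l bx by_.
have hx' : `|X x1 + X x2| <= pi by rewrite hx.
have [fz _ fy] := box_edges g R0 S0 b l1 l2 f1 f2 (width hx1 hx2) (width hy1 hy2)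
   (cos_half_ge0 hx') (cos_half_ge0 hy) l bx by_.
have C0 := max_pos g R0 S0 b.
have cy : 0 < cos ((Y y1 + Y y2) / 2).
  apply: cos_half_gt0; rewrite lt_neqAle hy andbT; apply/eqP => hy'.
  have : C + C = 0.
    rewrite -{1}f1 -f2 /wave addrACA -!mulrDr !cos_sum (cos_half_eq0 hx) (cos_half_eq0 hy').
    by ring.
  by lra.
have [yy|yy] := fy cy.
  left; split=> //; apply: phase_inj; apply: (half_arc_inj hx1 hx2 hx (phase_between bx)).
  apply: (mulfI (lt0r_neq0 R0)); apply: (@addIr _ (Ss * cos (Y y1))).
  by move: fz; rewrite -f1 yy.
right; split=> //; apply: phase_inj.
have hx'' : `|X x2 + X x1| = pi by rewrite addrC.
apply: (half_arc_inj hx2 hx1 hx'').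
  by have := phase_between bx; tauto.
apply: (mulfI (lt0r_neq0 R0)); apply: (@addIr _ (Ss * cos (Y y2))).
by move: fz; rewrite -f2 yy.
Qed.

(** By box_edges only corners of the box can be lattice points.  If the other two
    corners were, the sides of the box would be multiples of q, and the interior of the box
    would contain lattice points. *)
Lemma direct_strict x1 y1 x2 y2 : E x1 y1 -> E x2 y2 ->
  `|X x1 + X x2| < pi -> `|Y y1 + Y y2| < pi -> empty_box q p x1 y1 x2 y2.
Proof.
move=> [l1 f1 hx1 hy1] [l2 f2 hx2 hy2] hx hy.
have edges x y : lat q p x y -> between x1 x2 x -> between y1 y2 y ->
    (x = x1 \/ x = x2) /\ (y = y1 \/ y = y2).
  move=> l bx by_.
  have [fz fx fy] := box_edges g R0 S0 b l1 l2 f1 f2 (width hx1 hx2) (width hy1 hy2)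
    (cos_half_ge0 (ltW hx)) (cos_half_ge0 (ltW hy)) l bx by_.
  by split; [apply: fx|apply: fy]; exact: cos_half_gt0.
move=> x y l bx by_; have [ex ey] := edges x y l bx by_.
have q1 := gq1 g.
(* two more corners in the lattice make the sides of the box multiples of q, and the
   lattice point (x1 + s, y1 + ry) is in the interior of the box *)
have corner : lat q p (x2 - x1) 0 -> lat q p 0 (y2 - y1) -> x1 = x2 \/ y1 = y2.
  move=> /(lat_horizontal (ghp g)) [k ek] [k' ek'].
  have [|x12] := eqVneq x1 x2; first by left.
  have [|y12] := eqVneq y1 y2; first by right.
  exfalso.
  pose s : int := if x1 < x2 then 1 else -1.
  pose r := (p * s %% q)%Z.
  have [D er] : exists D, p * s = D * q + r by exists (p * s %/ q)%Z; exact: divz_eq.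
  have r0 : 0 <= r by apply: modz_ge0; exact: lt0r_neq0 (gq0 g).
  have rq : r < q by apply: ltz_pmod; exact: gq0 g.
  have rn : r != 0.
    apply/eqP => r0'; have [k0 e0] := ghp g; move: er; rewrite r0' addr0 => er.
    have [m em] : exists m, q * m = s.
      exists (D * p' + s * k0).
      have -> : q * (D * p' + s * k0) = (D * q) * p' + q * s * k0.
        by ring.
      rewrite -er (_ : p * s * p' + q * s * k0 = s * (p * p' + q * k0)); last by ring.
      by rewrite -e0 mulr1.
    have : s = 0 by apply: (small_multiple (gq0 g) em); clear - q1; rewrite /s; case: ifP; lia.
    by rewrite /s; case: ifP.
  pose ry := if y1 < y2 then r else r - q.
  have lz : lat q p (x1 + s) (y1 + ry).
    apply: latD => //; rewrite /ry; case: ifP => _.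
      by exists (- D); rewrite er; ring.
    by exists (- D - 1); rewrite er; ring.
  have k0 : k != 0 by apply: contra_neq x12; clear - ek => k0; move: ek; rewrite k0 mulr0; lia.
  have k0' : k' != 0 by apply: contra_neq y12; clear - ek' => k0; move: ek'; rewrite k0 !mulr0; lia.
  have xq : q <= `|x2 - x1| by rewrite ek large_multiple // (gq0 g).
  have yq : q <= `|y2 - y1| by rewrite ek' mulr0 add0r large_multiple // (gq0 g).
  clearbody r.
  have bx' : between x1 x2 (x1 + s) by clear - xq q1; rewrite /s /between; case: ifP; lia.
  have by' : between y1 y2 (y1 + ry) by clear - yq q1 r0 rq; rewrite /ry /between; case: ifP; lia.
  have [h _] := edges _ _ lz bx' by'.
  by clear - h xq q1; move: h; rewrite /s; case: ifP; lia.
case: ex => ex; case: ey => ey; [by left| | |by right].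
  have [e|e] : x1 = x2 \/ y1 = y2.
    apply: corner.
      by rewrite -(subrr y2); apply: latB => //; rewrite -ex -ey.
    by rewrite -(subrr x1); apply: latB => //; rewrite -ex -ey.
  - by right; rewrite -e.
  - by left; rewrite e.
have [e|e] : x1 = x2 \/ y1 = y2.
  apply: corner.
    by rewrite -(subrr y1); apply: latB => //; rewrite -ex -ey.
  by rewrite -(subrr x2); apply: latB => //; rewrite -ex -ey.
- by left; rewrite e.
- by right; rewrite -e.
Qed.

End MaxPair.

Lemma direct_empty (q p p' : int) (mu nu : nat) (Rr Ss s0 t0 C : R) x1 y1 x2 y2 :
  good q p p' mu nu -> 0 < Rr -> 0 < Ss -> bounded q p mu nu Rr Ss s0 t0 C ->
  maximizer q p mu nu Rr Ss s0 t0 C x1 y1 -> maximizer q p mu nu Rr Ss s0 t0 C x2 y2 ->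
  `|(step q mu * x1%:~R - s0) + (step q mu * x2%:~R - s0)| <= pi ->
  `|(step q nu * y1%:~R - t0) + (step q nu * y2%:~R - t0)| <= pi ->
  empty_box q p x1 y1 x2 y2.
Proof.
move=> g R0 S0 b e1 e2; have hp := ghp g.
rewrite le_eqVlt => /orP[/eqP hx hy|hx]; first exact: (direct_half g R0 S0 b).
rewrite le_eqVlt => /orP[/eqP hy|hy]; last exact: (direct_strict g R0 S0 b).
apply: (empty_boxC hp); apply: (direct_half (goodC g) S0 R0 (boundedC hp b)) => //.
- exact: maximizerC hp e1.
- exact: maximizerC hp e2.
- exact: ltW.
Qed.

End Wave.

Section Wave.
Variable R : realType.

Local Notation step := (@angle_step R).

Lemma phase_shift q m (s : R) (x k : int) : 0 < q -> (0 < m)%N ->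
  step q m * (x + q * m%:Z * k)%:~R - s = step q m * x%:~R - s + 2 * pi * k%:~R.
Proof.
move=> q0 m0; rewrite intrD mulrDr (intrM _ (q * m%:Z)) mulrA step_period //; ring.
Qed.

Lemma wave_shift q mu nu (Rr Ss s0 t0 : R) x y k l : 0 < q -> (0 < mu)%N -> (0 < nu)%N ->
  wave q mu nu Rr Ss s0 t0 (x + q * mu%:Z * k) (y + q * nu%:Z * l) = wave q mu nu Rr Ss s0 t0 x y.
Proof. by move=> q0 m0 n0; rewrite /wave !phase_shift // !cosD2piz. Qed.

Lemma lat_period q p mu nu x y k l : lat q p x y ->
  lat q p (x + q * mu * k) (y + q * nu * l).
Proof.
by move=> h; apply: latD => //; exists (- p * mu * k + nu * l); ring.
Qed.

Lemma lat_q0 q p : lat q p q 0.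
Proof. by exists (- p); ring. Qed.

Section Pair.
Variables (q p p' : int) (mu nu : nat) (Rr Ss s0 t0 C : R).
Hypotheses (g : good q p p' mu nu) (R0 : 0 < Rr) (S0 : 0 < Ss).
Hypothesis b : bounded q p mu nu Rr Ss s0 t0 C.
Local Notation X x := (step q mu * x%:~R - s0).
Local Notation Y y := (step q nu * y%:~R - t0).
Local Notation F := (wave q mu nu Rr Ss s0 t0).
Local Notation E := (maximizer q p mu nu Rr Ss s0 t0 C).

Let q0 : 0 < q := gq0 g.
Let mu0 : (0 < mu)%N := gmu0 g.
Let nu0 : (0 < nu)%N := gnu0 g.

(** The middles of the phases for the two lifts of y2 differ by pi. *)
Lemma good_lift y1 y2 : `|Y y1| <= pi -> `|Y y2| <= pi ->
  exists l : int, `|Y y1 - Y (y2 + q * nu%:Z * l)| <= 2 * pi /\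
     0 <= cos ((Y y1 + Y (y2 + q * nu%:Z * l)) / 2).
Proof.
move=> h1 h2; have p0 := pi_gt0 R.
have [c|c] := lerP 0 (cos ((Y y1 + Y y2) / 2)).
  exists 0; rewrite mulr0 addr0; split=> //; exact: width.
move: h1 h2; rewrite !ler_norml => /andP[a1 a2] /andP[a3 a4].
have [h|h] := lerP (Y y1) (Y y2).
  exists (-1); rewrite phase_shift // intrN mulrN mulr1; split.
    by rewrite ler_norml; apply/andP; split; lra.
  rewrite (_ : _ / 2 = (Y y1 + Y y2) / 2 - pi); last by field.
  by have := cosDpi ((Y y1 + Y y2) / 2 - pi); rewrite subrK => E; move: c; rewrite E; lra.
exists 1; rewrite phase_shift // mulr1; split.
  by rewrite ler_norml; apply/andP; split; lra.
rewrite (_ : _ / 2 = (Y y1 + Y y2) / 2 + pi); last by field.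
by rewrite cosDpi; lra.
Qed.

Lemma wrap_cos (u v : R) : `|u| <= pi -> `|v| <= pi -> pi < u + v ->
  0 < cos ((u + (v + 2 * pi * (-1))) / 2).
Proof.
rewrite !ler_norml => /andP[a1 a2] /andP[a3 a4] h.
have p0 := pi_gt0 R.
by apply: cos_half_gt0; rewrite ltr_norml; apply/andP; split; lra.
Qed.

(** Otherwise the lift x2 - q mu brings the middle phase to the good side; as mu > 1, the
    lattice point (x1 - q, y1) is strictly inside the new box, against box_edges. *)
Lemma nowrap_up x1 y1 x2 y2 : (1 < mu)%N -> E x1 y1 -> E x2 y2 ->
  X x1 + X x2 <= pi.
Proof.
move=> mu1.
wlog x12 : x1 y1 x2 y2 / X x1 <= X x2.
  move=> W e1 e2; have [h|h] := lerP (X x1) (X x2); first exact: (W x1 y1 x2 y2).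
  by rewrite addrC; apply: (W x2 y2 x1 y1) => //; exact: ltW.
move=> [l1 f1 hx1 hy1] [l2 f2 hx2 hy2]; rewrite leNgt; apply/negP => wr.
have p0 := pi_gt0 R.
have [l [wy cy]] := good_lift hy1 hy2.
have cx := wrap_cos hx1 hx2 wr.
have st := step_gt0 R q0 mu0.
have l3 := lat_period (Posz mu) (Posz nu) (-1) l l2.
have f3 : F (x2 + q * mu%:Z * -1) (y2 + q * nu%:Z * l) = C by rewrite wave_shift.
have X3 : X (x2 + q * mu%:Z * -1) = X x2 + 2 * pi * (-1) by rewrite phase_shift // intrN.
have wx : `|X x1 - X (x2 + q * mu%:Z * -1)| <= 2 * pi.
  move: hx1 hx2; rewrite X3 !ler_norml => /andP[a1 a2] /andP[a3 a4].
  by apply/andP; split; lra.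
rewrite -{1}[-1]/((-1)%:~R) in cx.
have cx' : 0 < cos ((X x1 + X (x2 + q * mu%:Z * -1)) / 2) by rewrite X3.
have lz : lat q p (x1 - q) y1.
  by rewrite -(subr0 y1); apply: latB => //; exact: lat_q0.
have e0 : 0 <= x2 - x1.
  rewrite subr_ge0 -(ler_int R); move: x12; rewrite lerD2r ler_pM2l //.
have e1 : 2 * (x2 - x1) < q * mu%:Z.
  rewrite -(ltr_int R) -(ltr_pM2l st) step_period // intrM intrD intrN.
  move: hx1 hx2; rewrite !ler_norml => /andP[a1 a2] /andP[a3 a4]; lra.
have mu2 : q * 2 <= q * mu%:Z by rewrite ler_pM2l.
have bx : between x1 (x2 + q * mu%:Z * -1) (x1 - q).
  right; clear - e0 e1 mu2 q0; lia.
have by_ : between y1 (y2 + q * nu%:Z * l) y1.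
  by rewrite /between; clear; lia.
have [_ h _] := box_edges g R0 S0 b l1 l3 f1 f3 wx wy (ltW cx') cy lz bx by_.
by have := h cx'; clear - q0 e1 e0 mu2; lia.
Qed.

End Pair.

Lemma nowrap (q p p' : int) (mu nu : nat) (Rr Ss s0 t0 C : R) x1 y1 x2 y2 :
  good q p p' mu nu -> 0 < Rr -> 0 < Ss -> bounded q p mu nu Rr Ss s0 t0 C -> (1 < mu)%N ->
  maximizer q p mu nu Rr Ss s0 t0 C x1 y1 -> maximizer q p mu nu Rr Ss s0 t0 C x2 y2 ->
  `|(step q mu * x1%:~R - s0) + (step q mu * x2%:~R - s0)| <= pi.
Proof.
move=> g R0 S0 b m1 e1 e2.
rewrite ler_norml; apply/andP; split; last exact: (nowrap_up g R0 S0 b m1 e1 e2).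
have := nowrap_up (good_opp g) R0 S0 (bounded_opp b) m1 (maximizer_opp e1) (maximizer_opp e2).
by rewrite !intrN !mulrN -!opprD lerNl.
Qed.

Section Wrap.
Variables (q p p' : int) (nu : nat) (Rr Ss s0 t0 C : R).
Hypotheses (g : good q p p' 1 nu) (R0 : 0 < Rr) (S0 : 0 < Ss) (nu1 : (1 < nu)%N).
Hypothesis b : bounded q p 1 nu Rr Ss s0 t0 C.
Local Notation X x := (step q 1 * x%:~R - s0).
Local Notation Y y := (step q nu * y%:~R - t0).
Local Notation F := (wave q 1 nu Rr Ss s0 t0).
Local Notation E := (maximizer q p 1 nu Rr Ss s0 t0 C).

Let q0 : 0 < q := gq0 g.
Let nu0 : (0 < nu)%N := gnu0 g.

(** At (x1 + t k, y1 + sg k) the wave is S cos (z - e) - R cos (n z), where n = t nu > 1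
    and z runs through a progression of step 2 pi / (q nu). *)
Lemma wrap_line x1 y1 (t : int) (sg : int) (h : nat) : 0 < t -> sg = 1 \/ sg = -1 ->
  lat q p t sg -> lat q p x1 y1 -> (1 < h)%N ->
  F x1 y1 = C -> F (x1 + t * h%:Z) (y1 + sg * h%:Z) = C ->
  0 < X x1 -> X (x1 + t * h%:Z) <= pi ->
  `|Y y1 + Y (y1 + sg * h%:Z)| <= pi -> False.
Proof.
move=> t0' hsg lt l1 h1 f0 fh X1 X2 hy.
have p0 := pi_gt0 R.
pose n := (`|t| * nu)%N; pose w := step q nu.
have nE : n%:R = t%:~R * nu%:R :> R.
  by rewrite /n natrM; congr (_ * _); rewrite -[in RHS](gez0_abs (ltW t0')).
have w0 : 0 < w := step_gt0 R q0 nu0.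
have tn : (0 < `|t|)%N by clear - t0'; lia.
have n1 : (1 < n)%N by rewrite /n; apply: leq_trans nu1 _; rewrite leq_pmull.
have n0 : 0 < n%:R :> R by rewrite ltr0n (ltnW n1).
have nw : n%:R * w = step q 1 * t%:~R.
  rewrite /w /angle_step nE mulr1; field.
  by rewrite intr_eq0 pnatr_eq0 -lt0n nu0 gt_eqF.
pose z2 := (pi - X x1) / n%:R; pose z1 := (pi - X (x1 + t * h%:Z)) / n%:R.
pose e := - (sg%:~R * Y (y1 + sg * h%:Z)) - z1.
have sg2 : sg%:~R * sg%:~R = 1 :> R by case: hsg => ->; rewrite ?intrN ?mulrNN mulr1.
have nz2 : n%:R * z2 = pi - X x1 by rewrite /z2 mulrC divfK // gt_eqF.
have nz1 : n%:R * z1 = pi - X (x1 + t * h%:Z) by rewrite /z1 mulrC divfK // gt_eqF.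
have z2E : z2 = z1 + h%:R * w.
  apply: (mulfI (lt0r_neq0 n0)); rewrite mulrDr nz1 nz2 mulrCA nw intrD (intrM _ t) -pmulrn; ring.
have z10 : 0 <= z1 by rewrite /z1 divr_ge0 ?(ltW n0) // subr_ge0.
have Ysh (k : int) : Y (y1 + sg * k) = Y y1 + sg%:~R * (k%:~R * w).
  by rewrite intrD intrM mulrDr /w; ring.
have Xsh (k : int) : X (x1 + t * k) = pi + n%:R * (k%:~R * w - z2).
  by rewrite mulrBr nz2 mulrCA nw intrD intrM; ring.
have eE : e = - (sg%:~R * Y y1) - z2.
  rewrite /e Ysh mulrDr mulrA sg2 mul1r z2E -pmulrn; ring.
have FE (k : int) : F (x1 + t * k) (y1 + sg * k) =
    Ss * cos (k%:~R * w - z2 - e) - Rr * cos (n%:R * (k%:~R * w - z2)).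
  rewrite /wave Xsh Ysh addrC (addrC pi) cosDpi mulrN; congr (_ * _ - _).
  rewrite eE; case: hsg => ->; rewrite ?mul1r ?intrN ?mulN1r.
    by congr cos; ring.
  by rewrite -cosN; congr cos; ring.
have np : n%:R * z2 <= pi by rewrite nz2 gerBl ltW.
have n2 : (2 : R) <= n%:R by rewrite ler_nat.
have z12 : z1 <= z2 by rewrite z2E lerDl mulr_ge0 ?(ltW w0).
have z2h : 2 * z2 <= pi by apply: le_trans np; rewrite ler_wpM2r // (le_trans z10).
have [eN eP] : - pi <= e /\ e <= pi.
  have : `|e + (z1 + z2) / 2| <= pi / 2.
    have -> : e + (z1 + z2) / 2 = - sg%:~R * (Y y1 + Y (y1 + sg * h%:Z)) / 2.
      have := eE; rewrite {1}/e => eE'.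
      have -> : e + (z1 + z2) / 2 = ((e + z1) + (e + z2)) / 2 by field.
      by rewrite {2}eE /e; field.
    rewrite normrM normrM normrN (_ : `|sg%:~R| = 1) ?mul1r; last first.
      by case: hsg => ->; rewrite ?intrN ?normrN normr1.
    by rewrite (@ger0_norm _ 2^-1) ?invr_ge0 // ler_pM2r // invr_gt0.
  rewrite ler_norml => /andP[a1 a2]; split; lra.
apply: (@two_harmonics_gap R n h Ss Rr C w z1 z2 e) => //.
- move=> k; rewrite -FE; apply: b; apply: latD => //.
  by rewrite !(mulrC _ k); exact: latZ.
- by have := FE 0; rewrite !mulr0 !addr0 f0 mul0r sub0r => <-.
- by have := FE h%:Z; rewrite fh -pmulrn z2E opprD addrCA subrr addr0 => <-.
Qed.

(** With the lift x2 - q mu, box_edges shows that lattice points of the box are on its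
    vertical sides.  Hence the residues modulo q of the multiples of (t, sg), the lattice
    vector of height sg = 1 or - 1, stay in [0, x2 - x1], the two maximizers differ by a multiple
    h (t, sg), and h <= 1 by wrap_line. *)
Lemma wrap_up x1 y1 x2 y2 : E x1 y1 -> E x2 y2 ->
  pi < X x1 + X x2 -> `|Y y1 + Y y2| <= pi -> empty_box q p x1 y1 x2 y2.
Proof.
wlog x12 : x1 y1 x2 y2 / X x1 <= X x2.
  move=> W e1 e2 wr hy.
  have [h|h] := lerP (X x1) (X x2); first exact: (W x1 y1 x2 y2).
  by apply: empty_box_sym; apply: W => //; [exact: ltW|rewrite addrC|rewrite addrC].
move=> [l1 f1 hx1 hy1] [l2 f2 hx2 hy2] wr hy.
have p0 := pi_gt0 R; have st := step_gt0 R q0 (isT : (0 < 1)%N).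
have cx := wrap_cos hx1 hx2 wr.
have X3 : X (x2 + q * 1%:Z * -1) = X x2 + 2 * pi * (-1) by rewrite phase_shift // intrN.
have f3 : F (x2 + q * 1%:Z * -1) y2 = C.
  by have := wave_shift Rr Ss s0 t0 x2 y2 (-1) 0 q0 (isT : (0 < 1)%N) nu0; rewrite mulr0 addr0 => ->.
have l3 : lat q p (x2 + q * 1%:Z * -1) y2.
  by have := lat_period (Posz 1) (Posz nu) (-1) 0 l2; rewrite mulr0 addr0.
have wx : `|X x1 - X (x2 + q * 1%:Z * -1)| <= 2 * pi.
  move: hx1 hx2; rewrite X3 !ler_norml => /andP[a1 a2] /andP[a3 a4].
  by apply/andP; split; lra.
have cx' : 0 < cos ((X x1 + X (x2 + q * 1%:Z * -1)) / 2) by rewrite X3.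
have strict x y : lat q p x y -> between x1 (x2 - q) x -> between y1 y2 y -> x = x1 \/ x = x2 - q.
  have -> : x2 - q = x2 + q * 1%:Z * -1 by ring.
  move=> l bx by_.
  have [_ h _] := box_edges g R0 S0 b l1 l3 f1 f3 wx (width hy1 hy2) (ltW cx')
     (cos_half_ge0 hy) l bx by_.
  exact: h.
pose e := x2 - x1.
have X1 : 0 < X x1.
  by move: hx1 hx2; rewrite !ler_norml => /andP[a1 a2] /andP[a3 a4]; lra.
have X2 : X x2 <= pi by move: hx2; rewrite ler_norml => /andP[].
have e0 : 0 <= e.
  rewrite subr_ge0 -(ler_int R); move: x12; rewrite lerD2r ler_pM2l //.
have e1 : 2 * e < q.
  have : 2 * e < q * 1%:Z.
    rewrite -(ltr_int R) -(ltr_pM2l st) step_period // /e intrM intrD intrN.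
    lra.
  by rewrite mulr1.
clear cx X3 f3 l3 wx cx' st.
have [y12|y12] := eqVneq y1 y2.
  have l : lat q p e 0 by rewrite -(subrr y1) {1}y12; apply: latB.
  have [k ek] := lat_horizontal (ghp g) l.
  have e00 : e = 0 by apply: (small_multiple q0 (esym ek)); clear - e0 e1; lia.
  have -> : x2 = x1 by move: e00; rewrite /e; clear; lia.
  by move=> x y _; rewrite -y12 /between; clear; lia.
pose h := `|y2 - y1|%N; pose sg : int := if y1 < y2 then 1 else -1.
have hsg : sg = 1 \/ sg = -1 by rewrite /sg; case: ifP; [left|right].
have h0 : (0 < h)%N by rewrite /h; clear - y12; lia.
have yE : y2 = y1 + sg * h%:Z by rewrite /sg /h; case: ifP => h'; clear - h' y12; lia.
clearbody sg h.
pose t := (sg * p' %% q)%Z.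
have [D eD] : exists D, sg * p' = D * q + t by exists (sg * p' %/ q)%Z; exact: divz_eq.
have tge : 0 <= t by apply: modz_ge0; exact: lt0r_neq0 q0.
have tq : t < q by apply: ltz_pmod; exact: q0.
have lt : lat q p t sg.
  have [k0 ek] := ghp g; exists (p * D + sg * k0).
  have -> : t = sg * p' - D * q by rewrite eD; ring.
  rewrite -[LHS]mulr1 ek; ring.
clearbody t.
(* a residue r between e and q would give the lattice point (x1 + r - q, y1 + sg k) of the
   box for the new lift, off its vertical sides *)
have res (k : int) (r : int) : 0 <= k -> k <= h%:Z -> 0 <= r -> r < q ->
    lat q p r (sg * k) -> r <= e.
  move=> k0 kh r0 rq lr; rewrite leNgt; apply/negP => er.
  have lr' : lat q p (x1 + r - q) (y1 + sg * k).
    rewrite -[y1 + _]subr0; apply: latB; first exact: latD.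
    exact: lat_q0.
  have bx : between x1 (x2 - q) (x1 + r - q) by right; move: er; rewrite /e; clear - rq; lia.
  have by_ : between y1 y2 (y1 + sg * k).
    by rewrite yE /between; case: hsg => ->; clear - k0 kh; lia.
  by have := strict _ _ lr' bx by_; move: er; rewrite /e; clear - rq; lia.
have tpos : 0 < t.
  rewrite lt_neqAle tge andbT; apply/eqP => t00; rewrite -t00 in lt.
  have [k ek] := lt; move: ek; rewrite mulr0 add0r => ek.
  have : sg = 0 by apply: (small_multiple q0 (esym ek)); have := gq1 g; case: hsg => ->; clear; lia.
  by case: hsg => ->.
have h1 : (1 : int) <= h%:Z by clear - h0; lia.
have te : t <= e by apply: (res 1 t) => //; rewrite mulr1.
have lin (k : nat) : (k <= h)%N -> t * k%:Z <= e.
  elim: k => [|k IH] kh; first by rewrite mulr0.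
  have kt := IH (ltnW kh).
  have s : t * k.+1%:Z = t * k%:Z + t by rewrite -addn1 PoszD mulrDr mulr1.
  apply: (res k.+1%:Z) => //.
  - by rewrite mulr_ge0.
  - by rewrite s; clear - kt te e1; lia.
  - by rewrite !(mulrC _ k.+1%:Z); exact: latZ.
have ht := lin h (leqnn h).
have eE : e = t * h%:Z.
  have l : lat q p (e - t * h%:Z) 0.
    rewrite -(subrr (sg * h%:Z)); apply: latB.
      have -> : sg * h%:Z = y2 - y1 by rewrite yE; ring.
      exact: latB.
    by rewrite !(mulrC _ h%:Z); exact: latZ.
  have [k ek] := lat_horizontal (ghp g) l.
  have : e - t * h%:Z = 0.
    apply: (small_multiple q0 (esym ek)).
    have : 0 <= t * h%:Z by rewrite mulr_ge0.
    by clear - ht e0 e1; lia.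
  by clear; lia.
have x2E : x2 = x1 + t * h%:Z by rewrite -eE /e; clear; lia.
have hle : (h <= 1)%N.
  rewrite leqNgt; apply/negP => h2.
  rewrite x2E yE in f2 hy; rewrite x2E in X2.
  exact: (wrap_line tpos hsg lt l1 h2 f1 f2 X1 X2 hy).
have h1' : h = 1%N by clear - hle h0; lia.
rewrite h1' mulr1 in yE; rewrite h1' mulr1 in x2E.
move=> x y l bx by_.
have [yy|yy] : y = y1 \/ y = y2.
  by move: by_; rewrite yE /between; case: hsg => ->; clear; lia.
- left; split=> //; rewrite yy in l.
  have l' : lat q p (x - x1) 0 by rewrite -(subrr y1); apply: latB.
  have [k ek] := lat_horizontal (ghp g) l'.
  have : x - x1 = 0.
    apply: (small_multiple q0 (esym ek)); move: bx; rewrite x2E /between; clear - tpos tq; lia.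
  by clear; lia.
right; split=> //; rewrite yy in l.
have l' : lat q p (x - x2) 0 by rewrite -(subrr y2); apply: latB.
have [k ek] := lat_horizontal (ghp g) l'.
have : x - x2 = 0.
  apply: (small_multiple q0 (esym ek)); move: bx; rewrite x2E /between; clear - tpos tq; lia.
by clear; lia.
Qed.

End Wrap.

Lemma wrap_empty (q p p' : int) (nu : nat) (Rr Ss s0 t0 C : R) x1 y1 x2 y2 :
  good q p p' 1 nu -> 0 < Rr -> 0 < Ss -> (1 < nu)%N -> bounded q p 1 nu Rr Ss s0 t0 C ->
  maximizer q p 1 nu Rr Ss s0 t0 C x1 y1 -> maximizer q p 1 nu Rr Ss s0 t0 C x2 y2 ->
  empty_box q p x1 y1 x2 y2.
Proof.
move=> g R0 S0 nu1 b e1 e2; have hp := ghp g.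
have hy := nowrap (goodC g) S0 R0 (boundedC hp b) nu1 (maximizerC hp e1) (maximizerC hp e2).
have [hx|] := lerP `|(step q 1 * x1%:~R - s0) + (step q 1 * x2%:~R - s0)| pi.
  exact: (direct_empty g R0 S0 b).
rewrite lter_normr => /orP[wr|wr]; first exact: (wrap_up g R0 S0 nu1 b).
apply/empty_box_opp/(wrap_up (good_opp g) R0 S0 nu1 (bounded_opp b)) => //.
- exact: maximizer_opp.
- exact: maximizer_opp.
- by rewrite !intrN !mulrN -!opprD.
Qed.

(** A coordinate with multiplicity above 1 does not wrap around by nowrap, and at most one
    multiplicity is 1. *)
Theorem maximizers_empty (q p p' : int) (mu nu : nat) (Rr Ss s0 t0 C : R) x1 y1 x2 y2 :
  good q p p' mu nu -> 0 < Rr -> 0 < Ss -> bounded q p mu nu Rr Ss s0 t0 C ->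
  maximizer q p mu nu Rr Ss s0 t0 C x1 y1 -> maximizer q p mu nu Rr Ss s0 t0 C x2 y2 ->
  empty_box q p x1 y1 x2 y2.
Proof.
move=> g R0 S0 b e1 e2; have hp := ghp g; have [_ one _ _] := g.
have [mu1|mu1] := ltnP 1 mu; last first.
  have mu1' : mu = 1%N by apply/eqP; rewrite eqn_leq mu1 (gmu0 g).
  by subst mu; case: one => // nu1; exact: (wrap_empty g R0 S0 nu1 b).
have [nu1|nu1] := ltnP 1 nu; last first.
  have nu1' : nu = 1%N by apply/eqP; rewrite eqn_leq nu1 (gnu0 g).
  subst nu; apply: (empty_boxC hp).
  exact: (wrap_empty (goodC g) S0 R0 mu1 (boundedC hp b) (maximizerC hp e1) (maximizerC hp e2)).
apply: (direct_empty g R0 S0 b e1 e2); first exact: nowrap g R0 S0 b mu1 e1 e2.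
exact: nowrap (goodC g) S0 R0 (boundedC hp b) nu1 (maximizerC hp e1) (maximizerC hp e2).
Qed.

End Wave.

(** * Parallelograms as sets of maximizers *)

(** Each w' to the right of u is joined to a point w on the left by a segment of steepest
    descent; the least steep of these segments lies on a supporting line. *)
Lemma upper_edge (R : realFieldType) (s : seq (R * R)) (u v : R * R) : u \in s -> v \in s ->
  u.1 < v.1 -> v.2 < u.2 -> (forall z, z \in s -> u.1 < z.1 -> z.2 <= v.2) ->
  exists w w' (k : R), [/\ w \in s /\ w' \in s, w.1 <= u.1, u.1 < w'.1, 0 < k &
     (forall z, z \in s -> k * z.1 + z.2 <= k * w.1 + w.2) /\
     k * w'.1 + w'.2 = k * w.1 + w.2].
Proof.
move=> us vs uv vu hs.
pose sl (w' w : R * R) := (w.2 - w'.2) / (w'.1 - w.1).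
pose L := [seq z <- s | z.1 <= u.1]; pose Rt := [seq z <- s | u.1 < z.1].
have uL : u \in L by rewrite mem_filter lexx.
have vR : v \in Rt by rewrite mem_filter uv.
have hL w' : exists w, w \in L /\ forall y, y \in L -> sl w' y <= sl w' w.
  by have [x] := seq_argmax (sl w') uL; exists x.
pose best w' := projT1 (cid (hL w')).
have bestL w' : best w' \in L by rewrite /best; case: cid => x /= [].
have bestM w' y : y \in L -> sl w' y <= sl w' (best w') by rewrite /best; case: cid => x /= [_]; apply.
have [w' wR wM] := seq_argmax (fun w' => - sl w' (best w')) vR.
pose w := best w'; pose k := sl w' w.
have inR z : z \in Rt -> z \in s /\ u.1 < z.1 by rewrite mem_filter => /andP[].
have inL z : z \in L -> z \in s /\ z.1 <= u.1 by rewrite mem_filter => /andP[].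
have [w's w'1] := inR _ wR; have [ws w1] := inL _ (bestL w').
have dpos z y : z \in Rt -> y \in L -> 0 < z.1 - y.1.
  by move=> /inR[_ h1] /inL[_ h2]; rewrite subr_gt0; exact: le_lt_trans h1.
have slk z y (t : R) : z \in Rt -> y \in L -> (sl z y <= t) = (t * y.1 + y.2 <= t * z.1 + z.2).
  move=> zR yL; rewrite /sl ler_pdivrMr ?dpos // mulrBr; apply/idP/idP => h; lra.
have slk' z y (t : R) : z \in Rt -> y \in L -> (t <= sl z y) = (t * z.1 + z.2 <= t * y.1 + y.2).
  move=> zR yL; rewrite /sl ler_pdivlMr ?dpos // mulrBr; apply/idP/idP => h; lra.
have eqw : k * w'.1 + w'.2 = k * w.1 + w.2.
  have wL : w \in L by exact: bestL.
  apply/eqP; rewrite eq_le; apply/andP; split.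
    by rewrite -(slk' w' w k wR wL) lexx.
  by rewrite -(slk w' w k wR wL) lexx.
exists w, w', k; split => //; last first.
  split=> // z zs; have [zu|zu] := lerP z.1 u.1.
    have zL : z \in L by rewrite mem_filter zu.
    by rewrite -eqw -(slk w' z k wR zL) bestM.
  have zR : z \in Rt by rewrite mem_filter zu.
  have kz : k <= sl z (best z) by have := wM _ zR; rewrite lerN2.
  rewrite (slk' _ _ _ zR (bestL z)) in kz; apply: (le_trans kz).
  by rewrite -eqw -(slk w' (best z) k wR (bestL z)) bestM.
apply: lt_le_trans (bestM w' u uL).
by rewrite /sl divr_gt0 ?dpos // subr_gt0; apply: le_lt_trans vu; apply: hs.
Qed.

Lemma mulz_ge1 (n a : int) : 0 < n -> 0 < a -> a <= n * a.
Proof. by move=> n0 a0; rewrite ler_peMl ?(ltW a0) // -gtz0_ge1. Qed.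

(** Twice a lattice point minus the sum of the sides is m (a, c) + n (b, - d) with m and n odd;
    its abscissa is at least a + b in absolute value if m n > 0, its ordinate at least c + d
    if m n < 0. *)
Lemma centred_box_empty q p a c b d x y : 0 < q -> 0 < a -> 0 < c -> 0 < b -> 0 < d ->
  lat q p a c -> lat q p b (- d) -> a * d + b * c = q ->
  lat q p x y -> `|2 * x - (a + b)| < a + b -> c + d <= `|2 * y - (c - d)|.
Proof.
move=> q0 a0 c0 b0 d0 hA hB D l.
have [i [j [-> ->]]] := lat_decomp q0 hA hB D l.
have -> : 2 * (i * a + j * b) - (a + b) = (2 * i - 1) * a + (2 * j - 1) * b by ring.
have -> : 2 * (i * c - j * d) - (c - d) = (2 * i - 1) * c - (2 * j - 1) * d by ring.
pose m := 2 * i - 1; pose n := 2 * j - 1; rewrite -/m -/n.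
have m0 : m != 0 by rewrite /m; lia.
have n0 : n != 0 by rewrite /n; lia.
clearbody m n; clear - a0 b0 c0 d0 m0 n0.
have [mp|mn] : 0 < m \/ 0 < - m by lia.
  have [np|nn] : 0 < n \/ 0 < - n by lia.
    by have := mulz_ge1 mp a0; have := mulz_ge1 np b0; lia.
  by have := mulz_ge1 mp c0; have := mulz_ge1 nn d0; rewrite !mulNr; lia.
have [np|nn] : 0 < n \/ 0 < - n by lia.
  by have := mulz_ge1 mn c0; have := mulz_ge1 np d0; rewrite !mulNr; lia.
by have := mulz_ge1 mn a0; have := mulz_ge1 nn b0; rewrite !mulNr; lia.
Qed.

Section Wave.
Variable R : realType.
Local Notation step := (@angle_step R).

Theorem maximizers_parallelogram q p p' mu nu (Rr Ss s0 t0 C : R) x0 y0 x1 y1 x2 y2 x3 y3 :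
  good q p p' mu nu -> 0 < Rr -> 0 < Ss -> bounded q p mu nu Rr Ss s0 t0 C ->
  let E := maximizer q p mu nu Rr Ss s0 t0 C in
  E x0 y0 -> E x1 y1 -> E x2 y2 -> E x3 y3 ->
  x0 <> x1 \/ y0 <> y1 -> x0 <> x2 \/ y0 <> y2 -> x0 <> x3 \/ y0 <> y3 ->
  x1 <> x2 \/ y1 <> y2 -> x1 <> x3 \/ y1 <> y3 -> x2 <> x3 \/ y2 <> y3 ->
  exists xo yo a c b d, [/\ [/\ 0 < a, 0 < c, 0 < b & 0 < d],
    [/\ lat q p a c, lat q p b (- d) & a * d + b * c = q] &
    forall x y, E x y <-> in_parallelogram xo yo a c b d x y].
Proof.
move=> g R0 S0 b E; apply: (empty_family_parallelogram (gq0 g)).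
  by move=> x y [].
by move=> x y x' y' e e'; exact: (maximizers_empty g R0 S0 b e e').
Qed.

Lemma reduce_coord q m (s : R) (x : int) : 0 < q -> (0 < m)%N ->
  exists k : int, `|step q m * (x + q * m%:Z * k)%:~R - s| <= pi.
Proof.
move=> q0 m0; have [k hk] := reduce_angle (step q m * x%:~R - s).
by exists k; rewrite phase_shift.
Qed.

Lemma lattice_reps q p mu nu (s0 t0 : R) : 0 < q -> (0 < mu)%N -> (0 < nu)%N ->
  exists s : seq (int * int),
    (forall z, z \in s -> [/\ lat q p z.1 z.2, `|step q mu * z.1%:~R - s0| <= pi &
       `|step q nu * z.2%:~R - t0| <= pi]) /\
    (forall x y, lat q p x y -> exists k l,
       (x + q * mu%:Z * k, y + q * nu%:Z * l) \in s).
Proof.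
move=> q0 mu0 nu0.
pose rng (m : nat) : seq int := [seq Posz i | i <- iota 0 (`|q| * m)].
pose inl (z : int * int) := (q %| z.2 - p * z.1)%Z.
have inlP z : inl z <-> lat q p z.1 z.2.
  split; first by move=> /dvdzP[k e]; exists k; rewrite (mulrC q) -e; ring.
  by move=> [k e]; apply/dvdzP; exists k; rewrite e; ring.
pose rx (x : int) := x + q * mu%:Z * projT1 (cid (reduce_coord s0 x q0 mu0)).
pose ry (y : int) := y + q * nu%:Z * projT1 (cid (reduce_coord t0 y q0 nu0)).
pose pts := [seq z <- allpairs pair (rng mu) (rng nu) | inl z].
have rep (z : int) (m : nat) : (0 < m)%N -> exists k : int, z + q * m%:Z * k \in rng m.
  move=> m0; have N0 : q * m%:Z != 0 by rewrite mulf_neq0 ?lt0r_neq0.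
  exists (- (z %/ (q * m%:Z))%Z).
  have -> : z + q * m%:Z * - (z %/ (q * m%:Z))%Z = (z %% (q * m%:Z))%Z.
    by rewrite {1}(divz_eq z (q * m%:Z)); ring.
  have h1 : 0 <= (z %% (q * m%:Z))%Z by apply: modz_ge0.
  have h2 : (z %% (q * m%:Z))%Z < q * m%:Z by apply: ltz_pmod; rewrite mulr_gt0.
  apply/mapP; exists `|(z %% (q * m%:Z))%Z|%N; last by rewrite gez0_abs.
  rewrite mem_iota /= add0n; rewrite -ltz_nat gez0_abs // PoszM gez0_abs // ltW //.
exists [seq (rx z.1, ry z.2) | z <- pts]; split.
  move=> _ /mapP[[x y] + ->]; rewrite mem_filter => /andP[/inlP l _] /=; split.
  - exact: lat_period.
  - by rewrite /rx; case: cid.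
  - by rewrite /ry; case: cid.
move=> x y l; have [k hk] := rep x mu mu0; have [k' hk'] := rep y nu nu0.
exists (k + projT1 (cid (reduce_coord s0 (x + q * mu%:Z * k) q0 mu0))).
exists (k' + projT1 (cid (reduce_coord t0 (y + q * nu%:Z * k') q0 nu0))).
apply/mapP; exists (x + q * mu%:Z * k, y + q * nu%:Z * k').
  rewrite mem_filter; apply/andP; split; first exact/inlP/lat_period.
  by apply/allpairsP; exists (x + q * mu%:Z * k, y + q * nu%:Z * k').
by rewrite /rx /ry /= !(mulrDr (q * _)) !addrA.
Qed.

Section Centred.
Variables (q p p' : int) (mu nu : nat) (a c b d : int).
Hypotheses (g : good q p p' mu nu) (a0 : 0 < a) (c0 : 0 < c) (b0 : 0 < b) (d0 : 0 < d).
Hypotheses (hA : lat q p a c) (hB : lat q p b (- d)) (D : a * d + b * c = q).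

Definition centre_x : R := step q mu * (a + b)%:~R / 2.
Definition centre_y : R := step q nu * (c - d)%:~R / 2.
Local Notation X x := (step q mu * x%:~R - centre_x).
Local Notation Y y := (step q nu * y%:~R - centre_y).

Let q0 : 0 < q := gq0 g.
Let mu0 : (0 < mu)%N := gmu0 g.
Let nu0 : (0 < nu)%N := gnu0 g.

Lemma centred_xE x : X x = step q mu / 2 * (2 * x - (a + b))%:~R.
Proof. by rewrite /centre_x !(rmorphB, rmorphD, rmorphM) /=; field. Qed.

Lemma centred_yE y : Y y = step q nu / 2 * (2 * y - (c - d))%:~R.
Proof. by rewrite /centre_y !(rmorphB, rmorphD, rmorphM) /=; field. Qed.

Lemma half_step_gt0 m : (0 < m)%N -> 0 < step q m / 2.
Proof. by move=> m0; rewrite divr_gt0 // step_gt0. Qed.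

Lemma scaled_norm m (k : int) : (0 < m)%N -> `|step q m / 2 * k%:~R| = step q m / 2 * `|k|%:~R.
Proof.
by move=> m0; rewrite normrM (gtr0_norm (half_step_gt0 m0)) intr_norm.
Qed.

Lemma scaled_le_pi m (k : int) : (0 < m)%N -> `|k| <= q -> `|step q m / 2 * k%:~R| <= pi.
Proof.
move=> m0 k1; rewrite scaled_norm //.
have h : step q m * (q * m%:Z)%:~R = 2 * pi := step_period R q0 m0.
have -> : pi = step q m / 2 * (q * m%:Z)%:~R.
  by rewrite mulrAC h mulrC mulKf.
rewrite (ler_pM2l (half_step_gt0 m0)) ler_int.
by apply: le_trans k1 _; rewrite ler_peMr // ltW.
Qed.

Lemma scaled_cos_lt m (k l : int) : (0 < m)%N -> `|k| < `|l| ->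
  `|step q m / 2 * l%:~R| <= pi -> cos (step q m / 2 * l%:~R) < cos (step q m / 2 * k%:~R).
Proof.
move=> m0 kl lp; apply: cos_lt => //.
by rewrite !scaled_norm // (ltr_pM2l (half_step_gt0 m0)) ltr_int.
Qed.

Lemma scaled_cos_le m (k l : int) : (0 < m)%N -> `|k| <= `|l| ->
  `|step q m / 2 * l%:~R| <= pi -> cos (step q m / 2 * l%:~R) <= cos (step q m / 2 * k%:~R).
Proof.
move=> m0 kl lp; apply: cos_le => //.
by rewrite !scaled_norm // (ler_pM2l (half_step_gt0 m0)) ler_int.
Qed.

(** The points u and v are the images under (cos X, cos Y) of the vertices (0, 0) and (a, c).
    By centred_box_empty, images to the right of u are not above v; hence upper_edge gives
    positive amplitudes and two points of maximal value whose mirror images in the centre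
    are maximal too.  The maximizers thus form a parallelogram with the same centre, and
    comparing the empty boxes of the two parallelograms shows that they are equal. *)
Theorem parallelogram_supported : exists Rr Ss C : R, [/\ 0 < Rr, 0 < Ss,
   bounded q p mu nu Rr Ss centre_x centre_y C &
   forall x y, maximizer q p mu nu Rr Ss centre_x centre_y C x y <->
      in_parallelogram 0 0 a c b d x y].
Proof.
have [abq cdq _ _] := area_bounds a0 c0 b0 d0 D.
pose xe (z : int * int) : R * R := (cos (X z.1), cos (Y z.2)).
have [pts [ptsP repP]] := lattice_reps p centre_x centre_y q0 mu0 nu0.
pose s := map xe pts.
have ins x y : lat q p x y -> xe (x, y) \in s.
  move=> /repP[k [l h]]; apply/mapP; eexists; first exact: h.
  by rewrite /xe /= !phase_shift // !cosD2piz.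
have outs z : z \in s -> exists x y, [/\ lat q p x y, z = xe (x, y), `|X x| <= pi & `|Y y| <= pi].
  by move=> /mapP[[x y] /ptsP[l hx hy] ->]; exists x, y.
pose u := xe (0, 0); pose v := xe (a, c).
have Xu : X 0 = step q mu / 2 * (- (a + b))%:~R by rewrite centred_xE mulr0 sub0r.
have Yu : Y 0 = step q nu / 2 * (- (c - d))%:~R by rewrite centred_yE mulr0 sub0r.
have Xv : X a = step q mu / 2 * (a - b)%:~R by rewrite centred_xE; congr (_ * _%:~R); ring.
have Yv : Y c = step q nu / 2 * (c + d)%:~R by rewrite centred_yE; congr (_ * _%:~R); ring.
have Xup : `|X 0| <= pi by rewrite Xu scaled_le_pi // normrN ger0_norm // addr_ge0 // ltW.
have Yvp : `|Y c| <= pi by rewrite Yv scaled_le_pi // ger0_norm // addr_ge0 // ltW.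
have uv1 : u.1 < v.1.
  by rewrite /= Xv Xu; apply: scaled_cos_lt; rewrite -?Xu //; clear - a0 b0; lia.
have uv2 : v.2 < u.2.
  by rewrite /= Yv Yu; apply: scaled_cos_lt; rewrite -?Yv //; clear - c0 d0; lia.
have emp z : z \in s -> u.1 < z.1 -> z.2 <= v.2.
  move=> /outs[x [y [l -> hx hy]]] /=; rewrite Yv => h.
  have hw : `|2 * x - (a + b)| < a + b.
    rewrite ltNge; apply/negP => hn; move: h; rewrite ltNge => /negP; apply.
    rewrite Xu centred_xE; apply: scaled_cos_le; rewrite -?centred_xE // normrN ger0_norm //.
    by rewrite addr_ge0 // ltW.
  have := centred_box_empty q0 a0 c0 b0 d0 hA hB D l hw => hw2.
  rewrite centred_yE; apply: scaled_cos_le; rewrite -?centred_yE // ger0_norm //.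
  by rewrite addr_ge0 // ltW.
have us : u \in s by apply: ins; exact: lat0.
have vs : v \in s by apply: ins.
have [w [w' [k [[ws w's] wu uw' k0 [sup eqw]]]]] := upper_edge us vs uv1 uv2 emp.
pose C := k * w.1 + w.2.
have bd : bounded q p mu nu k 1 centre_x centre_y C.
  by move=> x y /ins /sup; rewrite /wave mul1r.
exists k, 1, C; split=> //.
pose E := maximizer q p mu nu k 1 centre_x centre_y C.
have [xw [yw [lw ew hxw hyw]]] := outs _ ws.
have [xw' [yw' [lw' ew' hxw' hyw']]] := outs _ w's.
have Ew : E xw yw by split=> //; rewrite /C ew /wave mul1r.
have Ew' : E xw' yw' by split=> //; rewrite /C -eqw ew' /wave mul1r.
have symE x y : E x y -> E (a + b - x) (c - d - y).
  move=> [l f hx hy].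
  have eX : X (a + b - x) = - X x by rewrite !centred_xE -mulrN -intrN; congr (_ * _%:~R); ring.
  have eY : Y (c - d - y) = - Y y by rewrite !centred_yE -mulrN -intrN; congr (_ * _%:~R); ring.
  split; rewrite ?eX ?eY ?normrN //.
    by apply: latB => //; exact: latD.
  by move: f; rewrite /wave eX eY !cosN.
have noc x y : lat q p x y -> x <> a + b - x \/ y <> c - d - y.
  move=> l; have [i [j [ei ej]]] := lat_decomp q0 hA hB D l.
  have [hx|] := eqVneq x (a + b - x); last by left; exact/eqP.
  have [hy|] := eqVneq y (c - d - y); last by right; exact/eqP.
  exfalso; have [h1 _] : 2 * i - 1 = 0 /\ 2 * j - 1 = 0.
    apply: (@independent_combination a c b (- d)).
    - by rewrite mulrN -opprD D oppr_eq0 lt0r_neq0.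
    - by move: hx; rewrite ei; clear; lia.
    - by move: hy; rewrite ej; clear; lia.
  by clear - h1; lia.
have ww' : cos (X xw) < cos (X xw').
  by have := le_lt_trans wu uw'; rewrite ew ew'.
have n1 : xw <> xw' by move=> e; move: ww'; rewrite e ltxx.
have cs x : cos (X (a + b - x)) = cos (X x).
  rewrite -cosN; congr cos; rewrite !centred_xE -mulrN -intrN; congr (_ * _%:~R); ring.
have n2 : xw <> a + b - xw' by move=> e; move: ww'; rewrite e cs ltxx.
have n3 : a + b - xw <> xw' by move=> e; move: ww'; rewrite -e cs ltxx.
have n4 : a + b - xw <> a + b - xw' by move=> /addrI /oppr_inj.
have [xo [yo [a' [c' [b' [d' [[a0' c0' b0' d0'] [hA' hB' D'] EP]]]]]]] :=
  maximizers_parallelogram g k0 ltr01 bd Ew (symE _ _ Ew) Ew' (symE _ _ Ew')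
   (noc _ _ lw) (or_introl n1) (or_introl n2) (or_introl n3) (or_introl n4) (noc _ _ lw').
rewrite -/E in EP *.
have [abq' cdq' _ _] := area_bounds a0' c0' b0' d0' D'.
have e0 : E xo yo by apply/EP; constructor 1.
have e1 : E (xo + a') (yo + c') by apply/EP; constructor 2.
have e2 : E (xo + b') (yo - d') by apply/EP; constructor 3.
have e3 : E (xo + (a' + b')) (yo + (c' - d')) by apply/EP; constructor 4.
have l0 : lat q p xo yo by case: e0.
(* the symmetry about the centre preserves the maximizers, so the centres are the same *)
have [cx cy] : 2 * xo + (a' + b') = a + b /\ 2 * yo + (c' - d') = c - d.
  have /EP h0 := symE _ _ e0; have /EP h1 := symE _ _ e1; have /EP h2 := symE _ _ e2.
  have /EP h3 := symE _ _ e3.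
  clear - h0 h1 h2 h3 a0' c0' b0' d0'.
  by move: h0 h1 h2 h3; rewrite /in_parallelogram => -[] [] ? ? [] [] ? ? [] [] ? ? [] [] ? ?; lia.
have emp' x y : lat q p x y -> `|2 * x - (a + b)| < a' + b' -> c' + d' <= `|2 * y - (c - d)|.
  move=> l; have l' : lat q p (x - xo) (y - yo) by apply: latB.
  have := centred_box_empty q0 a0' c0' b0' d0' hA' hB' D' l'.
  have -> : 2 * (x - xo) - (a' + b') = 2 * x - (a + b) by clear - cx; lia.
  by have -> : 2 * (y - yo) - (c' - d') = 2 * y - (c - d) by clear - cy; lia.
have X0 : cos (X xo) = cos (step q mu / 2 * (a' + b')%:~R).
  by rewrite -cosN centred_xE -mulrN -intrN; congr cos; congr (_ * _%:~R); clear - cx; lia.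
have X1 : cos (X (xo + a')) = cos (step q mu / 2 * (a' - b')%:~R).
  by rewrite centred_xE; congr cos; congr (_ * _%:~R); clear - cx; lia.
have pab : `|step q mu / 2 * (a' + b')%:~R| <= pi.
  by rewrite scaled_le_pi // ger0_norm // addr_ge0 // ltW.
have X01 : cos (X xo) < cos (X (xo + a')).
  by rewrite X0 X1; apply: scaled_cos_lt => //; clear - a0' b0'; lia.
have X2 : cos (X (xo + b')) = cos (X (xo + a')).
  by rewrite -cs; congr cos; congr (_ * _%:~R - _); clear - cx; lia.
have X3 : cos (X (xo + (a' + b'))) = cos (X xo).
  by rewrite -cs; congr cos; congr (_ * _%:~R - _); clear - cx; lia.
have [cw cw'] : cos (X xw) = cos (X xo) /\ cos (X xw') = cos (X (xo + a')).
  have /EP hw := Ew; have /EP hw' := Ew'.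
  have aw : cos (X xw) = cos (X xo) \/ cos (X xw) = cos (X (xo + a')).
    by case: hw => -[-> _]; rewrite ?X2 ?X3; [left|right|right|left].
  have aw' : cos (X xw') = cos (X xo) \/ cos (X xw') = cos (X (xo + a')).
    by case: hw' => -[-> _]; rewrite ?X2 ?X3; [left|right|right|left].
  by move: ww' X01; case: aw => ->; case: aw' => -> h h'; split=> //;
    move: h; rewrite ?ltxx // ltNge (ltW h').
have ab' : a + b <= a' + b'.
  rewrite leNgt; apply/negP => h.
  have : cos (X xw) <= cos (X 0) by move: wu; rewrite ew.
  rewrite cw X0 Xu leNgt => /negP; apply; apply: scaled_cos_lt; rewrite -?Xu //.
  by clear - h a0' b0'; lia.
have ab2 : `|a' - b'| < a + b.
  rewrite ltNge; apply/negP => h.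
  have : cos (X 0) < cos (X xw') by move: uw'; rewrite ew'.
  rewrite cw' X1 Xu ltNge => /negP; apply; apply: scaled_cos_le => //.
    by clear - h a0 b0; lia.
  rewrite scaled_le_pi //; clear - abq' a0' b0'; lia.
have cd' : c + d <= c' + d'.
  have [l1 _ _ _] := e1.
  have := centred_box_empty q0 a0 c0 b0 d0 hA hB D l1.
  have -> : 2 * (xo + a') - (a + b) = a' - b' by clear - cx; lia.
  have -> : 2 * (yo + c') - (c - d) = c' + d' by clear - cy; lia.
  by move=> /(_ ab2); rewrite ger0_norm // addr_ge0 // ltW.
have abE : a + b = a' + b'.
  have [//|h] : a + b = a' + b' \/ a + b < a' + b' by clear - ab'; lia.
  have := emp' 0 0 (lat0 _ _); rewrite !mulr0 !sub0r !normrN.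
  by clear - h cd' a0 b0 c0 d0; lia.
have cdE : c + d = c' + d'.
  have := emp' a c hA.
  have -> : 2 * a - (a + b) = a - b by ring.
  have -> : 2 * c - (c - d) = c + d by ring.
  by clear - abE cd' a0 b0 c0 d0; lia.
have xo0 : xo = 0 by clear - cx abE; lia.
have yo0 : yo = 0.
  have l : lat q p 0 yo by rewrite -xo0.
  have [k' ek'] := l; rewrite mulr0 add0r in ek'.
  apply: (small_multiple q0 (esym ek')).
  by clear - cy cdE cdq cdq' c0 d0 c0' d0'; lia.
have cE : c' = c by clear - cy yo0 cdE; lia.
have dE : d' = d by clear - cE cdE; lia.
have aE : a' = a.
  have l : lat q p (a' - a) 0 by rewrite -(subrr c) -{1}cE; apply: latB.
  have [k' ek'] := lat_horizontal (ghp g) l.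
  have := small_multiple q0 (esym ek').
  by clear - abE abq abq' a0 b0 a0' b0'; lia.
have bE : b' = b by clear - aE abE; lia.
by move=> x y; rewrite EP xo0 yo0 aE bE cE dE.
Qed.

End Centred.
End Wave.

(** * Affine independence of the vertices of a parallelogram *)

Section Wave.
Variable R : realType.
Local Notation step := (@angle_step R).

Lemma harmonic (A B : R) : exists r t, [/\ 0 <= r,
   forall z, A * cos z + B * sin z = r * cos (z - t) & A != 0 \/ B != 0 -> 0 < r].
Proof.
have [r [t [r0 eA eB]]] := polar A B; exists r, t; split=> // [z|].
  by rewrite eA eB cosB; ring.
rewrite lt_neqAle r0 andbT eA eB; have [<-|//] := eqVneq 0 r.
by rewrite !mul0r eqxx; case.
Qed.

Lemma max_pos_single q p p' mu nu (r s0 t0 C : R) : good q p p' mu nu -> 0 < r ->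
  bounded q p mu nu r 0 s0 t0 C -> 0 < C.
Proof.
move=> [[q1 hp mu0 nu0] _ qmu qnu] r0 b.
have p0 := pi_gt0 R.
have q0 : 0 < q by lia.
have st := step_gt0 R q0 mu0; have sp := step_period R q0 mu0.
have [x hx] := round_to (- s0) st.
have lk : lat q p x (p * x) by exists 0; ring.
have qmu3 : (3 : R) <= (q * mu%:Z)%:~R by rewrite (ler_int R 3).
have cx : 0 < cos (step q mu * x%:~R - s0).
  apply: cos_gt0_pihalf; rewrite -ltr_norml addrC; apply: le_lt_trans hx _.
  rewrite ltr_pM2r //; nra.
by apply: lt_le_trans (b _ _ lk); rewrite /wave mul0r addr0 mulr_gt0.
Qed.

Lemma max_pos_gen q p p' mu nu (r1 r2 s0 t0 C : R) : good q p p' mu nu ->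
  0 <= r1 -> 0 <= r2 -> 0 < r1 \/ 0 < r2 -> bounded q p mu nu r1 r2 s0 t0 C -> 0 < C.
Proof.
move=> g r1p r2p h b; have hp := ghp g; have b' := boundedC hp b.
have [e1|r10] := eqVneq r1 0.
  have r20 : 0 < r2 by case: h => //; rewrite e1 ltxx.
  by rewrite e1 in b'; exact: max_pos_single (goodC g) r20 b'.
have {}r10 : 0 < r1 by rewrite lt_neqAle eq_sym r10.
have [e2|r20] := eqVneq r2 0.
  by rewrite e2 in b; exact: max_pos_single g r10 b.
have {}r20 : 0 < r2 by rewrite lt_neqAle eq_sym r20.
exact: max_pos g r10 r20 b.
Qed.

Section Centred.
Variables (q p p' : int) (mu nu : nat) (a c b d : int).
Hypotheses (g : good q p p' mu nu) (a0 : 0 < a) (c0 : 0 < c) (b0 : 0 < b) (d0 : 0 < d).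
Hypotheses (hA : lat q p a c) (hB : lat q p b (- d)) (D : a * d + b * c = q).
Hypotheses (abN : a + b < q * mu%:Z) (cdN : c + d < q * nu%:Z).

Lemma parallelogram_noncong x y x' y' k l :
  in_parallelogram 0 0 a c b d x y -> in_parallelogram 0 0 a c b d x' y' ->
  x + q * mu%:Z * k = x' -> y + q * nu%:Z * l = y' -> x = x' /\ y = y'.
Proof.
move=> h h' ex ey.
have q0 := gq0 g; have mu0 := gmu0 g; have nu0 := gnu0 g.
have Nx : 0 < q * mu%:Z by rewrite mulr_gt0.
have Ny : 0 < q * nu%:Z by rewrite mulr_gt0.
have ex' : q * mu%:Z * k = x' - x by rewrite -ex; ring.
have ey' : q * nu%:Z * l = y' - y by rewrite -ey; ring.
have dx : x' - x = 0.
  apply: (small_multiple Nx ex'); apply: le_lt_trans abN.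
  clear - h h' a0 b0; by case: h => -[-> _]; case: h' => -[-> _]; lia.
have dy : y' - y = 0.
  apply: (small_multiple Ny ey'); apply: le_lt_trans cdN.
  clear - h h' c0 d0; by case: h => -[_ ->]; case: h' => -[_ ->]; lia.
by clear - dx dy; lia.
Qed.

Local Notation sx := (centre_x R q mu a b).
Local Notation sy := (centre_y R q nu c d).
Local Notation X x := (step q mu * x%:~R - sx).
Local Notation Y y := (step q nu * y%:~R - sy).

(** If the determinant vanished, some lam = rho sin X + sig sin Y would vanish at the four
    vertices.  As lam is a wave, it is positive at some lattice point; for the least eps such
    that the perturbed wave F + eps lam reaches C at a point with lam > 0, there are five
    maximizers, against maximizers_parallelogram. *)
Theorem parallelogram_nondegenerate (Rr Ss C : R) : 0 < Rr -> 0 < Ss ->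
  bounded q p mu nu Rr Ss sx sy C ->
  (forall x y, maximizer q p mu nu Rr Ss sx sy C x y <-> in_parallelogram 0 0 a c b d x y) ->
  sin (X 0) * sin (Y c) - sin (Y 0) * sin (X a) != 0.
Proof.
move=> R0 S0 bd EP; apply/eqP => D0.
have q0 := gq0 g; have mu0 := gmu0 g; have nu0 := gnu0 g.
have [rho [sig [nz z1 z2]]] : exists rho sig : R, [/\ rho != 0 \/ sig != 0,
    rho * sin (X 0) + sig * sin (Y 0) = 0 & rho * sin (X a) + sig * sin (Y c) = 0].
  have [e1|] := eqVneq (sin (X 0)) 0; last first.
    move=> h; exists (- sin (Y 0)), (sin (X 0)); split; [by right|by ring|].
    by rewrite -D0; ring.
  have [e2|] := eqVneq (sin (Y 0)) 0; last first.
    move=> h; exists (- sin (Y 0)), (sin (X 0)); split; [by left; rewrite oppr_eq0|by ring|].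
    by rewrite -D0; ring.
  have [e3|] := eqVneq (sin (X a)) 0; last first.
    move=> h; exists (- sin (Y c)), (sin (X a)); split; [by right|rewrite e1 e2; ring|ring].
  by exists 1, 0; rewrite e1 e3 oner_neq0; split; [left|ring|ring].
pose lam x y := rho * sin (X x) + sig * sin (Y y).
have Xop x : X (a + b - x) = - X x.
  by rewrite !centred_xE -mulrN -intrN; congr (_ * _%:~R); ring.
have Yop y : Y (c - d - y) = - Y y.
  by rewrite !centred_yE -mulrN -intrN; congr (_ * _%:~R); ring.
have lamop x y : lam (a + b - x) (c - d - y) = - lam x y.
  by rewrite /lam Xop Yop !sinN; ring.
have lamV x y : in_parallelogram 0 0 a c b d x y -> lam x y = 0.
  have l0 : lam 0 0 = 0 := z1; have l1 : lam a c = 0 := z2.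
  case=> -[-> ->]; rewrite ?(add0r a) ?(add0r b) ?(add0r c) ?(add0r (- d)) ?(add0r (a + b)) ?(add0r (c - d)) //.
    have := lamop a c; rewrite l1 oppr0 addrAC subrr add0r.
    by rewrite (addrC c) addrK.
  by have := lamop 0 0; rewrite l0 !subr0 oppr0.
have lamsh x y k l : lam (x + q * mu%:Z * k) (y + q * nu%:Z * l) = lam x y.
  by rewrite /lam !phase_shift // !sinD2piz.
have [r1 [u1 [r1p h1 n1]]] := harmonic 0 rho.
have [r2 [u2 [r2p h2 n2]]] := harmonic 0 sig.
have lamE x y : lam x y = wave q mu nu r1 r2 (sx + u1) (sy + u2) x y.
  by rewrite /lam /wave !opprD !addrA -h1 -h2 !mul0r !add0r.
have [x5 [y5 [l5 p5]]] : exists x y, lat q p x y /\ 0 < lam x y.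
  apply: contrapT => H.
  suff : (0 : R) < 0 by rewrite ltxx.
  apply: (@max_pos_gen q p p' mu nu r1 r2 (sx + u1) (sy + u2) 0 g r1p r2p).
    by case: nz => h; [left; apply: n1; right|right; apply: n2; right].
  move=> x y l; rewrite -lamE leNgt; apply/negP => h.
  by apply: H; exists x, y.
have [pts [ptsP repP]] := lattice_reps p sx sy q0 mu0 nu0.
pose F := wave q mu nu Rr Ss sx sy.
have Fsh x y k l : F (x + q * mu%:Z * k) (y + q * nu%:Z * l) = F x y by exact: wave_shift.
pose pos := [seq z <- pts | 0 < lam z.1 z.2].
have [k5 [m5 h5]] := repP _ _ l5.
have w5 : (x5 + q * mu%:Z * k5, y5 + q * nu%:Z * m5) \in pos.
  by rewrite mem_filter h5 andbT /= lamsh.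
have [[xm ym]] := seq_argmax (fun z : int * int => - ((C - F z.1 z.2) / lam z.1 z.2)) w5.
rewrite mem_filter /= => /andP[lm mpts] mmin.
have [lmm _ _] := ptsP _ mpts; rewrite /= in lmm.
(* the least coefficient for which a point with lam > 0 reaches C *)
pose eps := (C - F xm ym) / lam xm ym.
have eps0 : 0 <= eps by rewrite divr_ge0 ?(ltW lm) // subr_ge0; exact: bd.
have [s1 [v1 [s1p k1 n1']]] := harmonic Rr (eps * rho).
have [s2 [v2 [s2p k2 n2']]] := harmonic Ss (eps * sig).
pose tx := sx + v1; pose ty := sy + v2.
have GE x y : wave q mu nu s1 s2 tx ty x y = F x y + eps * lam x y.
  by rewrite /wave /tx /ty !opprD !addrA -k1 -k2 /F /wave /lam; ring.
have s10 : 0 < s1 by apply: n1'; left; exact: lt0r_neq0.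
have s20 : 0 < s2 by apply: n2'; left; exact: lt0r_neq0.
have bd' : bounded q p mu nu s1 s2 tx ty C.
  move=> x y l; rewrite GE; have [lp|ln] := ltrP 0 (lam x y); last first.
    by have := bd x y l; rewrite -/(F x y); have : eps * lam x y <= 0; [rewrite mulr_ge0_le0|lra].
  have [k [m h]] := repP _ _ l.
  have hpos : (x + q * mu%:Z * k, y + q * nu%:Z * m) \in pos.
    by rewrite mem_filter h andbT /= lamsh.
  have := mmin _ hpos; rewrite lerN2 /= lamsh Fsh -/eps ler_pdivlMr //; lra.
have five x y : lat q p x y -> F x y + eps * lam x y = C ->
    exists k l, maximizer q p mu nu s1 s2 tx ty C (x + q * mu%:Z * k) (y + q * nu%:Z * l).
  move=> l e; have [k hk] := reduce_coord tx x q0 mu0; have [m hm] := reduce_coord ty y q0 nu0.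
  exists k, m; split=> //; first exact: lat_period.
  by rewrite wave_shift // GE.
have fiveV x y : in_parallelogram 0 0 a c b d x y ->
    exists k l, maximizer q p mu nu s1 s2 tx ty C (x + q * mu%:Z * k) (y + q * nu%:Z * l).
  move=> h; have /EP[l f _ _] := h; apply: five => //.
  by rewrite lamV // mulr0 addr0.
have V0 : in_parallelogram 0 0 a c b d 0 0 by constructor 1.
have V1 : in_parallelogram 0 0 a c b d a c by constructor 2; rewrite !add0r.
have V2 : in_parallelogram 0 0 a c b d b (- d) by constructor 3; rewrite !add0r.
have V3 : in_parallelogram 0 0 a c b d (a + b) (c - d) by constructor 4; rewrite !add0r.
have [i0 [j0 m0]] := fiveV _ _ V0; have [i1 [j1 m1]] := fiveV _ _ V1.
have [i2 [j2 m2]] := fiveV _ _ V2; have [i3 [j3 m3]] := fiveV _ _ V3.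
have [i4 [j4 m4]] : exists k l,
    maximizer q p mu nu s1 s2 tx ty C (xm + q * mu%:Z * k) (ym + q * nu%:Z * l).
  by apply: five => //; rewrite /eps divfK ?lt0r_neq0 //; ring.
have ne x y x' y' k l k' l' : in_parallelogram 0 0 a c b d x y ->
    in_parallelogram 0 0 a c b d x' y' -> (x, y) != (x', y') ->
    (x + q * mu%:Z * k, y + q * nu%:Z * l) != (x' + q * mu%:Z * k', y' + q * nu%:Z * l').
  move=> h h'; apply: contra_neq => -[ex ey].
  have ex' : x + q * mu%:Z * (k - k') = x' by rewrite mulrBr addrA ex; ring.
  have ey' : y + q * nu%:Z * (l - l') = y' by rewrite mulrBr addrA ey; ring.
  by have [-> ->] := parallelogram_noncong h h' ex' ey'.
have nem x y k l : in_parallelogram 0 0 a c b d x y ->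
    (x + q * mu%:Z * k, y + q * nu%:Z * l) != (xm + q * mu%:Z * i4, ym + q * nu%:Z * j4).
  move=> h; apply/eqP => -[ex ey].
  have := lamsh x y k l; rewrite ex ey lamsh (lamV _ _ h) => e.
  by move: lm; rewrite e ltxx.
have d01 : (0, 0) != (a, c) by rewrite xpair_eqE !(eq_sym 0) (gt_eqF a0).
have d02 : (0, 0) != (b, - d) by rewrite xpair_eqE !(eq_sym 0) (gt_eqF b0).
have d03 : (0, 0) != (a + b, c - d) by rewrite xpair_eqE !(eq_sym 0) gt_eqF // addr_gt0.
have d12 : (a, c) != (b, - d).
  by apply/eqP => -[_ e]; move: c0; rewrite e oppr_gt0 ltNge (ltW d0).
have d13 : (a, c) != (a + b, c - d) by apply/eqP => -[e _]; clear - e b0; lia.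
have d23 : (b, - d) != (a + b, c - d) by apply/eqP => -[e _]; clear - e a0; lia.
have pn (x y x' y' : int) : (x, y) != (x', y') -> x <> x' \/ y <> y'.
  by rewrite xpair_eqE negb_and => /orP[] /eqP; [left|right].
have [xo [yo [a' [c' [b' [d' [_ _ EP']]]]]]] :=
  maximizers_parallelogram g s10 s20 bd' m0 m1 m2 m3
   (pn _ _ _ _ (ne _ _ _ _ i0 j0 i1 j1 V0 V1 d01)) (pn _ _ _ _ (ne _ _ _ _ i0 j0 i2 j2 V0 V2 d02))
   (pn _ _ _ _ (ne _ _ _ _ i0 j0 i3 j3 V0 V3 d03)) (pn _ _ _ _ (ne _ _ _ _ i1 j1 i2 j2 V1 V2 d12))
   (pn _ _ _ _ (ne _ _ _ _ i1 j1 i3 j3 V1 V3 d13)) (pn _ _ _ _ (ne _ _ _ _ i2 j2 i3 j3 V2 V3 d23)).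
pose P := [:: (xo, yo); (xo + a', yo + c'); (xo + b', yo - d'); (xo + (a' + b'), yo + (c' - d'))].
have inP x y : maximizer q p mu nu s1 s2 tx ty C x y -> (x, y) \in P.
  by move=> /EP' [] [-> ->]; rewrite /P !inE eqxx ?orbT.
pose Q := [:: (0 + q * mu%:Z * i0, 0 + q * nu%:Z * j0); (a + q * mu%:Z * i1, c + q * nu%:Z * j1);
   (b + q * mu%:Z * i2, - d + q * nu%:Z * j2); (a + b + q * mu%:Z * i3, c - d + q * nu%:Z * j3);
   (xm + q * mu%:Z * i4, ym + q * nu%:Z * j4)].
have uQ : uniq Q.
  by rewrite /Q /= !inE !negb_or !nem // !ne.
have sQ : {subset Q <= P}.
  apply/allP; rewrite /Q /all.
  by rewrite (inP _ _ m0) (inP _ _ m1) (inP _ _ m2) (inP _ _ m3) (inP _ _ m4).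
by have := uniq_leq_size uQ sQ.
Qed.

End Centred.
End Wave.

(** * Convex hulls, faces and dimension *)

Section Hull.
Variables (R : realType) (n : nat).
Implicit Types (A B E K F : set 'rV[R]_n) (l x y : 'rV[R]_n) (c : R).

Lemma dotC x y : dot x y = dot y x.
Proof. by apply: eq_bigr => i _; rewrite mulrC. Qed.

Lemma dotDr l x y : dot l (x + y) = dot l x + dot l y.
Proof. by rewrite -big_split; apply: eq_bigr => i _; rewrite mxE mulrDr. Qed.

Lemma dotZr l c x : dot l (c *: x) = c * dot l x.
Proof. by rewrite mulr_sumr; apply: eq_bigr => i _; rewrite mxE mulrCA. Qed.

Lemma dotNr l x : dot l (- x) = - dot l x.
Proof. by rewrite -scaleN1r dotZr mulN1r. Qed.

Lemma dotBr l x y : dot l (x - y) = dot l x - dot l y.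
Proof. by rewrite dotDr dotNr. Qed.

Lemma dot0r l : dot l 0 = 0.
Proof. by rewrite -(subrr l) dotBr subrr. Qed.

Lemma dot0l x : dot 0 x = 0.
Proof. by rewrite dotC dot0r. Qed.

Lemma dotE l x : dot l x = (x *m l^T) 0 0.
Proof. by rewrite mxE; apply: eq_bigr => i _; rewrite mxE mulrC. Qed.

(** Convexity with coefficients in the field, instead of elements of an interval type. *)
Definition cvx A := forall x y (t : R), A x -> A y -> 0 <= t -> t <= 1 -> A (t *: x + (1 - t) *: y).

Lemma cvxP A : cvx A <-> @convex_set R 'rV[R]_n A.
Proof.
split=> [cA x y t|cA x y t Ax Ay t0 t1].
  by rewrite !inE => Ax Ay; exact: cA.
by have := cA x y (Itv01 t0 t1); rewrite !inE; apply.
Qed.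

Lemma hull_sub A : A `<=` hull A.
Proof. exact: sub_smallest. Qed.

Lemma hull_min A B : cvx B -> A `<=` B -> hull A `<=` B.
Proof. by move=> /cvxP cB AB; apply: smallest_sub. Qed.

Lemma hull_cvx A : cvx (hull A).
Proof.
move=> x y t Ax Ay t0 t1 B BA; have [/cvxP cB _] := BA.
exact: cB (Ax B BA) (Ay B BA) t0 t1.
Qed.

Lemma hullS A B : A `<=` B -> hull A `<=` hull B.
Proof. by move=> AB; apply: hull_min; [exact: hull_cvx|exact: subset_trans (hull_sub (A := B))]. Qed.

Lemma hull_nonempty A x : hull A x -> A !=set0.
Proof.
move=> hx; have [//|/set0P/negP] := pselect (A !=set0).
rewrite negbK => /eqP A0; exfalso; move: hx; rewrite A0.
by apply: (hull_min (B := set0)) => // ? ? ? [].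
Qed.

Lemma hull_le A l c : (forall x, A x -> dot l x <= c) -> forall x, hull A x -> dot l x <= c.
Proof.
move=> h; apply: hull_min => // x y t hx hy t0 t1; rewrite dotDr !dotZr.
by have s0 : 0 <= 1 - t; [lra|have := ler_wpM2l t0 hx; have := ler_wpM2l s0 hy; rewrite mulrBl; lra].
Qed.

Lemma hull_eq A l c : (forall x, A x -> dot l x = c) -> forall x, hull A x -> dot l x = c.
Proof.
move=> h; apply: hull_min => // x y t hx hy t0 t1; rewrite dotDr !dotZr hx hy; ring.
Qed.

(** A convex combination of values at most c is c only if the values with a nonzero
    coefficient are. *)
Lemma face_hull A l c : (forall x, A x -> dot l x <= c) ->
  hull A `&` [set x | dot l x = c] = hull (A `&` [set x | dot l x = c]).
Proof.
move=> h; apply/seteqP; split => [x [hx]|x hx]; last first.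
  split; first by apply: hullS hx => y [].
  by apply: (hull_eq _ hx) => y [].
suff key : hull A `<=` (fun x => dot l x <= c /\
   (dot l x = c -> hull (A `&` [set x | dot l x = c]) x)) by have [_] := key x hx; apply.
apply: hull_min; last by move=> {hx}x Ax; split; [exact: h|move=> e; apply: hull_sub].
move=> {hx}x y t [x1 x2] [y1 y2] t0 t1.
have s0 : 0 <= 1 - t by lra.
split.
  by rewrite dotDr !dotZr; have := ler_wpM2l t0 x1; have := ler_wpM2l s0 y1; rewrite mulrBl; lra.
rewrite dotDr !dotZr => e.
have [t00|tn] := eqVneq t 0.
  rewrite t00 subr0 scale0r scale1r add0r; apply: y2; move: e; rewrite t00; lra.
have [t11|tn1] := eqVneq t 1.
  rewrite t11 subrr scale0r scale1r addr0; apply: x2; move: e; rewrite t11; lra.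
have t0' : 0 < t by rewrite lt_neqAle eq_sym tn.
have s0' : 0 < 1 - t by rewrite subr_gt0 lt_neqAle tn1.
apply: hull_cvx => //; [apply: x2|apply: y2]; apply/eqP; rewrite eq_le ?x1 ?y1 /=.
  by rewrite leNgt; apply/negP => hlt; have := ltr_pM2l t0' (dot l x) c; have := ler_wpM2l s0 y1;
   rewrite hlt mulrBl; lra.
by rewrite leNgt; apply/negP => hlt; have := ltr_pM2l s0' (dot l y) c; have := ler_wpM2l t0 x1;
   rewrite hlt mulrBl; lra.
Qed.

Lemma hull_rowspace E e0 m (M : 'M[R]_(m, n)) : (forall e, E e -> (e - e0 <= M)%MS) ->
  forall x, hull E x -> (x - e0 <= M)%MS.
Proof.
move=> h; apply: (@hull_min E (fun x => (x - e0 <= M)%MS)) => // x y t hx hy _ _.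
have -> : t *: x + (1 - t) *: y - e0 = t *: (x - e0) + (1 - t) *: (y - e0).
  rewrite !scalerBr addrACA -opprD -scalerDl addrCA subrr addr0 scale1r //.
by apply: addmx_sub; apply: scalemx_sub.
Qed.

Lemma aff_independent_rank k (x : 'I_k.+1 -> 'rV[R]_n) e0 m (M : 'M[R]_(m, n)) :
  (forall i, (x i - e0 <= M)%MS) -> aff_independent x -> (k <= \rank M)%N.
Proof.
move=> h; rewrite /aff_independent /row_free => /eqP <-; apply: mxrankS.
apply/row_subP => i; rewrite rowK.
have -> : x (lift ord0 i) - x ord0 = (x (lift ord0 i) - e0) - (x ord0 - e0).
  by rewrite opprB addrA subrK.
by apply: addmx_sub => //; rewrite eqmx_opp.
Qed.

Lemma has_dim_rank k E e0 m (M : 'M[R]_(m, n)) : has_dim k (hull E) ->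
  (forall e, E e -> (e - e0 <= M)%MS) -> (k <= \rank M)%N.
Proof.
move=> [[x xE xI] _] h; apply: (aff_independent_rank (x := x) (e0 := e0)) => // i.
exact: hull_rowspace (xE i).
Qed.

Lemma has_dim_hull k E e0 m (M : 'M[R]_(m, n)) (x : 'I_k.+1 -> 'rV[R]_n) :
  (forall i, E (x i)) -> aff_independent x ->
  (forall e, E e -> (e - e0 <= M)%MS) -> (\rank M <= k)%N -> has_dim k (hull E).
Proof.
move=> xE xI h rk; split; first by exists x => // i; apply: hull_sub.
move=> y yE; apply/negP => yI.
have : (k.+1 <= \rank M)%N.
  by apply: (aff_independent_rank (x := y) (e0 := e0)) => // i; exact: hull_rowspace (yE i).
by rewrite ltnNge rk.
Qed.

Lemma hyperplane_rowspace l e0 x : dot l x = dot l e0 -> (x - e0 <= kermx l^T)%MS.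
Proof.
move=> e; apply/sub_kermxP; apply/matrixP => i j; rewrite !ord1 -dotE dotBr e subrr.
by rewrite mxE.
Qed.

Lemma rank_hyperplane l : l != 0 -> \rank (kermx l^T) = n.-1.
Proof. by move=> l0; rewrite mxrank_ker mxrank_tr rank_rV l0 subn1. Qed.

Section Isometry.
Variable U : 'M[R]_n.
Hypothesis UU : U *m U^T = 1%:M.
Definition lin A : set 'rV[R]_n := (fun x => x *m U) @` A.

Lemma dot_iso x y : dot (x *m U) (y *m U) = dot x y.
Proof. by rewrite !dotE trmx_mul mulmxA -(mulmxA y) UU mulmx1. Qed.

Lemma hull_lin A : hull (lin A) = lin (hull A).
Proof.
apply/seteqP; split.
  apply: hull_min; last by move=> _ [x Ax <-]; exists x => //; exact: hull_sub.
  move=> _ _ t [x hx <-] [y hy <-] t0 t1; exists (t *: x + (1 - t) *: y); first exact: hull_cvx.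
  by rewrite mulmxDl -!scalemxAl.
move=> _ [x hx <-]; move: x hx.
apply: (@hull_min A (fun x => hull (lin A) (x *m U))); last first.
  by move=> x Ax; apply: hull_sub; exists x.
by move=> x y t hx hy t0 t1; rewrite mulmxDl -!scalemxAl; exact: hull_cvx.
Qed.

Lemma UTU : U^T *m U = 1%:M.
Proof. exact: mulmx1C. Qed.

Lemma isoK x : x *m U *m U^T = x.
Proof. by rewrite -mulmxA UU mulmx1. Qed.

Lemma isoVK x : x *m U^T *m U = x.
Proof. by rewrite -mulmxA UTU mulmx1. Qed.

Lemma aff_independent_lin k (x : 'I_k.+1 -> 'rV[R]_n) :
  aff_independent (fun i => x i *m U) = aff_independent x.
Proof.
have Uu : row_free U by apply/row_freeP; exists U^T.
rewrite /aff_independent.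
have -> : \matrix_(i < k) (x (lift ord0 i) *m U - x ord0 *m U) =
  (\matrix_(i < k) (x (lift ord0 i) - x ord0)) *m U.
  by apply/row_matrixP => i; rewrite rowK row_mul rowK mulmxBl.
by rewrite /row_free mxrankMfree.
Qed.

Lemma has_dim_lin k A : has_dim k A -> has_dim k (lin A).
Proof.
move=> [[x xA xI] h]; split.
  by exists (fun i => x i *m U); [move=> i; exists (x i)|rewrite aff_independent_lin].
move=> y yA; have := h (fun i => y i *m U^T) _.
have -> : aff_independent (fun i => y i *m U^T) = aff_independent y.
  rewrite -aff_independent_lin; congr aff_independent; apply/funext => i; exact: isoVK.
by apply=> i; have [x' Ax' <-] := yA i; rewrite isoK.
Qed.

Lemma face_of_dim_lin k K F : face_of_dim k K F -> face_of_dim k (lin K) (lin F).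
Proof.
move=> [dF [l [c [lc FE]]]]; split; first exact: has_dim_lin.
exists (l *m U), c; split=> [_ [x Kx <-]|]; first by rewrite dot_iso; exact: lc.
rewrite FE; apply/seteqP; split=> [_ [x [Kx /= e] <-]|_ [[x Kx <-] /=]].
  by split; [exists x|rewrite /= dot_iso].
by rewrite dot_iso => e; exists x.
Qed.

End Isometry.

Lemma lin_trK (U : 'M[R]_n) A : U *m U^T = 1%:M -> lin U^T (lin U A) = A.
Proof.
move=> UU; apply/seteqP; split=> [_ [_ [x Ax <-] <-]|x Ax]; first by rewrite isoK.
by exists (x *m U); [exists x|rewrite isoK].
Qed.

Lemma face_of_dim_linP (U : 'M[R]_n) k K F : U *m U^T = 1%:M ->
  face_of_dim k (lin U K) F <-> exists2 F', face_of_dim k K F' & F = lin U F'.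
Proof.
move=> UU; have UU' : U^T *m U^T^T = 1%:M by rewrite trmxK; exact: UTU.
split=> [h|[F' h ->]]; last exact: face_of_dim_lin.
exists (lin U^T F); last by have := @lin_trK U^T F UU'; rewrite trmxK.
by have := face_of_dim_lin UU' h; rewrite lin_trK.
Qed.

End Hull.

Section LinAlg.
Variables (R : realType) (n : nat).
Implicit Types (E : set 'rV[R]_n) (l x y : 'rV[R]_n).

Definition pts4 (x0 x1 x2 x3 : 'rV[R]_n) (i : 'I_4) : 'rV[R]_n := [:: x0; x1; x2; x3]`_i.
Definition pts3 (x0 x1 x2 : 'rV[R]_n) (i : 'I_3) : 'rV[R]_n := [:: x0; x1; x2]`_i.

Lemma aff_independent4 x0 x1 x2 x3 :
  (forall v0 v1 v2 : R, v0 *: (x1 - x0) + v1 *: (x2 - x0) + v2 *: (x3 - x0) = 0 ->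
     [/\ v0 = 0, v1 = 0 & v2 = 0]) -> aff_independent (pts4 x0 x1 x2 x3).
Proof.
move=> h; apply: inj_row_free => v; rewrite mulmx_sum_row !big_ord_recl big_ord0 addr0 !rowK addrA.
move=> /h[e0 e1 e2]; apply/rowP => i; rewrite mxE.
case: (unliftP ord0 i) => [j ->|-> //].
case: (unliftP ord0 j) => [k ->|-> //].
by rewrite !ord1.
Qed.

Lemma aff_independent3 x0 x1 x2 :
  (forall v0 v1 : R, v0 *: (x1 - x0) + v1 *: (x2 - x0) = 0 -> v0 = 0 /\ v1 = 0) ->
  aff_independent (pts3 x0 x1 x2).
Proof.
move=> h; apply: inj_row_free => v; rewrite mulmx_sum_row !big_ord_recl big_ord0 addr0 !rowK.
move=> /h[e0 e1]; apply/rowP => i; rewrite mxE.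
case: (unliftP ord0 i) => [j ->|-> //].
by rewrite !ord1.
Qed.

Lemma range_pts4 x0 x1 x2 x3 : range (pts4 x0 x1 x2 x3) = [set x0; x1; x2; x3].
Proof.
apply/seteqP; split=> [_ [i _ <-]|x /=].
  by rewrite /pts4; case: i => -[|[|[|[|//]]]] i /=; [left; left; left|left; left; right|left; right|right].
case=> [[[->|->]|->]|->].
- by exists (inord 0) => //; rewrite /pts4 inordK.
- by exists (inord 1) => //; rewrite /pts4 inordK.
- by exists (inord 2) => //; rewrite /pts4 inordK.
- by exists (inord 3) => //; rewrite /pts4 inordK.
Qed.

Lemma pts4_in E x0 x1 x2 x3 : E x0 -> E x1 -> E x2 -> E x3 -> forall i, E (pts4 x0 x1 x2 x3 i).
Proof. by move=> e0 e1 e2 e3 [[|[|[|[|//]]]] i]. Qed.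

Lemma pts3_in E x0 x1 x2 : E x0 -> E x1 -> E x2 -> forall i, E (pts3 x0 x1 x2 i).
Proof. by move=> e0 e1 e2 [[|[|[|//]]] i]. Qed.

(** The differences of points of E span a space of rank k < n, so some nonzero l is
    orthogonal to it. *)
Lemma has_dim_hyperplane k E : has_dim k (hull E) -> (k < n)%N ->
  exists l (c : R), l != 0 /\ forall e, E e -> dot l e = c.
Proof.
move=> [[x xE xI] h] kn.
pose A := \matrix_(i < k) (x (lift ord0 i) - x ord0).
have rA : \rank A = k by apply/eqP.
have key e : E e -> (e - x ord0 <= A)%MS.
  move=> Ee; pose y (i : 'I_k.+2) := if unlift ord_max i is Some j then x j else e.
  have yE i : hull E (y i) by rewrite /y; case: unlift => // ; exact: hull_sub.
  have /negP := h y yE; rewrite /aff_independent /row_free.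
  set B := (\matrix_(_ < _) _) => rB.
  have yl j : y (lift ord_max j) = x j by rewrite /y liftK.
  have ym : y ord_max = e by rewrite /y unlift_none.
  have y0 : y ord0 = x ord0.
    by rewrite -(yl ord0); congr y; apply: val_inj; rewrite /= /bump leqn0.
  have AB : (A <= B)%MS.
    apply/row_subP => i; rewrite rowK.
    have -> : x (lift ord0 i) - x ord0 = row (lift ord_max i) B.
      rewrite rowK y0 -(yl (lift ord0 i)); congr (y _ - _); apply: val_inj => /=.
      by rewrite /bump /= !add1n ltnS addnS.
    exact: row_sub.
  have eB : (e - x ord0 <= B)%MS.
    have -> : e - x ord0 = row ord_max B.
      by rewrite rowK y0 -ym; congr (y _ - _); apply: val_inj.
    exact: row_sub.
  have rBk : (\rank B <= k)%N.
    by rewrite -ltnS ltn_neqAle rank_leq_row andbT; apply/negP.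
  apply: submx_trans eB _; have [_ <-] := mxrank_leqif_sup AB.
  by rewrite eqn_leq (mxrankS AB) rA rBk.
pose l := nz_row (kermx A^T).
have l0 : l != 0.
  rewrite nz_row_eq0 -mxrank_eq0 mxrank_ker mxrank_tr rA.
  by rewrite -lt0n subn_gt0.
have lA : A *m l^T = 0.
  apply: trmx_inj; rewrite trmx_mul trmxK trmx0; apply/sub_kermxP.
  exact: nz_row_sub.
exists l, (dot l (x ord0)); split=> // e Ee.
have /submxP[B eB] := key e Ee.
by apply/eqP; rewrite -subr_eq0 -dotBr dotE eB -mulmxA lA mulmx0 mxE.
Qed.

(** Three points span a space of dimension at most 2. *)
Lemma has_dim_four E : has_dim 3 (hull E) ->
  exists x0 x1 x2 x3, [/\ E x0, E x1, E x2 & E x3] /\ uniq [:: x0; x1; x2; x3].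
Proof.
move=> h.
have [x0 E0] : E !=set0 by have [[x xE _] _] := h; exact: hull_nonempty (xE ord0).
have next x1 x2 : exists2 x3, E x3 & x3 \notin [:: x0; x1; x2].
  apply: contrapT => H.
  have /has_dim_rank := h; move=> /(_ x0 _ (col_mx (x1 - x0) (x2 - x0))).
  suff : forall e, E e -> (e - x0 <= col_mx (x1 - x0) (x2 - x0))%MS.
    move=> /[swap] /[apply] /leq_trans /(_ (rank_leq_row _)).
    by [].
  move=> e Ee; have : e \in [:: x0; x1; x2].
    by apply: contrapT => /negP h'; apply: H; exists e.
  rewrite !inE => /or3P[] /eqP ->; rewrite ?subrr ?sub0mx //.
    by rewrite -addsmxE addsmxSl.
  by rewrite -addsmxE addsmxSr.
have [x1 E1] := next x0 x0; rewrite !inE !negb_or => /and3P[n01 _ _].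
have [x2 E2] := next x1 x1; rewrite !inE !negb_or => /and3P[n02 n12 _].
have [x3 E3] := next x1 x2; rewrite !inE !negb_or => /and3P[n03 n13 n23].
exists x0, x1, x2, x3; split=> //=.
by rewrite !inE !negb_or (eq_sym x0 x1) (eq_sym x0 x2) (eq_sym x0 x3) (eq_sym x1 x2)
  (eq_sym x1 x3) (eq_sym x2 x3) n01 n02 n03 n12 n13 n23.
Qed.

End LinAlg.

Section IsoOfLinear.
Variables (R : realType) (n : nat) (T : 'rV[R]_n -> 'rV[R]_n).
Hypotheses (TD : forall x y, T (x + y) = T x + T y) (TZ : forall c x, T (c *: x) = c *: T x).
Hypothesis Tdot : forall x y, dot (T x) (T y) = dot x y.

(** Isometric images of cells are handled through the matrix of the isometry. *)
Lemma isometry_matrix : exists2 U : 'M[R]_n, U *m U^T = 1%:M & forall x, T x = x *m U.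
Proof.
pose U : 'M[R]_n := \matrix_i T (delta_mx 0 i).
exists U.
  apply/matrixP => i j; rewrite !mxE.
  transitivity (dot (T (delta_mx 0 i)) (T (delta_mx 0 j))).
    by apply: eq_bigr => k _; rewrite !mxE.
  rewrite Tdot /dot (bigD1 i) //= big1 ?addr0 => [|k ki]; rewrite !mxE !eqxx /=.
    by rewrite mul1r eq_sym.
  by rewrite (negbTE ki) mul0r.
move=> x; rewrite mulmx_sum_row {1}[x]row_sum_delta.
have T0 : T 0 = 0 by have := TZ 0 0; rewrite !scale0r.
rewrite (big_morph T TD T0); apply: eq_bigr => i _.
by rewrite TZ rowK.
Qed.
End IsoOfLinear.

(** * The torus in four-dimensional space *)

Section Vec4.
Variable R : realType.

Lemma vec4_00 (a b c d : R) : vec4 a b c d 0 0 = a.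
Proof. by rewrite mxE. Qed.
Lemma vec4_01 (a b c d : R) : vec4 a b c d 0 1 = b.
Proof. by rewrite mxE. Qed.
Lemma vec4_02 (a b c d : R) : vec4 a b c d 0 2 = c.
Proof. by rewrite mxE. Qed.
Lemma vec4_03 (a b c d : R) : vec4 a b c d 0 3 = d.
Proof. by rewrite mxE. Qed.
Definition vec4E := (vec4_00, vec4_01, vec4_02, vec4_03).

Lemma dot4 (x y : 'rV[R]_4) :
  dot x y = x 0 0 * y 0 0 + x 0 1 * y 0 1 + x 0 2 * y 0 2 + x 0 3 * y 0 3.
Proof.
rewrite /dot !big_ord_recl big_ord0 addr0 !addrA.
by congr (x 0 _ * y 0 _ + x 0 _ * y 0 _ + x 0 _ * y 0 _ + x 0 _ * y 0 _); apply: val_inj.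
Qed.

Lemma vec4P (x y : 'rV[R]_4) : x 0 0 = y 0 0 -> x 0 1 = y 0 1 -> x 0 2 = y 0 2 -> x 0 3 = y 0 3 -> x = y.
Proof.
move=> h0 h1 h2 h3; apply/rowP => -[[|[|[|[|//]]]] i].
- by rewrite (_ : Ordinal i = 0); [|apply: val_inj].
- by rewrite (_ : Ordinal i = 1); [|apply: val_inj].
- by rewrite (_ : Ordinal i = 2); [|apply: val_inj].
- by rewrite (_ : Ordinal i = 3); [|apply: val_inj].
Qed.

Lemma proj_eqP (s t s' t' : R) : Defs.proj (s, t) = Defs.proj (s', t') <->
  (exists k : int, s' = s + 2 * pi * k%:~R) /\ (exists l : int, t' = t + 2 * pi * l%:~R).
Proof.
have A (x y : R) : angle x = angle y <-> exists k : int, y = x + 2 * pi * k%:~R.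
  split=> [e|[k ->]].
    have [k hk] := angle_repr x; have [l hl] := angle_repr y.
    by exists (k - l); rewrite intrD intrN; move: hl; rewrite -e hk => hl; lra.
  apply/eqP; rewrite /angle -Quotient.idealrBE inE; apply/intrP; exists (- k).
  have p0 : (2 * pi : R) != 0 by rewrite mulf_neq0 ?pnatr_eq0 // gt_eqF ?pi_gt0.
  by rewrite opprD addrA subrr add0r mulrC -mulrN mulKf // intrN.
rewrite /Defs.proj /=; split=> [[/A h /A h']|[/A -> /A ->]] //.
Qed.

Lemma projP (g : torus R) : exists s t, g = Defs.proj (s, t).
Proof.
case: g => u v; exists (repr u), (repr v); rewrite /Defs.proj /angle /=.
by congr pair; rewrite reprK.
Qed.

Lemma iota_proj (s t : R) : iotaT (Defs.proj (s, t)) = vec4 (cos s) (sin s) (cos t) (sin t).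
Proof. by rewrite /iotaT /Defs.proj /= !cos_angle !sin_angle. Qed.

Lemma iota_inj : injective (@iotaT R).
Proof.
move=> g h; have [s [t ->]] := projP g; have [s' [t' ->]] := projP h.
rewrite !iota_proj => e; apply/proj_eqP.
have e0 := congr1 (fun x : 'rV[R]_4 => x 0 0) e; have e1 := congr1 (fun x : 'rV[R]_4 => x 0 1) e.
have e2 := congr1 (fun x : 'rV[R]_4 => x 0 2) e; have e3 := congr1 (fun x : 'rV[R]_4 => x 0 3) e.
rewrite /= !vec4E in e0 e1 e2 e3.
by split; [exact: cos_sin_inj (esym e0) (esym e1)|exact: cos_sin_inj (esym e2) (esym e3)].
Qed.

Lemma projD (s t s' t' : R) : Defs.proj (s, t) + Defs.proj (s', t') = Defs.proj (s + s', t + t').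
Proof.
rewrite /Defs.proj /angle /=.
have A (x y : R) : \pi_(Quotient.quot (@two_pi_Z R)) x + \pi_(Quotient.quot (@two_pi_Z R)) y =
    \pi_(Quotient.quot (@two_pi_Z R)) (x + y) by rewrite -raddfD.
by rewrite -!A.
Qed.

Lemma act_iota (g h : torus R) : act g (iotaT h) = iotaT (g + h).
Proof.
have [s [t ->]] := projP g; have [s' [t' ->]] := projP h.
rewrite projD !iota_proj /act /Defs.proj /= !cos_angle !sin_angle !vec4E !cosD !sinD.
by congr vec4; ring.
Qed.

Lemma act_isometry (g : torus R) :
  exists2 U : 'M[R]_4, U *m U^T = 1%:M & forall x, act g x = x *m U.
Proof.
apply: isometry_matrix.
- by move=> x y; apply: vec4P; rewrite /act !mxE /=; ring.
- by move=> c x; apply: vec4P; rewrite /act !mxE /=; ring.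
move=> x y; have [s [t ->]] := projP g.
rewrite !dot4 /act !vec4E /Defs.proj /= !cos_angle !sin_angle.
have := cos2Dsin2 s; have := cos2Dsin2 t => ht hs.
transitivity ((cos s ^+ 2 + sin s ^+ 2) * (x 0 0 * y 0 0 + x 0 1 * y 0 1) +
  (cos t ^+ 2 + sin t ^+ 2) * (x 0 2 * y 0 2 + x 0 3 * y 0 3)); first by ring.
by rewrite ht hs; ring.
Qed.

Definition swap4 (x : 'rV[R]_4) : 'rV[R]_4 := vec4 (x 0 2) (x 0 3) (x 0 0) (x 0 1).

Lemma swap_isometry : exists2 U : 'M[R]_4, U *m U^T = 1%:M & forall x, swap4 x = x *m U.
Proof.
apply: isometry_matrix.
- by move=> x y; apply: vec4P; rewrite /swap4 !mxE.
- by move=> c x; apply: vec4P; rewrite /swap4 !mxE.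
by move=> x y; rewrite !dot4 /swap4 !vec4E; ring.
Qed.

End Vec4.

(** * Tetrahedral facets *)

Section Polytope.
Variable R : realType.
Local Notation step := (@angle_step R).

Definition translate (g : torus R) (S : set (torus R)) : set (torus R) := [set g + h | h in S].

Lemma act_spanned g (S : set (torus R)) : act g @` spanned_cell S = spanned_cell (translate g S).
Proof.
have [U UU hU] := act_isometry g.
rewrite (_ : act g = fun x => x *m U); last exact/funext.
rewrite -/(lin U _) /spanned_cell -hull_lin; congr hull.
apply/seteqP; split=> [_ [_ [h Sh <-] <-]|_ [_ [h Sh <-] <-]].
  by exists (g + h); [exists h|rewrite -act_iota hU].
by exists (iotaT h); [exists h|rewrite -hU act_iota].
Qed.

Section Lattice.
Variables (q p p' : int) (mu nu : nat).
Hypothesis g : good q p p' mu nu.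

Let q0 : 0 < q := gq0 g.
Let mu0 : (0 < mu)%N := gmu0 g.
Let nu0 : (0 < nu)%N := gnu0 g.

Definition lattice_pt (x y : int) : torus R := Defs.proj (step q mu * x%:~R, step q nu * y%:~R).
Local Notation pt := lattice_pt.
Definition Gam : set (torus R) := [set h | exists x y, lat q p x y /\ h = pt x y].
Definition polytope := hull (@iotaT R @` Gam).
Local Notation K := polytope.

Lemma step_mul_inj m (x y k : int) : (0 < m)%N ->
  step q m * y%:~R = step q m * x%:~R + 2 * pi * k%:~R -> y = x + q * m%:Z * k.
Proof.
move=> m0; rewrite -(step_period R q0 m0) -mulrA -mulrDr => /(mulfI (lt0r_neq0 (step_gt0 R q0 m0))).
by rewrite -intrM -intrD => /eqP; rewrite eqr_int => /eqP.
Qed.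

Lemma pt_eqP x y x' y' : pt x y = pt x' y' <->
  exists k l, x' = x + q * mu%:Z * k /\ y' = y + q * nu%:Z * l.
Proof.
split=> [/proj_eqP[[k hk] [l hl]]|[k [l [-> ->]]]].
  by exists k, l; split; apply: step_mul_inj.
apply/proj_eqP; split; [exists k|exists l].
  by rewrite intrD mulrDr (intrM _ (q * mu%:Z)) mulrA step_period.
by rewrite intrD mulrDr (intrM _ (q * nu%:Z)) mulrA step_period.
Qed.

Lemma ptD x y x' y' : pt (x + x') (y + y') = pt x y + pt x' y'.
Proof. by rewrite /lattice_pt projD !intrD !mulrDr. Qed.

Lemma iota_pt x y : iotaT (pt x y) = vec4 (cos (step q mu * x%:~R)) (sin (step q mu * x%:~R))
  (cos (step q nu * y%:~R)) (sin (step q nu * y%:~R)).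
Proof. exact: iota_proj. Qed.

Lemma wave_functional (r1 r2 s0 t0 : R) : exists l : 'rV[R]_4,
  forall x y, dot l (iotaT (pt x y)) = wave q mu nu r1 r2 s0 t0 x y.
Proof.
exists (vec4 (r1 * cos s0) (r1 * sin s0) (r2 * cos t0) (r2 * sin t0)) => x y.
by rewrite iota_pt dot4 !vec4E /wave !cosB; ring.
Qed.

Lemma functional_wave (l : 'rV[R]_4) : exists r1 r2 s0 t0 : R, [/\ 0 <= r1, 0 <= r2,
   l != 0 -> 0 < r1 \/ 0 < r2 &
   forall x y, dot l (iotaT (pt x y)) = wave q mu nu r1 r2 s0 t0 x y].
Proof.
have [r1 [s0 [r1p h1 n1]]] := harmonic (l 0 0) (l 0 1).
have [r2 [t0 [r2p h2 n2]]] := harmonic (l 0 2) (l 0 3).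
exists r1, r2, s0, t0; split=> // [l0|x y].
  have [e0|] := eqVneq (l 0 0) 0; last by move=> h; left; apply: n1; left.
  have [e1|] := eqVneq (l 0 1) 0; last by move=> h; left; apply: n1; right.
  have [e2|] := eqVneq (l 0 2) 0; last by move=> h; right; apply: n2; left.
  have [e3|] := eqVneq (l 0 3) 0; last by move=> h; right; apply: n2; right.
  by move: l0; rewrite (_ : l = 0) ?eqxx //; apply: vec4P; rewrite mxE.
by rewrite iota_pt dot4 !vec4E /wave -h1 -h2 !addrA.
Qed.

(** The waves of l and of - l both have a positive maximum. *)
Lemma functional_nonconstant (l : 'rV[R]_4) (c : R) : l != 0 ->
  ~ forall h, Gam h -> dot l (iotaT h) = c.
Proof.
move=> l0 H.
have pos (l' : 'rV[R]_4) c' : l' != 0 -> (forall h, Gam h -> dot l' (iotaT h) = c') -> 0 < c'.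
  move=> l'0 H'; have [r1 [r2 [s0 [t0 [r1p r2p rp E]]]]] := functional_wave l'.
  apply: (max_pos_gen (s0 := s0) (t0 := t0) g r1p r2p (rp l'0)) => x y l1.
  by rewrite -E H' //; exists x, y.
have c0 := pos l c l0 H.
have : 0 < - c.
  apply: (pos (- l)); first by rewrite oppr_eq0.
  by move=> h Gh; rewrite dotC dotNr dotC H.
by rewrite oppr_gt0 => /(lt_trans c0); rewrite ltxx.
Qed.

Lemma functional_nonzero (l : 'rV[R]_4) (r1 r2 s0 t0 : R) : 0 <= r1 -> 0 <= r2 ->
  0 < r1 \/ 0 < r2 -> (forall x y, dot l (iotaT (pt x y)) = wave q mu nu r1 r2 s0 t0 x y) -> l != 0.
Proof.
move=> r1p r2p rp E; apply/eqP => l0.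
have : (0 : R) < 0; last by rewrite ltxx.
by apply: (max_pos_gen (s0 := s0) (t0 := t0) g r1p r2p rp) => x y _; rewrite -E l0 dot0l.
Qed.

Lemma face_points (l : 'rV[R]_4) (c : R) (E : set (torus R)) :
  (forall h, Gam h -> dot l (iotaT h) <= c) ->
  (forall h, E h <-> Gam h /\ dot l (iotaT h) = c) ->
  K `&` [set x | dot l x = c] = spanned_cell E.
Proof.
move=> lc EP; rewrite /polytope face_hull => [|_ [h Gh <-]]; last exact: lc.
congr hull; apply/seteqP; split=> [_ [[h Gh <-] /= e]|_ [h /EP[Gh e] <-]].
  by exists h => //; apply/EP.
by split=> //; exists h.
Qed.

Lemma cell_face (l : 'rV[R]_4) (c : R) (E : set (torus R)) (x0 x1 x2 x3 : torus R) : l != 0 ->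
  (forall h, Gam h -> dot l (iotaT h) <= c) ->
  (forall h, E h <-> Gam h /\ dot l (iotaT h) = c) ->
  E x0 -> E x1 -> E x2 -> E x3 ->
  aff_independent (pts4 (iotaT x0) (iotaT x1) (iotaT x2) (iotaT x3)) ->
  face_of_dim 3 K (spanned_cell E).
Proof.
move=> l0 lc EP e0 e1 e2 e3 ind; split; last first.
  exists l, c; split; last by rewrite (face_points lc EP).
  by apply: hull_le => _ [h Gh <-]; exact: lc.
apply: (@has_dim_hull R 4 3 _ (iotaT x0) _ (kermx l^T) (pts4 (iotaT x0) (iotaT x1) (iotaT x2) (iotaT x3))) => //.
- by apply: pts4_in; [exists x0|exists x1|exists x2|exists x3].
- move=> _ [h /EP[_ eh] <-]; apply: hyperplane_rowspace.
  by have /EP[_ ->] := e0.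
- by rewrite rank_hyperplane.
Qed.

(** The functional of a facet is nonzero: otherwise the facet is the whole polytope, which
    lies in no hyperplane. *)
Lemma face_cell F : face_of_dim 3 K F -> exists l c (E : set (torus R)), [/\ l != 0,
   forall h, Gam h -> dot l (iotaT h) <= c,
   forall h, E h <-> Gam h /\ dot l (iotaT h) = c & F = spanned_cell E].
Proof.
move=> [dF [l [c [lc FE]]]].
have lc' h : Gam h -> dot l (iotaT h) <= c by move=> Gh; apply: lc; apply: hull_sub; exists h.
have [l0|l0] := eqVneq l 0; last first.
  exists l, c, [set h | Gam h /\ dot l (iotaT h) = c]; split=> //.
  by rewrite FE; exact: face_points.
exfalso.
have FK : F = K.
  rewrite FE; apply/seteqP; split=> [x []//|x Kx]; split=> //=.
  have [[y yF _] _] := dF; have := yF ord0; rewrite FE => -[_ /=].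
  by rewrite l0 !dot0l.
rewrite FK in dF; have [l' [c' [l'0 H]]] := has_dim_hyperplane dF (isT : (3 < 4)%N).
apply: (functional_nonconstant l'0 (c := c')) => h Gh.
by apply: H; exists h.
Qed.

Section Tetra.
Variables (a c b d : int).
Hypotheses (a0 : 0 < a) (c0 : 0 < c) (b0 : 0 < b) (d0 : 0 < d).
Hypotheses (hA : lat q p a c) (hB : lat q p b (- d)) (D : a * d + b * c = q).
Hypotheses (abN : a + b < q * mu%:Z) (cdN : c + d < q * nu%:Z).

Definition tetra : set (torus R) := [set pt 0 0; pt a c; pt b (- d); pt (a + b) (c - d)].

Lemma tetraP h : tetra h <-> exists x y, in_parallelogram 0 0 a c b d x y /\ h = pt x y.
Proof.
rewrite /in_parallelogram !add0r; split=> [[[[->|->]|->]|->]|[x [y [[] [-> ->] ->]]]].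
- by exists 0, 0; split=> //; constructor 1.
- by exists a, c; split=> //; constructor 2.
- by exists b, (- d); split=> //; constructor 3.
- by exists (a + b), (c - d); split=> //; constructor 4.
- by left; left; left.
- by left; left; right.
- by left; right.
- by right.
Qed.

(** The supporting functional is given by parallelogram_supported.  In an affine relation
    between the vertices, the values of cos X leave two unknown coefficients, and those of
    sin X and sin Y give a system with the determinant of parallelogram_nondegenerate. *)
Theorem tetra_face : face_of_dim 3 K (spanned_cell tetra) /\ is_tetrahedron (spanned_cell tetra).
Proof.
have [r1 [r2 [C [r10 r20 bd EP]]]] := parallelogram_supported R g a0 c0 b0 d0 hA hB D.
have ndg := parallelogram_nondegenerate g a0 c0 b0 d0 abN cdN r10 r20 bd EP.
pose sx := centre_x R q mu a b; pose sy := centre_y R q nu c d.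
have [l E] := wave_functional r1 r2 sx sy.
have l0 : l != 0 by apply: functional_nonzero E => //; [exact: ltW|exact: ltW|left].
have tP h : tetra h <-> Gam h /\ dot l (iotaT h) = C.
  split=> [/tetraP[x [y [/EP[lxy f _ _] ->]]]|[[x [y [lxy ->]]]]].
    by rewrite E; split=> //; exists x, y.
  rewrite E => f; apply/tetraP.
  have [k hk] := reduce_coord sx x q0 mu0; have [m hm] := reduce_coord sy y q0 nu0.
  exists (x + q * mu%:Z * k), (y + q * nu%:Z * m); split.
    by apply/EP; split=> //; [exact: lat_period|rewrite wave_shift].
  by apply/pt_eqP; exists k, m.
have lc h : Gam h -> dot l (iotaT h) <= C.
  by move=> [x [y [lxy ->]]]; rewrite E; exact: bd.
set x0 := step q mu * 0%:~R - centre_x R q mu a b in ndg.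
set x1 := step q mu * a%:~R - centre_x R q mu a b in ndg.
set y0 := step q nu * 0%:~R - centre_y R q nu c d in ndg.
set y1 := step q nu * c%:~R - centre_y R q nu c d in ndg.
have ind : aff_independent (pts4 (iotaT (pt 0 0)) (iotaT (pt a c)) (iotaT (pt b (- d)))
    (iotaT (pt (a + b) (c - d)))).
  apply: aff_independent4 => v0 v1 v2 e.
  pose v := - (v0 + v1 + v2).
  have H (m : 'rV[R]_4) : v * dot m (iotaT (pt 0 0)) + v0 * dot m (iotaT (pt a c)) +
      v1 * dot m (iotaT (pt b (- d))) + v2 * dot m (iotaT (pt (a + b) (c - d))) = 0.
    have := congr1 (dot m) e; rewrite dot0r !dotDr !dotZr !dotBr => e'.
    by rewrite -e' /v; ring.
  have Xop : step q mu * b%:~R - sx = - x1.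
    by rewrite /x1 /sx !centred_xE -mulrN -intrN; congr (_ * _%:~R); ring.
  have Xop0 : step q mu * (a + b)%:~R - sx = - x0.
    by rewrite /x0 /sx !centred_xE -mulrN -intrN; congr (_ * _%:~R); ring.
  have Yop : step q nu * (- d)%:~R - sy = - y1.
    by rewrite /y1 /sy !centred_yE -mulrN -intrN; congr (_ * _%:~R); ring.
  have Yop0 : step q nu * (c - d)%:~R - sy = - y0.
    by rewrite /y0 /sy !centred_yE -mulrN -intrN; congr (_ * _%:~R); ring.
  have [m1 M1] := wave_functional 1 0 sx sy; have [m2 M2] := wave_functional 1 0 (sx + pi / 2) sy.
  have [m3 M3] := wave_functional 0 1 sx (sy + pi / 2).
  have q1 := H m1; have q2 := H m2; have q3 := H m3.
  rewrite !M1 /wave !mul1r !mul0r !addr0 Xop Xop0 !cosN -/x0 -/x1 in q1.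
  rewrite !M2 /wave !mul1r !mul0r !addr0 !opprD !addrA Xop Xop0 !cosBpihalf !sinN -/x0 -/x1 in q2.
  rewrite !M3 /wave !mul1r !mul0r !add0r !opprD !addrA Yop Yop0 !cosBpihalf !sinN -/y0 -/y1 in q3.
  have [abq cdq _ _] := area_bounds a0 c0 b0 d0 D.
  have cne : cos x0 < cos x1.
    rewrite /x0 /x1 !centred_xE mulr0 sub0r -[2 * a - _]/(2 * a - (a + b)).
    apply: (scaled_cos_lt g) => //.
      by clear - a0 b0; lia.
    by apply: (scaled_le_pi R g) => //; clear - abq a0 b0; lia.
  have v01 : v0 + v1 = 0.
    have : (v0 + v1) * (cos x1 - cos x0) = 0 by rewrite -q1 /v; ring.
    move/eqP; rewrite mulf_eq0 [X in _ || X]gt_eqF ?subr_gt0 // orbF => /eqP //.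
  have v1E : v1 = - v0 by lra.
  have z1 : v2 * sin x0 - v0 * sin x1 = 0.
    by move: q2; rewrite /v v1E => q2; lra.
  have z2 : v2 * sin y0 - v0 * sin y1 = 0.
    by move: q3; rewrite /v v1E => q3; lra.
  have D1 : v0 * (sin x0 * sin y1 - sin y0 * sin x1) = 0.
    transitivity (sin y0 * (v2 * sin x0 - v0 * sin x1) - sin x0 * (v2 * sin y0 - v0 * sin y1)); first ring.
    by rewrite z1 z2; ring.
  have D2 : v2 * (sin x0 * sin y1 - sin y0 * sin x1) = 0.
    transitivity (sin y1 * (v2 * sin x0 - v0 * sin x1) - sin x1 * (v2 * sin y0 - v0 * sin y1)); first ring.
    by rewrite z1 z2; ring.
  move/eqP: D1; move/eqP: D2; rewrite !mulf_eq0 (negbTE ndg) !orbF => /eqP-> /eqP v00.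
  by rewrite v1E v00 oppr0; split.
have t0 : tetra (pt 0 0) by left; left; left.
have t1 : tetra (pt a c) by left; left; right.
have t2 : tetra (pt b (- d)) by left; right.
have t3 : tetra (pt (a + b) (c - d)) by right.
split; first exact: (cell_face l0 lc tP t0 t1 t2 t3 ind).
eexists; first exact: ind.
rewrite range_pts4 /spanned_cell /tetra; congr hull; apply/seteqP; split=> [_ [h + <-]|x].
  by move=> [[[->|->]|->]|->]; [left; left; left|left; left; right|left; right|right].
by move=> [[[->|->]|->]|->]; [exists (pt 0 0)|exists (pt a c)|exists (pt b (- d))|exists (pt (a + b) (c - d))].
Qed.

End Tetra.
End Lattice.
End Polytope.

(** * Facets made of two columns *)

Section Polytope.
Variable R : realType.
Local Notation step := (@angle_step R).

Lemma step_le_pi q m : 0 < q -> (0 < m)%N -> 2 < q * m%:Z -> 3 / 2 * step q m <= pi.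
Proof.
move=> q0 m0 h; have sp := step_period R q0 m0; have s0 := step_gt0 R q0 m0.
have : (3 : R) <= (q * m%:Z)%:~R by rewrite (ler_int R 3).
by rewrite -(ler_pM2l s0) sp; lra.
Qed.

Section Levels.
Variables (q : int) (m : nat).
Hypotheses (q0 : 0 < q) (m0 : (0 < m)%N) (qm : 2 < q * m%:Z).
Local Notation st := (step q m).
Local Notation N := (q * m%:Z).

Lemma cos_period (be : R) (y k : int) : cos (st * (y + N * k)%:~R + be) = cos (st * y%:~R + be).
Proof. by have := phase_shift (- be) y k q0 m0; rewrite !opprK => ->; rewrite cosD2piz. Qed.

(** The phase be is within half a step of 0, so no other phase st x + be is nearer to 0
    modulo 2 pi, and another one is as near only if 0 is halfway between the two. *)
Lemma nearest_level (be : R) (x : int) : `|be| <= st / 2 ->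
  cos (st * x%:~R + be) <= cos be /\
  (cos (st * x%:~R + be) = cos be -> exists k,
     [\/ x = N * k, be = - (st / 2) /\ x = 1 + N * k | be = st / 2 /\ x = - 1 + N * k]).
Proof.
move=> hb; have s0 := step_gt0 R q0 m0; have sp := step_le_pi q0 m0 qm; have p0 := pi_gt0 R.
have [k] := reduce_coord (- be) x q0 m0; rewrite opprK => hk.
rewrite -(cos_period be x k); have -> : x = x + N * k + N * - k by ring.
set y := x + N * k in hk *; rewrite -[_ + N * k]addrA -mulrDr addNr mulr0 addr0.
have far : y != 0 -> st * `|y|%:~R - `|be| <= `|st * y%:~R + be| /\ 1 <= `|y|.
  move=> y0; rewrite -gtz0_ge1 normr_gt0 y0; split=> //.
  have := lerB_dist (st * y%:~R) (- be).
  by rewrite opprK normrN normrM (gtr0_norm s0) intr_norm.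
have [y0|yn] := eqVneq y 0.
  by rewrite y0 mulr0 add0r; split=> // _; exists (- k); constructor 1; rewrite add0r.
have [h1 y1] := far yn; have y1' : (1 : R) <= `|y|%:~R by rewrite (ler_int R 1).
have h2 : st <= st * `|y|%:~R by rewrite ler_peMr // ltW.
have bp : `|be| <= pi by lra.
split=> [|e]; first by apply: cos_le => //; lra.
have e' := cos_eq hk bp e.
have yy : `|y| = 1.
  have : st * `|y|%:~R = st * 1 by lra.
  by move=> /(mulfI (lt0r_neq0 s0)) /eqP; rewrite (eqr_int R _ 1) => /eqP.
exists (- k); move: e'; have [->|->] : y = 1 \/ y = -1 by clear - yy; lia.
  constructor 2; split=> //; move: e'; rewrite mulr1.
  by have [h|h] := lerP 0 (st + be); [rewrite (ger0_norm h)|rewrite (ltr0_norm h)];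
    case: ger0P; lra.
constructor 3; split=> //; move: e'; rewrite mulrN1.
by have [h|h] := lerP 0 (- st + be); [rewrite (ger0_norm h)|rewrite (ltr0_norm h)];
  case: ger0P; lra.
Qed.

Lemma middle_level (x : int) :
  cos (st * x%:~R - st / 2) <= cos (st / 2) /\
  (cos (st * x%:~R - st / 2) = cos (st / 2) <-> exists k, x = N * k \/ x = 1 + N * k).
Proof.
have s0 := step_gt0 R q0 m0.
have [|le eq] := @nearest_level (- (st / 2)) x; first by rewrite normrN ger0_norm // divr_ge0 // ltW.
rewrite cosN in le eq; split=> //; split=> [/eq[k [->|[_ ->]|[e _]]]|[k [->|->]]].
- by exists k; left.
- by exists k; right.
- by move: s0; lra.
- by rewrite -[N * k]add0r cos_period mulr0 add0r cosN.
- by rewrite cos_period mulr1; congr cos; field.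
Qed.

(** The first alternative is a maximum at one point modulo the period, the second one a
    maximum at two consecutive points, at equal distances from the phase s0. *)
Lemma levels (s0 C : R) : (forall x : int, cos (st * x%:~R - s0) <= C) ->
  (exists x : int, cos (st * x%:~R - s0) = C) ->
  exists x0 : int,
   (forall x : int, cos (st * x%:~R - s0) = C -> exists k, x = x0 + N * k) \/
   (st * x0%:~R - s0 = - (st / 2) /\
    forall x : int, cos (st * x%:~R - s0) = C <->
      exists k, x = x0 + N * k \/ x = x0 + 1 + N * k).
Proof.
move=> le [xm exm]; have st0 := step_gt0 R q0 m0.
have two (x0 : int) : st * x0%:~R - s0 = - (st / 2) -> forall x : int,
    cos (st * x%:~R - s0) = C <-> exists k, x = x0 + N * k \/ x = x0 + 1 + N * k.
  move=> e.
  have cE (x : int) : cos (st * x%:~R - s0) = cos (st * (x - x0)%:~R - st / 2).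
    by congr cos; rewrite intrB mulrBr -e; ring.
  have CE : C = cos (st / 2).
    apply: le_anti; rewrite -{1}exm cE; have [-> _] := middle_level (xm - x0).
    by have := le x0; rewrite e cosN.
  move=> x; rewrite cE CE; have [_ ->] := middle_level (x - x0).
  by split=> -[k h]; exists k; case: h => h; [left|right|left|right]; clear - h; lia.
have [x0] := round_to (- s0) st0; rewrite addrC => hb.
set be := st * x0%:~R - s0 in hb.
have xE (x : int) : st * x%:~R - s0 = st * (x - x0)%:~R + be.
  by rewrite /be intrB mulrBr; ring.
have CE : C = cos be.
  apply: le_anti; rewrite -{1}exm xE; have [-> _] := nearest_level (xm - x0) hb.
  by have := le x0; rewrite /be.
have [e|n1] := eqVneq be (- (st / 2)); first by exists x0; right; split=> //; exact: two.
have [e|n2] := eqVneq be (st / 2).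
  have e' : st * (x0 - 1)%:~R - s0 = - (st / 2).
    by rewrite intrB mulrBr mulr1; move: e; rewrite /be; lra.
  by exists (x0 - 1); right; split=> //; exact: two.
exists x0; left => x; rewrite xE CE => e; have [_ /(_ e)[k [h|[h _]|[h _]]]] := nearest_level (x - x0) hb.
- by exists k; rewrite -h addrC subrK.
- by move: n1; rewrite h eqxx.
- by move: n2; rewrite h eqxx.
Qed.

End Levels.

Section Lattice.
Variables (q p p' : int) (mu nu : nat).
Hypothesis g : good q p p' mu nu.
Let q0 : 0 < q := gq0 g.
Let mu0 : (0 < mu)%N := gmu0 g.
Let nu0 : (0 < nu)%N := gnu0 g.
Local Notation pt := (lattice_pt R q mu nu).
Local Notation Gam := (@Gam R q p mu nu).
Local Notation K := (@polytope R q p mu nu).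

(** The points on the columns 0 and 1, respectively on the rows 0 and 1. *)
Definition prism : set (torus R) :=
  [set h | exists x y, [/\ lat q p x y, x = 0 \/ x = 1 & h = pt x y]].
Definition prism2 : set (torus R) :=
  [set h | exists x y, [/\ lat q p x y, y = 0 \/ y = 1 & h = pt x y]].

Lemma residue : exists2 r : int, 0 < r < q & lat q p 1 r.
Proof.
have q1 := gq1 g.
pose r := (p %% q)%Z; have er : p = (p %/ q)%Z * q + r by exact: divz_eq.
have r0 : 0 <= r by apply: modz_ge0; exact: lt0r_neq0.
have rq : r < q by apply: ltz_pmod.
have lr : lat q p 1 r by exists (- (p %/ q)%Z); rewrite {1}er; ring.
exists r => //; rewrite rq andbT lt_neqAle r0 andbT; apply/eqP => r00.
rewrite -r00 in lr; have [k ek] := lat_horizontal (ghp g) lr.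
by have := small_multiple q0 (esym ek); clear - q1; lia.
Qed.

Lemma prism_independent r : (1 < nu)%N -> 0 < r < q ->
  aff_independent (pts4 (iotaT (pt 0 0)) (iotaT (pt 0 q)) (iotaT (pt 1 r)) (iotaT (pt 1 (r + q)))).
Proof.
move=> nu1 /andP[r0 rq].
have p0 := pi_gt0 R.
have stm := step_gt0 R q0 mu0; have stn := step_gt0 R q0 nu0.
have qmu : 2 < q * mu%:Z by have [] := g.
have spm := step_le_pi q0 mu0 qmu; have spn := step_period R q0 nu0.
pose th := step q nu * q%:~R; pose ta := step q nu * r%:~R.
have qR : (0 : R) < q%:~R by rewrite ltr0z.
have thp : 0 < th <= pi.
  rewrite /th mulr_gt0 //=.
  have : th * nu%:R = 2 * pi by rewrite -spn intrM -pmulrn mulrA.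
  have : (2 : R) <= nu%:R by rewrite ler_nat.
  have : 0 < th by rewrite /th mulr_gt0.
  by rewrite -/th; nra.
have tap : 0 < ta < pi.
  rewrite /ta mulr_gt0 ?ltr0z //=; have /andP[_] := thp; apply: lt_le_trans.
  by rewrite ltr_pM2l // ltr_int.
have cth : cos th < 1.
  rewrite -cos0; apply: cos_lt; have /andP[t1 t2] := thp; rewrite ?normr0 gtr0_norm //.
have cde : cos (step q mu) < 1.
  by rewrite -cos0; apply: cos_lt; rewrite ?normr0 gtr0_norm //; lra.
have sta : 0 < sin ta by exact: sin_gt0_pi.
apply: aff_independent4 => v0 v1 v2 e.
have H m : v0 * (dot m (iotaT (pt 0 q)) - dot m (iotaT (pt 0 0))) +
   v1 * (dot m (iotaT (pt 1 r)) - dot m (iotaT (pt 0 0))) +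
   v2 * (dot m (iotaT (pt 1 (r + q))) - dot m (iotaT (pt 0 0))) = 0.
  by have := congr1 (dot m) e; rewrite dot0r !dotDr !dotZr !dotBr.
have e1 := H (vec4 1 0 0 0); have e2 := H (vec4 0 0 1 0); have e3 := H (vec4 0 0 0 1).
rewrite !dot4 !iota_pt !vec4E !(mul1r, mul0r, addr0, add0r, mulr0, cos0, sin0, mulr1) in e1 e2 e3.
rewrite intrD (mulrDr (step q nu)) -/th -/ta in e2 e3.
have v12 : v2 = - v1.
  have : (v1 + v2) * (cos (step q mu) - 1) = 0 by rewrite -e1; ring.
  by move/eqP; rewrite mulf_eq0 [X in _ || X]lt_eqF ?subr_lt0 // orbF => /eqP; lra.
rewrite v12 in e2 e3 *.
have f2 : v0 * (cos th - 1) + v1 * (cos ta - cos (ta + th)) = 0 by rewrite -e2; ring.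
have f3 : v0 * sin th + v1 * (sin ta - sin (ta + th)) = 0 by rewrite -e3; ring.
rewrite cosD sinD in f2 f3.
have cs := cos2Dsin2 th.
have s2 : sin th ^+ 2 = 1 - cos th ^+ 2 by rewrite -cs; ring.
have det : v1 * (2 * (1 - cos th) * sin ta) = 0.
  transitivity (v1 * ((1 - cos th) * sin ta * (1 - cos th) + sin th ^+ 2 * sin ta)).
    by rewrite s2; ring.
  have -> : v1 * ((1 - cos th) * sin ta * (1 - cos th) + sin th ^+ 2 * sin ta) =
    sin th * (v0 * (cos th - 1) + v1 * (cos ta - (cos ta * cos th - sin ta * sin th))) +
    (1 - cos th) * (v0 * sin th + v1 * (sin ta - (sin ta * cos th + cos ta * sin th))) by ring.
  by rewrite f2 f3; ring.
have v10 : v1 = 0.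
  move/eqP: det; rewrite mulf_eq0 => /orP[/eqP //|].
  by rewrite gt_eqF // !mulr_gt0 // subr_gt0.
have v00 : v0 = 0.
  move/eqP: f2; rewrite v10 mul0r addr0 mulf_eq0 => /orP[/eqP //|].
  by rewrite lt_eqF // subr_lt0.
by rewrite v10 v00 oppr0; split.
Qed.

(** With th the angle step, cos (th x - th / 2) is maximal exactly on the columns 0 and 1. *)
Theorem prism_face : (1 < nu)%N -> face_of_dim 3 K (spanned_cell prism).
Proof.
move=> nu1; have [r r01 lr] := residue.
have qmu : 2 < q * mu%:Z by have [] := g.
have [l E] := wave_functional q mu nu 1 0 (step q mu / 2) 0.
have l0 : l != 0 by apply: (functional_nonzero g _ _ _ E) => //; left.
have EE x y : dot l (iotaT (pt x y)) = cos (step q mu * x%:~R - step q mu / 2).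
  by rewrite E /wave mul1r mul0r addr0.
apply: (cell_face (p := p) (c := cos (step q mu / 2)) l0 _ _ _ _ _ _ (prism_independent nu1 r01)).
- by move=> h [x [y [_ ->]]]; rewrite EE; have [] := middle_level q0 mu0 qmu x.
- move=> h; split=> [[x [y [lxy x01 ->]]]|[[x [y [lxy ->]]]]]; rewrite EE.
    split; first by exists x, y.
    have [_ [_ ->]] := middle_level q0 mu0 qmu x => //.
    by exists 0; rewrite mulr0 addr0.
  have [_ [+ _]] := middle_level q0 mu0 qmu x => /[apply] -[k hk].
  exists (x + q * mu%:Z * - k), (y + q * nu%:Z * 0); split.
  - exact: lat_period.
  - by case: hk => ->; [left|right]; ring.
  - by apply/(pt_eqP R g); exists (- k), 0.
- by exists 0, 0; split=> //; [exact: lat0|left].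
- exists 0, q; split=> //; [by exists 1; ring|by left].
- by exists 1, r; split=> //; right.
- exists 1, (r + q); split=> //; last by right.
  by have [k ->] := lr; exists (k + 1); ring.
Qed.

(** A column lies in a plane, so E consists of two columns; for nu = 1 these only have two
    points. *)
Lemma flat_levels (s0 C : R) (E : set (torus R)) :
  (forall h, E h <-> exists x y, [/\ lat q p x y, h = pt x y & cos (step q mu * x%:~R - s0) = C]) ->
  (forall x : int, cos (step q mu * x%:~R - s0) <= C) ->
  has_dim 3 (spanned_cell E) ->
  (1 < nu)%N /\ exists x0, E = translate (pt x0 (p * x0)) prism.
Proof.
move=> EP le dE.
have qmu : 2 < q * mu%:Z by have [] := g.
have [x0 [x1 [x2 [x3 [[[h0 E0 e0] [h1 E1 e1] [h2 E2 e2] [h3 E3 e3]] un]]]]] := has_dim_four dE.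
have ex : exists x : int, cos (step q mu * x%:~R - s0) = C.
  by have /EP[x [y [_ _ ?]]] := E0; exists x.
have [xo [one|[_ two]]] := levels q0 mu0 qmu le ex.
  exfalso.
  have := @has_dim_rank _ _ _ _ (iotaT h0) _ (col_mx (delta_mx 0 2 : 'rV[R]_4) (delta_mx 0 3 : 'rV[R]_4)) dE.
  suff H : forall e, (@iotaT R @` E) e ->
      (e - iotaT h0 <= col_mx (delta_mx 0 2 : 'rV[R]_4) (delta_mx 0 3 : 'rV[R]_4))%MS.
    by move=> /(_ H) /leq_trans /(_ (rank_leq_row _)).
  move=> _ [h Eh <-].
  have [x [y [_ -> /one[k ek]]]] := iffLR (EP _) Eh.
  have [x' [y' [_ -> /one[k' ek']]]] := iffLR (EP _) E0.
  have px : x' = x + q * mu%:Z * (k' - k) by rewrite ek ek'; ring.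
  have cx : step q mu * x'%:~R = step q mu * x%:~R + 2 * pi * (k' - k)%:~R.
    have := @phase_shift R q mu 0 x (k' - k) q0 mu0; rewrite !subr0 -px; exact.
  rewrite -addsmxE.
  have -> : iotaT (pt x y) - iotaT (pt x' y') =
     (iotaT (pt x y) - iotaT (pt x' y')) 0 2 *: delta_mx 0 2 +
     (iotaT (pt x y) - iotaT (pt x' y')) 0 3 *: delta_mx 0 3.
    rewrite !iota_pt cx cosD2piz sinD2piz.
    by apply: vec4P; rewrite !mxE /= ?subrr ?mulr0 ?mulr1 ?addr0 ?add0r.
  by apply: addmx_sub_adds; exact: scalemx_sub.
have Eform h : E h -> exists x y, [/\ lat q p x y, x = 0 \/ x = 1 & h = pt xo (p * xo) + pt x y].
  move=> /EP[x [y [lxy -> /two[k hk]]]].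
  exists (x - xo - q * mu%:Z * k), (y - p * xo); split.
  - have -> : x - xo - q * mu%:Z * k = x + q * mu%:Z * - k - xo by ring.
    have := lat_period mu%:Z nu%:Z (- k) 0 lxy; rewrite mulr0 addr0 => l.
    by apply: latB => //; exists 0; ring.
  - by case: hk => ->; [left|right]; ring.
  - rewrite -ptD; apply/(pt_eqP R g); exists (- k), 0.
    by split; ring.
split.
  rewrite ltnNge; apply/negP => nu1.
  have nuE : nu%:Z = 1 by clear - nu1 nu0; lia.
  pose P := [:: pt xo (p * xo); pt xo (p * xo) + pt 1 p].
  have inP h : E h -> h \in P.
    move=> /Eform[x [y [[k ->] hx ->]]]; rewrite /P !inE.
    case: hx => ->.
      rewrite -ptD; apply/orP; left; apply/eqP/(pt_eqP R g); exists 0, (- k).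
      by rewrite nuE; split; ring.
    apply/orP; right; apply/eqP; congr (_ + _); apply/(pt_eqP R g); exists 0, (- k).
    by rewrite nuE; split; ring.
  have un' : uniq [:: h0; h1; h2; h3].
    by move: un; rewrite -e0 -e1 -e2 -e3 -[_ :: _]/(map (@iotaT R) [:: h0; h1; h2; h3]) map_inj_uniq //; exact: iota_inj.
  have sub : {subset [:: h0; h1; h2; h3] <= P}.
    by apply/allP; rewrite /all (inP _ E0) (inP _ E1) (inP _ E2) (inP _ E3).
  by have := uniq_leq_size un' sub.
exists xo; apply/seteqP; split=> [h /Eform[x [y [l hx ->]]]|_ [_ [x [y [l hx ->]]] <-]].
  by exists (pt x y) => //; exists x, y.
apply/EP; exists (xo + x), (p * xo + y); split.
- by apply: latD => //; exists 0; ring.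
- by rewrite ptD.
- by apply/two; exists 0; rewrite mulr0 addr0; case: hx => ->; [left; rewrite addr0|right; rewrite addr0].
Qed.

End Lattice.
End Polytope.

(** * The list of all facets *)

Section Swap.
Variable R : realType.

(** The exchange of the two circles turns the data (p, mu, nu) into (p', nu, mu). *)
Definition swapT (h : torus R) : torus R := (h.2, h.1).
Definition swapset (S : set (torus R)) : set (torus R) := swapT @` S.

Lemma swapTK : involutive swapT. Proof. by case. Qed.
Lemma swapsetK S : swapset (swapset S) = S.
Proof.
apply/seteqP; split=> [_ [_ [h Sh <-] <-]|h Sh]; first by rewrite swapTK.
by exists (swapT h); [exists h|rewrite swapTK].
Qed.

Lemma swapset_translate h S : swapset (translate h S) = translate (swapT h) (swapset S).
Proof.
apply/seteqP; split=> [_ [_ [k Sk <-] <-]|_ [_ [k Sk <-] <-]].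
  by exists (swapT k); [exists k|].
by exists (h + k); [exists k|].
Qed.

Lemma iota_swap (h : torus R) : iotaT (swapT h) = swap4 (iotaT h).
Proof. by rewrite /iotaT /swap4 !vec4E. Qed.

Lemma spanned_swap (U : 'M[R]_4) S : (forall x, swap4 x = x *m U) ->
  spanned_cell (swapset S) = lin U (spanned_cell S).
Proof.
move=> hU; rewrite /spanned_cell -hull_lin; congr hull.
apply/seteqP; split=> [_ [_ [h Sh <-] <-]|_ [_ [h Sh <-] <-]].
  by exists (iotaT h); [exists h|rewrite iota_swap hU].
by exists (swapT h); [exists h|rewrite iota_swap hU].
Qed.

Lemma swap_pt q mu nu x y : swapT (lattice_pt R q mu nu x y) = lattice_pt R q nu mu y x.
Proof. by []. Qed.

Lemma swap_Gam q p p' mu nu : lat q p p' 1 -> swapset (@Gam R q p' nu mu) = Gam q p mu nu.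
Proof.
move=> hp; apply/seteqP; split=> [_ [_ [y [x [l ->]]] <-]|_ [x [y [l ->]]]].
  by exists x, y; split; [exact: latC (lat_inv hp) l|].
by exists (lattice_pt R q nu mu y x) => //; exists y, x; split=> //; exact: latC hp l.
Qed.

Lemma swap_prism q p p' mu nu : lat q p p' 1 -> swapset (@prism R q p' nu mu) = prism2 q p mu nu.
Proof.
move=> hp; apply/seteqP; split=> [_ [_ [y [x [l h ->]]] <-]|_ [x [y [l h ->]]]].
  by exists x, y; split; [exact: latC (lat_inv hp) l| |].
by exists (lattice_pt R q nu mu y x) => //; exists y, x; split=> //; exact: latC hp l.
Qed.

End Swap.

Section Polytope.
Variable R : realType.
Local Notation step := (@angle_step R).
Variables (q p p' : int) (mu nu : nat).
Hypothesis g : good q p p' mu nu.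
Let q0 : 0 < q := gq0 g.
Let mu0 : (0 < mu)%N := gmu0 g.
Let nu0 : (0 < nu)%N := gnu0 g.
Local Notation pt := (lattice_pt R q mu nu).
Local Notation Gam := (@Gam R q p mu nu).
Local Notation K := (@polytope R q p mu nu).

Theorem prism2_face : (1 < mu)%N -> face_of_dim 3 K (spanned_cell (prism2 q p mu nu)).
Proof.
move=> mu1; have [U UU hU] := swap_isometry R; have hp := ghp g.
have := face_of_dim_lin UU (prism_face R (goodC g) mu1).
by rewrite -(spanned_swap _ hU) (swap_prism _ _ _ hp) /polytope -/(spanned_cell _)
  -(spanned_swap _ hU) (swap_Gam _ _ _ hp).
Qed.

(** The bounds on a + b and c + d say that the four vertices are distinct. *)
Definition lattice_cell (S : set (torus R)) : Prop :=
  [\/ exists a c b d, [/\ [/\ 0 < a, 0 < c, 0 < b & 0 < d],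
        [/\ lat q p a c, lat q p b (- d) & a * d + b * c = q],
        a + b < q * mu%:Z /\ c + d < q * nu%:Z & S = tetra q mu nu a c b d],
      (1 < nu)%N /\ S = prism q p mu nu |
      (1 < mu)%N /\ S = prism2 q p mu nu].

(** Four points of E are distinct in the torus, so their lifts form a parallelogram, and
    the bounds on a + b and c + d follow from their being distinct. *)
Lemma mixed_facet (r1 r2 s0 t0 C : R) (E : set (torus R)) : 0 < r1 -> 0 < r2 ->
  (forall h, E h <-> exists x y, [/\ lat q p x y, h = pt x y & wave q mu nu r1 r2 s0 t0 x y = C]) ->
  bounded q p mu nu r1 r2 s0 t0 C -> has_dim 3 (spanned_cell E) ->
  exists S h, [/\ lattice_cell S, Gam h & E = translate h S].
Proof.
move=> r10 r20 EP bd dE.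
have [x0 [x1 [x2 [x3 [[[h0 E0 e0] [h1 E1 e1] [h2 E2 e2] [h3 E3 e3]] un]]]]] := has_dim_four dE.
have un' : uniq [:: h0; h1; h2; h3].
  by move: un; rewrite -e0 -e1 -e2 -e3 -[_ :: _]/(map (@iotaT R) [:: h0; h1; h2; h3])
    map_inj_uniq //; exact: iota_inj.
pose M := maximizer q p mu nu r1 r2 s0 t0 C.
have lift h : E h -> exists x y, M x y /\ h = pt x y.
  move=> /EP[x [y [l -> f]]].
  have [k hk] := reduce_coord s0 x q0 mu0; have [m hm] := reduce_coord t0 y q0 nu0.
  exists (x + q * mu%:Z * k), (y + q * nu%:Z * m); split.
    by split=> //; [exact: lat_period|rewrite wave_shift].
  by apply/(pt_eqP R g); exists k, m.
have [u0 [w0 [m0 f0]]] := lift _ E0; have [u1 [w1 [m1 f1]]] := lift _ E1.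
have [u2 [w2 [m2 f2]]] := lift _ E2; have [u3 [w3 [m3 f3]]] := lift _ E3.
have ne x y x' y' : pt x y != pt x' y' -> x <> x' \/ y <> y'.
  have [->|] := eqVneq x x'; last by move=> /eqP; left.
  by have [->|] := eqVneq y y'; [rewrite eqxx|move=> /eqP; right].
have := un'; rewrite /= !inE !negb_or f0 f1 f2 f3 => /and4P[/and3P[d01 d02 d03] /andP[d12 d13] d23 _].
have [xo [yo [a [c [b [d [[a0 c0 b0 d0] [hA hB D] MP]]]]]]] :=
  maximizers_parallelogram g r10 r20 bd m0 m1 m2 m3 (ne _ _ _ _ d01) (ne _ _ _ _ d02)
    (ne _ _ _ _ d03) (ne _ _ _ _ d12) (ne _ _ _ _ d13) (ne _ _ _ _ d23).
have [lo _ _ _] : M xo yo by apply/MP; constructor 1.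
pose P := [:: pt xo yo; pt (xo + a) (yo + c); pt (xo + b) (yo - d); pt (xo + (a + b)) (yo + (c - d))].
have inP h : E h -> h \in P.
  by move=> /lift[x [y [/MP hM ->]]]; rewrite /P !inE; case: hM => -[-> ->]; rewrite eqxx ?orbT.
have sub : {subset [:: h0; h1; h2; h3] <= P}.
  by apply/allP; rewrite /all (inP _ E0) (inP _ E1) (inP _ E2) (inP _ E3).
have uP : uniq P by exact: leq_size_uniq un' sub isT.
have [abq cdq ab1 cd1] := area_bounds a0 c0 b0 d0 D.
have q1 : q <= q * mu%:Z by rewrite ler_peMr // ltW.
have q2 : q <= q * nu%:Z by rewrite ler_peMr // ltW.
have abN : a + b < q * mu%:Z.
  rewrite lt_neqAle (le_trans abq q1) andbT; apply/eqP => e.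
  have [c1 d1] : c = 1 /\ d = 1 by apply: ab1; clear - e abq q1; lia.
  move: uP; rewrite /P /= !inE !negb_or => /andP[/and3P[_ _ /eqP h] _].
  apply: h; apply/(pt_eqP R g); exists 1, 0; rewrite c1 d1 e; split; ring.
have cdN : c + d < q * nu%:Z.
  rewrite lt_neqAle (le_trans cdq q2) andbT; apply/eqP => e.
  have [a1 b1] : a = 1 /\ b = 1 by apply: cd1; clear - e cdq q2; lia.
  move: uP; rewrite /P /= !inE !negb_or => /and3P[_ /andP[/eqP h _] _].
  apply: h; apply/(pt_eqP R g); exists 0, (- 1); rewrite a1 b1 mulrN1 -e; split; ring.
exists (tetra q mu nu a c b d), (pt xo yo); split; [|by exists xo, yo|].
  by constructor 1; exists a, c, b, d; split.
apply/seteqP; split=> [h /lift[x [y [/MP hM ->]]]|_ [_ /tetraP[x [y [hP ->]]] <-]].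
  exists (pt (x - xo) (y - yo)); last by rewrite -ptD; congr pt; ring.
  apply/tetraP; exists (x - xo), (y - yo); split=> //.
  by case: hM => -[-> ->]; [constructor 1|constructor 2|constructor 3|constructor 4]; split; ring.
rewrite -ptD; apply/EP; exists (xo + x), (yo + y).
have [l f _ _] : M (xo + x) (yo + y).
  apply/MP; case: hP => -[-> ->]; [constructor 1|constructor 2|constructor 3|constructor 4]; split; ring.
by split.
Qed.

(** The wave of a facet has two positive amplitudes (mixed_facet) or only one (flat_levels,
    up to the exchange of the circles). *)
Theorem facetsP F : face_of_dim 3 K F <->
  exists S h, [/\ lattice_cell S, Gam h & F = spanned_cell (translate h S)].
Proof.
have hp := ghp g.
split; last first.
  move=> [S [h [cS Gh ->]]].
  have fS : face_of_dim 3 K (spanned_cell S).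
    case: cS => [[a [c [b [d [[a0 c0 b0 d0] [hA hB D] [abN cdN] ->]]]]]|[nu1 ->]|[mu1 ->]].
    - by have [] := tetra_face R g a0 c0 b0 d0 hA hB D abN cdN.
    - exact: prism_face g nu1.
    - exact: prism2_face.
  have [U UU hU] := act_isometry h.
  have := face_of_dim_lin UU fS.
  have lE : lin U = fun A => act h @` A.
    by apply/funext => A; rewrite (_ : act h = fun x => x *m U) //; exact/funext.
  have KE : K = spanned_cell Gam by [].
  rewrite lE KE !act_spanned.
  have -> // : translate h Gam = Gam.
  have [x [y [l hE]]] := Gh; apply/seteqP; split=> [_ [_ [x' [y' [l' ->]]] <-]|_ [x' [y' [l' ->]]]].
    by exists (x + x'), (y + y'); split; [exact: latD|rewrite ptD hE].
  exists (pt (x' - x) (y' - y)); first by exists (x' - x), (y' - y); split=> //; exact: latB.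
  by rewrite hE -ptD; congr pt; ring.
move=> fF; have [l [C [E [l0 lc EP FE]]]] := face_cell g fF.
have dE : has_dim 3 (spanned_cell E) by rewrite -FE; case: fF.
have [r1 [r2 [s0 [t0 [r1p r2p rp lE]]]]] := functional_wave q mu nu l.
have bd : bounded q p mu nu r1 r2 s0 t0 C.
  by move=> x y lxy; rewrite -lE; apply: lc; exists x, y.
have EP' h : E h <-> exists x y, [/\ lat q p x y, h = pt x y & wave q mu nu r1 r2 s0 t0 x y = C].
  rewrite EP; split=> [[[x [y [lxy ->]]]]|[x [y [lxy -> f]]]].
    by rewrite lE => f; exists x, y.
  by rewrite lE; split=> //; exists x, y.
suff [S [h [cS Gh ES]]] : exists S h, [/\ lattice_cell S, Gam h & E = translate h S].
  by exists S, h; split=> //; rewrite FE ES.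
have [r20|r20] := eqVneq r2 0.
  have r10 : 0 < r1 by case: (rp l0) => //; rewrite r20 ltxx.
  have EQ (x y : int) : (wave q mu nu r1 r2 s0 t0 x y = C) <-> (cos (step q mu * x%:~R - s0) = C / r1).
    rewrite /wave r20 mul0r addr0; split=> [<-|->]; first by rewrite (mulrC r1) mulfK // gt_eqF.
    by rewrite mulrC divfK // gt_eqF.
  have [nu1 [x0 E0]] : (1 < nu)%N /\ exists x0, E = translate (pt x0 (p * x0)) (prism q p mu nu).
    apply: (@flat_levels R q p p' mu nu g s0 (C / r1)) => // [h|x].
      rewrite EP'; split=> [[x [y [a b /EQ c]]]|[x [y [a b /EQ c]]]]; by exists x, y.
    have lx : lat q p x (p * x) by exists 0; ring.
    have := bd _ _ lx.
    by rewrite /wave r20 mul0r addr0 ler_pdivlMr // mulrC.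
  exists (prism q p mu nu), (pt x0 (p * x0)); split=> //; first by constructor 2.
  by exists x0, (p * x0); split=> //; exists 0; ring.
have [r10|r10] := eqVneq r1 0.
  have r20' : 0 < r2 by rewrite lt_neqAle eq_sym r20.
  have EQ (x y : int) : (wave q mu nu r1 r2 s0 t0 x y = C) <-> (cos (step q nu * y%:~R - t0) = C / r2).
    rewrite /wave r10 mul0r add0r; split=> [<-|->]; first by rewrite (mulrC r2) mulfK // gt_eqF.
    by rewrite mulrC divfK // gt_eqF.
  have [U UU hU] := swap_isometry R.
  have [mu1 [y0 E0]] : (1 < mu)%N /\
      exists y0, swapset E = translate (lattice_pt R q nu mu y0 (p' * y0)) (prism q p' nu mu).
    apply: (@flat_levels R q p' p nu mu (goodC g) t0 (C / r2)) => [h|y|].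
    - split=> [[h' /EP'[x [y [a b /EQ c]]] <-]|[y [x [a -> c]]]].
        by exists y, x; rewrite b swap_pt; split=> //; exact: latC hp a.
      exists (pt x y); last by rewrite swap_pt.
      by apply/EP'; exists x, y; split=> //; [exact: latC (lat_inv hp) a|exact/EQ].
    - have lxy : lat q p (p' * y) y by apply: (latC (lat_inv hp)); exists 0; ring.
      have := bd _ _ lxy.
      by rewrite /wave r10 mul0r add0r ler_pdivlMr // mulrC.
    - by rewrite (spanned_swap _ hU); apply: has_dim_lin.
  exists (prism2 q p mu nu), (pt (p' * y0) y0); split.
  - by constructor 3.
  - by exists (p' * y0), y0; split=> //; apply: (latC (lat_inv hp)); exists 0; ring.
  - by rewrite -[E]swapsetK E0 swapset_translate swap_pt (swap_prism _ _ _ hp).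
have {}r10 : 0 < r1 by rewrite lt_neqAle eq_sym r10.
have {}r20 : 0 < r2 by rewrite lt_neqAle eq_sym r20.
exact: (mixed_facet r10 r20 EP' bd dE).
Qed.

End Polytope.

(** * Isometric images and vertices *)

Section Isometry.
Variables (R : realType) (n : nat) (U : 'M[R]_n).
Hypothesis UU : U *m U^T = 1%:M.

Lemma lin_range (T : Type) (f : T -> 'rV[R]_n) : lin U (range f) = range (fun i => f i *m U).
Proof.
apply/seteqP; split=> [_ [_ [i _ <-] <-]|_ [i _ <-]]; first by exists i.
by exists (f i) => //; exists i.
Qed.

Lemma linU (A B : set 'rV[R]_n) : lin U (A `|` B) = lin U A `|` lin U B.
Proof. exact: image_setU. Qed.

Lemma is_tetrahedron_lin C : is_tetrahedron C -> is_tetrahedron (lin U C).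
Proof.
move=> [x xI ->]; exists (fun i => x i *m U); first by rewrite aff_independent_lin.
by rewrite -hull_lin lin_range.
Qed.

Lemma ngon_lin m (o e f : 'rV[R]_n) t k : ngon m o e f t k *m U = ngon m (o *m U) (e *m U) (f *m U) t k.
Proof. by rewrite /ngon !mulmxDl -!scalemxAl. Qed.

Lemma range_ngon_lin m (o e f : 'rV[R]_n) t :
  lin U (range (ngon m o e f t)) = range (ngon m (o *m U) (e *m U) (f *m U) t).
Proof.
apply/seteqP; split=> [_ [_ [k _ <-] <-]|_ [k _ <-]].
  by exists k => //; rewrite ngon_lin.
by exists (ngon m o e f t k); [exists k|rewrite ngon_lin].
Qed.

Lemma is_antiprism_lin m C : is_antiprism m C -> is_antiprism m (lin U C).
Proof.
move=> [] o [] o' [] e [] f [] t [[ef ee e0] CE dC faces].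
exists (o *m U), (o' *m U), (e *m U), (f *m U), t; split.
- by rewrite !dot_iso.
- by rewrite CE -hull_lin linU !range_ngon_lin.
- exact: has_dim_lin.
have lin3 (x y z : 'rV[R]_n) : lin U [set x; y; z] = [set x *m U; y *m U; z *m U].
  by rewrite !linU; congr (_ `|` _ `|` _); apply: image_set1.
move=> F; rewrite (face_of_dim_linP _ _ _ UU); split.
  move=> [F' /faces h ->]; case: h => [->|->|[k ->]|[k ->]].
  - by constructor 1; rewrite -hull_lin range_ngon_lin.
  - by constructor 2; rewrite -hull_lin range_ngon_lin.
  - by constructor 3; exists k; rewrite -hull_lin lin3 !ngon_lin.
  - by constructor 4; exists k; rewrite -hull_lin lin3 !ngon_lin.
case=> [->|->|[k ->]|[k ->]].
- exists (hull (range (ngon m o e f 0))); first by apply/faces; constructor 1.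
  by rewrite -hull_lin range_ngon_lin.
- exists (hull (range (ngon m o' e f t))); first by apply/faces; constructor 2.
  by rewrite -hull_lin range_ngon_lin.
- eexists; first by apply/faces; constructor 3; exists k.
  by rewrite -hull_lin lin3 !ngon_lin.
- eexists; first by apply/faces; constructor 4; exists k.
  by rewrite -hull_lin lin3 !ngon_lin.
Qed.
End Isometry.

Section Vertices.
Variable R : realType.

Lemma dot_iota (s t s' t' : R) : dot (iotaT (Defs.proj (s, t))) (iotaT (Defs.proj (s', t'))) =
  cos (s - s') + cos (t - t').
Proof. by rewrite !iota_proj dot4 !vec4E !cosB; ring. Qed.

Lemma dot_iota_le2 (g h : torus R) : dot (iotaT g) (iotaT h) <= 2.
Proof.
have [s [t ->]] := projP g; have [s' [t' ->]] := projP h.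
by rewrite dot_iota; have := cos_le1 (s - s'); have := cos_le1 (t - t'); lra.
Qed.

Lemma dot_iota_eq2 (g h : torus R) : dot (iotaT g) (iotaT h) = 2 <-> g = h.
Proof.
have [s [t ->]] := projP g; have [s' [t' ->]] := projP h.
rewrite dot_iota; split=> [e|/proj_eqP[[k ->] [l ->]]].
  have c1 := cos_le1 (s - s'); have c2 := cos_le1 (t - t').
  have [k hk] : exists k : int, s - s' = 2 * pi * k%:~R by apply: cos_eq1; lra.
  have [l hl] : exists k : int, t - t' = 2 * pi * k%:~R by apply: cos_eq1; lra.
  apply/proj_eqP; split; [exists (- k)|exists (- l)]; rewrite intrN mulrN; lra.
rewrite !opprD !addrA !subrr !add0r !cosN -[_ * k%:~R]add0r -[_ * l%:~R]add0r !cosD2piz cos0; lra.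
Qed.

(** The points of the torus have norm the square root of 2, so each of them is exposed by its
    own scalar product. *)
Lemma vertices_spanned (S : set (torus R)) : vertices (spanned_cell S) = @iotaT R @` S.
Proof.
apply/seteqP; split=> [x [_ [l [c [lc e]]]]|_ [h Sh <-]].
  have lc' y : (@iotaT R @` S) y -> dot l y <= c by move=> Sy; apply: lc; exact: hull_sub.
  have := face_hull lc'; rewrite -/(spanned_cell S) -e => e'.
  have [y [Sy /= ey]] : (@iotaT R @` S) `&` [set y | dot l y = c] !=set0.
    by apply: (@hull_nonempty _ _ _ x); rewrite -e'.
  have : [set x] y by rewrite e'; apply: hull_sub; split.
  by move=> /= <-.
split.
  split; first by exists (fun=> iotaT h) => //; rewrite /aff_independent /row_free -leqn0 rank_leq_row.
  move=> x xh; apply/negP; rewrite /aff_independent /row_free => /eqP.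
  rewrite (_ : \matrix_(_ < _) _ = 0) ?mxrank0 //.
  by apply/row_matrixP => i; rewrite rowK row0 !(xh _ : x _ = _) subrr.
exists (iotaT h), 2; split; first by apply: hull_le => _ [k _ <-]; exact: dot_iota_le2.
rewrite /spanned_cell face_hull => [|_ [k _ <-]]; last exact: dot_iota_le2.
have -> : [set iotaT k | k in S] `&` [set x | dot (iotaT h) x = 2] = [set iotaT h].
  apply/seteqP; split=> [_ [[k Sk <-] /= /dot_iota_eq2 ->] //|_ ->].
  by split; [exists h|apply/dot_iota_eq2].
apply/seteqP; split; first exact: hull_sub.
apply: hull_min => // x y t -> -> _ _.
by rewrite -scalerDl addrCA subrr addr0 scale1r.
Qed.

Lemma card_spanned (S : set (torus R)) : (@iotaT R @` S #= S)%card.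
Proof. by apply: inj_card_eq => x y _ _; exact: iota_inj. Qed.

End Vertices.

(** * Antiprisms *)

Section Dim2.
Variables (R : realType) (n : nat).

Lemma has_dim_third (E : set 'rV[R]_n) x0 x1 : has_dim 2 (hull E) -> E x0 ->
  exists2 x, E x & x \notin [:: x0; x1].
Proof.
move=> h E0; apply: contrapT => H.
have := @has_dim_rank _ _ _ _ x0 _ (x1 - x0) h.
suff K e : E e -> (e - x0 <= x1 - x0)%MS by move=> /(_ K) /leq_trans /(_ (rank_leq_row _)).
move=> Ee; have : e \in [:: x0; x1] by apply: contrapT => /negP h'; apply: H; exists e.
by rewrite !inE => /orP[] /eqP ->; rewrite ?subrr ?sub0mx.
Qed.

Lemma triangle_dim (x0 x1 x2 : 'rV[R]_n) :
  (forall v0 v1 : R, v0 *: (x1 - x0) + v1 *: (x2 - x0) = 0 -> v0 = 0 /\ v1 = 0) ->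
  has_dim 2 (hull [set x0; x1; x2]).
Proof.
move=> ind.
apply: (@has_dim_hull R n 2 _ x0 _ (col_mx (x1 - x0) (x2 - x0)) (pts3 x0 x1 x2)).
- by apply: pts3_in; [left; left|left; right|right].
- exact: aff_independent3.
- move=> _ [[->|->]|->]; rewrite ?subrr ?sub0mx // -addsmxE; [exact: addsmxSl|exact: addsmxSr].
- exact: rank_leq_row.
Qed.
End Dim2.

Section Levels.
Variables (R : realType) (m : nat).
Hypothesis m3 : (2 < m)%N.
Local Notation th := (angle_step R 1 m).

Lemma m_gt0 : (0 < m)%N. Proof. exact: ltn_trans m3. Qed.
Let qm : 2 < (1 : int) * m%:Z. Proof. by rewrite mul1r ltz_nat. Qed.
Lemma th_gt0 : 0 < th. Proof. by apply: step_gt0 => //; exact: m_gt0. Qed.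
Lemma th_period (k j : int) : th * (k + m%:Z * j)%:~R = th * k%:~R + 2 * pi * j%:~R.
Proof.
have := @phase_shift R 1 m 0 k j isT m_gt0; rewrite !subr0 mul1r => ->; ring.
Qed.
Lemma th_le : 3 / 2 * th <= pi.
Proof. by apply: step_le_pi => //; exact: m_gt0. Qed.

Lemma near_level (be : R) (k : int) : `|be| < th / 2 ->
  cos (th * k%:~R + be) <= cos be /\
  (cos (th * k%:~R + be) = cos be <-> exists j, k = m%:Z * j).
Proof.
move=> hb; have [le eq] := nearest_level ltr01 m_gt0 qm k (ltW hb).
split=> //; split=> [/eq[j [->|[e _]|[e _]]]|[j ->]].
- by exists j; rewrite mul1r.
- by move: hb; rewrite e normrN gtr0_norm ?ltxx // divr_gt0 // th_gt0.
- by move: hb; rewrite e gtr0_norm ?ltxx // divr_gt0 // th_gt0.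
- by have := cos_period ltr01 m_gt0 be 0 j; rewrite mul1r add0r mulr0 add0r.
Qed.

Lemma edge_level (k : int) :
  cos (th * k%:~R - th / 2) <= cos (th / 2) /\
  (cos (th * k%:~R - th / 2) = cos (th / 2) <-> exists j, k = m%:Z * j \/ k = 1 + m%:Z * j).
Proof. by have := @middle_level R 1 m ltr01 m_gt0 qm k; rewrite mul1r. Qed.

Lemma level_cases (s C : R) : (forall k : int, cos (th * k%:~R - s) <= C) ->
  (exists x0, forall k : int, cos (th * k%:~R - s) = C -> exists j, k = x0 + m%:Z * j) \/
  (exists x0 : int, s = th * x0%:~R + th / 2 /\ C = cos (th / 2)).
Proof.
move=> le; have [ex|nex] := pselect (exists k : int, cos (th * k%:~R - s) = C); last first.
  by left; exists 0 => k e; exfalso; apply: nex; exists k.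
have [x0 [one|[e two]]] := levels (ltr01 : 0 < (1 : int)) m_gt0 qm le ex.
  by left; exists x0 => k /one; rewrite mul1r.
right; exists x0; split; first by lra.
have [_ <-] := two x0; last by exists 0; left; ring.
by rewrite e cosN.
Qed.

End Levels.

Section Polygon.
Variables (R : realType) (m : nat).
Hypothesis m3 : (2 < m)%N.
Local Notation th := (angle_step R 1 m).
Definition e3 : 'rV[R]_4 := vec4 0 0 1 0.
Definition e4 : 'rV[R]_4 := vec4 0 0 0 1.

Lemma ngon_vec (a b be : R) (k : nat) : ngon m (vec4 a b 0 0) e3 e4 be k =
  vec4 a b (cos (th * k%:R + be)) (sin (th * k%:R + be)).
Proof.
have -> : th * k%:R + be = be + 2 * pi * k%:R / m%:R.
  by rewrite /angle_step mul1r; field; rewrite pnatr_eq0 -lt0n; exact: ltn_trans m3.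
by apply: vec4P; rewrite /ngon !mxE /= ?mulr0 ?mulr1 ?addr0 ?add0r.
Qed.

Lemma ngon_dim (a b be : R) : has_dim 2 (hull (range (ngon m (vec4 a b 0 0) e3 e4 be))).
Proof.
have t0 := th_gt0 R m3; have tp := th_le R m3; have p0 := pi_gt0 R.
set P := ngon _ _ _ _ _.
apply: (@has_dim_hull R 4 2 _ (P 0%N) _ (col_mx e3 e4) (pts3 (P 0%N) (P 1%N) (P 2%N))).
- by apply: pts3_in; [exists 0%N|exists 1%N|exists 2%N].
- apply: aff_independent3 => v0 v1 e.
  have H l : v0 * (dot l (P 1%N) - dot l (P 0%N)) + v1 * (dot l (P 2%N) - dot l (P 0%N)) = 0.
    by have := congr1 (dot l) e; rewrite dot0r dotDr !dotZr !dotBr.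
  have H1 := H (vec4 0 0 (cos be) (sin be)); have H2 := H (vec4 0 0 (- sin be) (cos be)).
  rewrite /P !ngon_vec !dot4 !vec4E !mul0r !add0r in H1 H2.
  have c1 (x : R) : cos be * cos (x + be) + sin be * sin (x + be) = cos x.
    by rewrite -cosB (_ : be - (x + be) = - x) ?cosN //; ring.
  have s1 (x : R) : - sin be * cos (x + be) + cos be * sin (x + be) = sin x.
    by rewrite -(addrK be x) sinB addrK; ring.
  rewrite !c1 mulr0 cos0 mulr1 in H1; rewrite !s1 mulr0 sin0 mulr1 !subr0 in H2.
  have t2 : th * 2 = th *+ 2 by rewrite mulr2n; ring.
  rewrite t2 cos_mulr2n in H1; rewrite t2 sin_mulr2n in H2.
  have s0 : 0 < sin th by apply: sin_gt0_pi; apply/andP; split; lra.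
  have c0 : cos th < 1 by rewrite -cos0; apply: cos_lt; rewrite ?normr0 gtr0_norm //; lra.
  have E1 : v0 + v1 * (2 * cos th + 2) = 0.
    have : (v0 + v1 * (2 * cos th + 2)) * (cos th - 1) = 0 by rewrite -H1; ring.
    by move/eqP; rewrite mulf_eq0 subr_eq0 [X in _ || X]lt_eqF // orbF => /eqP.
  have E2 : v0 + v1 * (2 * cos th) = 0.
    have : (v0 + v1 * (2 * cos th)) * sin th = 0 by rewrite -H2; ring.
    by move/eqP; rewrite mulf_eq0 [X in _ || X]gt_eqF // orbF => /eqP.
  have v10 : v1 = 0 by lra.
  by split=> //; move: E2; rewrite v10 mul0r addr0.
- move=> _ [k _ <-]; rewrite -addsmxE.
  have -> : P k - P 0%N = (P k 0 2 - P 0%N 0 2) *: e3 + (P k 0 3 - P 0%N 0 3) *: e4.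
    by rewrite /P !ngon_vec; apply: vec4P; rewrite !mxE /= ?subrr ?mulr0 ?mulr1 ?addr0 ?add0r.
  by apply: addmx_sub_adds; exact: scalemx_sub.
- exact: rank_leq_row.
Qed.

End Polygon.

Section Antiprism.
Variables (R : realType) (m : nat) (de ta : R).
Hypothesis m3 : (2 < m)%N.
Local Notation th := (angle_step R 1 m).
Hypotheses (de0 : 0 < de) (dep : de < pi) (ta0 : 0 < ta) (tath : ta < th).

(** Two regular m-gons in parallel planes of the last two coordinates, with angular
    shift ta, whose first two coordinates are at the angles 0 and de. *)
Definition bot (k : int) : 'rV[R]_4 := vec4 1 0 (cos (th * k%:~R)) (sin (th * k%:~R)).
Definition top (k : int) : 'rV[R]_4 :=
  vec4 (cos de) (sin de) (cos (th * k%:~R + ta)) (sin (th * k%:~R + ta)).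
Definition band : set 'rV[R]_4 := range bot `|` range top.

Lemma twist_bound : `|ta - th / 2| < th / 2.
Proof.
by rewrite ltr_norml ltrBlDr -splitr tath andbT ltrBrDr addNr ta0.
Qed.

Lemma twist_boundN : `|th / 2 - ta| < th / 2.
Proof. by rewrite distrC twist_bound. Qed.

Lemma bot_period (k j : int) : bot (k + m%:Z * j) = bot k.
Proof. by rewrite /bot (th_period R m3) cosD2piz sinD2piz. Qed.

Lemma top_period (k j : int) : top (k + m%:Z * j) = top k.
Proof. by rewrite /top (th_period R m3) addrAC cosD2piz sinD2piz. Qed.

Lemma nat_rep (k : int) : exists (i : nat) (j : int), k = i%:Z + m%:Z * j.
Proof.
have mz : m%:Z != 0 by rewrite eqz_nat -lt0n; exact: m_gt0.
exists `|(k %% m%:Z)%Z|%N, (k %/ m%:Z)%Z.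
by rewrite gez0_abs ?modz_ge0 // {1}(divz_eq k m%:Z); ring.
Qed.

Lemma ngon_bot (k : nat) : ngon m (vec4 1 0 0 0) (e3 R) (e4 R) 0 k = bot k%:Z.
Proof. by rewrite (ngon_vec m3) addr0. Qed.

Lemma ngon_top (k : nat) : ngon m (vec4 (cos de) (sin de) 0 0) (e3 R) (e4 R) ta k = top k%:Z.
Proof. by rewrite (ngon_vec m3). Qed.

Lemma range_bot : range (ngon m (vec4 1 0 0 0) (e3 R) (e4 R) 0) = range bot.
Proof.
apply/seteqP; split=> [_ [k _ <-]|_ [k _ <-]]; first by exists k%:Z => //; rewrite ngon_bot.
by have [i [j ->]] := nat_rep k; exists i => //; rewrite ngon_bot bot_period.
Qed.

Lemma range_top : range (ngon m (vec4 (cos de) (sin de) 0 0) (e3 R) (e4 R) ta) = range top.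
Proof.
apply/seteqP; split=> [_ [k _ <-]|_ [k _ <-]]; first by exists k%:Z => //; rewrite ngon_top.
by have [i [j ->]] := nat_rep k; exists i => //; rewrite ngon_top top_period.
Qed.

Lemma band_face (l : 'rV[R]_4) (c : R) (E : set 'rV[R]_4) :
  (forall k, dot l (bot k) <= c) -> (forall k, dot l (top k) <= c) ->
  (forall k, dot l (bot k) = c -> E (bot k)) -> (forall k, dot l (top k) = c -> E (top k)) ->
  (forall x, E x -> band x /\ dot l x = c) ->
  (forall x, hull band x -> dot l x <= c) /\ hull E = hull band `&` [set x | dot l x = c].
Proof.
move=> hb ht eb et Eb.
have lc x : band x -> dot l x <= c by case=> -[k _ <-]; [exact: hb|exact: ht].
split; first exact: hull_le.
rewrite face_hull //; congr hull; apply/seteqP; split=> [x /Eb[]//|x [[] [k _ <-] /= e]].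
  exact: eb.
exact: et.
Qed.

Lemma dot_bot (l : 'rV[R]_4) (w s : R) (k : int) :
  (forall z, l 0 2 * cos z + l 0 3 * sin z = w * cos (z - s)) ->
  dot l (bot k) = l 0 0 + w * cos (th * k%:~R - s).
Proof. by move=> h; rewrite dot4 !vec4E -h; ring. Qed.

Lemma dot_top (l : 'rV[R]_4) (w s : R) (k : int) :
  (forall z, l 0 2 * cos z + l 0 3 * sin z = w * cos (z - s)) ->
  dot l (top k) = (l 0 0 * cos de + l 0 1 * sin de) + w * cos (th * k%:~R - (s - ta)).
Proof.
move=> h; rewrite dot4 !vec4E -!addrA h opprB.
by congr (_ + (_ + _ * cos _)); ring.
Qed.

Lemma sin_de : 0 < sin de. Proof. by apply: sin_gt0_pi; apply/andP. Qed.
Lemma cos_de : cos de < 1.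
Proof. by rewrite -cos0; apply: cos_lt; rewrite ?normr0 gtr0_norm // ltW. Qed.

Lemma bot_ne (k : int) : bot k != bot (k + 1).
Proof.
apply/eqP => e; have := congr1 (fun x : 'rV[R]_4 => x 0 2) e.
have := congr1 (fun x : 'rV[R]_4 => x 0 3) e; rewrite /= !vec4E => es ec.
have t0 := th_gt0 R m3; have tp := th_le R m3; have p0 := pi_gt0 R.
have : cos th = 1.
  have -> : th = th * (k + 1)%:~R - th * k%:~R by rewrite intrD; ring.
  by rewrite cosB -es -ec -!expr2 cos2Dsin2.
have : cos th < 1 by rewrite -cos0; apply: cos_lt; rewrite ?normr0 gtr0_norm //; lra.
by move=> + e1; rewrite e1 ltxx.
Qed.

Lemma top_ne (k : int) : top k != top (k + 1).
Proof.
apply/eqP => e; have := congr1 (fun x : 'rV[R]_4 => x 0 2) e.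
have := congr1 (fun x : 'rV[R]_4 => x 0 3) e; rewrite /= !vec4E => es ec.
have t0 := th_gt0 R m3; have tp := th_le R m3; have p0 := pi_gt0 R.
have : cos th = 1.
  have -> : th = (th * (k + 1)%:~R + ta) - (th * k%:~R + ta) by rewrite intrD; ring.
  by rewrite cosB -es -ec -!expr2 cos2Dsin2.
have : cos th < 1 by rewrite -cos0; apply: cos_lt; rewrite ?normr0 gtr0_norm //; lra.
by move=> + e1; rewrite e1 ltxx.
Qed.

Lemma band_triangle_dim (x0 x1 x2 : 'rV[R]_4) : x0 0 0 = x1 0 0 -> x0 != x1 -> x2 0 0 != x0 0 0 ->
  has_dim 2 (hull [set x0; x1; x2]).
Proof.
move=> e n01 n02; apply: triangle_dim => v0 v1 h.
have v10 : v1 = 0.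
  have := congr1 (fun x : 'rV[R]_4 => x 0 0) h; rewrite !mxE -e subrr mulr0 add0r => /eqP.
  by rewrite mulf_eq0 subr_eq0 (negbTE n02) orbF => /eqP.
move: h; rewrite v10 scale0r addr0 => /eqP; rewrite scaler_eq0 subr_eq0 (eq_sym x1) (negbTE n01) orbF.
by move=> /eqP ->.
Qed.

(** The wave is centred at the middle of the edge; the second coordinate, which vanishes
    on the lower base, is used to bring the third vertex to the same level. *)
Lemma up_triangle_face (k : int) : face_of_dim 2 (hull band) (hull [set bot k; bot (k + 1); top k]).
Proof.
have t0 := th_gt0 R m3; have sd := sin_de.
split.
  apply: band_triangle_dim; rewrite ?vec4E //; first exact: bot_ne.
  by rewrite lt_eqF // cos_de.
pose s := th * k%:~R + th / 2.
pose A := (cos (th / 2) - cos (ta - th / 2)) / sin de.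
pose l : 'rV[R]_4 := vec4 0 A (cos s) (sin s).
have hl z : l 0 2 * cos z + l 0 3 * sin z = 1 * cos (z - s) by rewrite !vec4E cosB; ring.
have bE j : dot l (bot j) = cos (th * (j - k)%:~R - th / 2).
  by rewrite (dot_bot _ hl) vec4E add0r mul1r /s intrD intrN; congr cos; ring.
have tE j : dot l (top j) = cos (th / 2) - cos (ta - th / 2) + cos (th * (j - k)%:~R + (ta - th / 2)).
  rewrite (dot_top _ hl) !vec4E mul0r add0r mul1r /A divfK ?gt_eqF //.
  by rewrite /s intrD intrN; congr (_ + cos _); ring.
have hb := twist_bound.
exists l, (cos (th / 2)); apply: band_face.
- by move=> j; rewrite bE; have [] := edge_level R m3 (j - k).
- by move=> j; rewrite tE; have [h _] := near_level m3 (j - k) hb; lra.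
- move=> j; rewrite bE => e; have [_ [/(_ e) [i hi] _]] := edge_level R m3 (j - k).
  left; case: hi => hi.
    by left; rewrite -(bot_period k i) -hi addrC subrK.
  by right; rewrite -(bot_period (k + 1) i) -addrA -hi addrC subrK.
- move=> j; rewrite tE => e; have [_ [h _]] := near_level m3 (j - k) hb.
  have [|i hi] := h; first by lra.
  by right; rewrite -(top_period k i) -hi addrC subrK.
- move=> x [[->|->]|->].
  + split; first by left; exists k.
    by rewrite bE subrr mulr0 sub0r cosN.
  + split; first by left; exists (k + 1).
    by rewrite bE addrAC subrr add0r mulr1; congr cos; field.
  + split; first by right; exists k.
    by rewrite tE subrr mulr0 add0r subrK.
Qed.

(** As in up_triangle_face, with the wave centred at the middle of the upper edge. *)
Lemma down_triangle_face (k : int) :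
  face_of_dim 2 (hull band) (hull [set bot (k + 1); top k; top (k + 1)]).
Proof.
have t0 := th_gt0 R m3; have sd := sin_de.
split.
  have -> : [set bot (k + 1); top k; top (k + 1)] = [set top k; top (k + 1); bot (k + 1)].
    by rewrite -setUA setUC.
  apply: band_triangle_dim; rewrite ?vec4E //; first exact: top_ne.
  by rewrite gt_eqF // cos_de.
pose s := th * k%:~R + th / 2 + ta.
pose A := (cos (th / 2 - ta) - cos (th / 2)).
pose B := (cos (th / 2 - ta) - cos (th / 2) - 0) / sin de.
pose l : 'rV[R]_4 := vec4 0 B (cos s) (sin s).
have hl z : l 0 2 * cos z + l 0 3 * sin z = 1 * cos (z - s) by rewrite !vec4E cosB; ring.
have bE j : dot l (bot j) = cos (th * (j - (k + 1))%:~R + (th / 2 - ta)).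
  by rewrite (dot_bot _ hl) vec4E add0r mul1r /s !(intrD, intrN); congr cos; field.
have tE j : dot l (top j) = cos (th / 2 - ta) - cos (th / 2) + cos (th * (j - k)%:~R - th / 2).
  rewrite (dot_top _ hl) !vec4E mul0r add0r mul1r /B subr0 divfK ?gt_eqF //.
  by rewrite /s intrD intrN; congr (_ + cos _); ring.
have hb := twist_boundN.
exists l, (cos (th / 2 - ta)); apply: band_face.
- by move=> j; rewrite bE; have [] := near_level m3 (j - (k + 1)) hb.
- by move=> j; rewrite tE; have [h _] := edge_level R m3 (j - k); lra.
- move=> j; rewrite bE => e; have [_ [/(_ e) [i hi] _]] := near_level m3 (j - (k + 1)) hb.
  by left; left; rewrite -(bot_period (k + 1) i) -hi addrC subrK.
- move=> j; rewrite tE => e; have [_ [h _]] := edge_level R m3 (j - k).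
  have [|i hi] := h; first by lra.
  case: hi => hi.
    by left; right; rewrite -(top_period k i) -hi addrC subrK.
  by right; rewrite -(top_period (k + 1) i) -addrA -hi addrC subrK.
- move=> x [[->|->]|->].
  + split; first by left; exists (k + 1).
    by rewrite bE subrr mulr0 add0r.
  + split; first by right; exists k.
    by rewrite tE subrr mulr0 sub0r cosN subrK.
  + split; first by right; exists (k + 1).
    by rewrite tE (addrC k) addrK mulr1 (_ : th - th / 2 = th / 2) ?subrK //; field.
Qed.

Lemma base_face : face_of_dim 2 (hull band) (hull (range bot)) /\
  face_of_dim 2 (hull band) (hull (range top)).
Proof.
have cd := cos_de; have sd := sin_de.
split; split; [by rewrite -range_bot; exact: ngon_dim| |by rewrite -range_top; exact: ngon_dim|].
  pose l : 'rV[R]_4 := vec4 1 0 0 0.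
  have bE j : dot l (bot j) = 1 by rewrite dot4 !vec4E; ring.
  have tE j : dot l (top j) = cos de by rewrite dot4 !vec4E; ring.
  exists l, 1; apply: band_face.
  - by move=> j; rewrite bE.
  - by move=> j; rewrite tE ltW.
  - by move=> j _; exists j.
  - by move=> j; rewrite tE => e; move: cd; rewrite e ltxx.
  - by move=> _ [j _ <-]; rewrite bE; split=> //; left; exists j.
pose l : 'rV[R]_4 := vec4 (cos de) (sin de) 0 0.
have bE j : dot l (bot j) = cos de by rewrite dot4 !vec4E; ring.
have tE j : dot l (top j) = 1 by rewrite dot4 !vec4E !mul0r !addr0 -!expr2 cos2Dsin2.
exists l, 1; apply: band_face.
- by move=> j; rewrite bE ltW.
- by move=> j; rewrite tE.
- by move=> j; rewrite bE => e; move: cd; rewrite e ltxx.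
- by move=> j _; exists j.
- by move=> _ [j _ <-]; rewrite tE; split=> //; right; exists j.
Qed.

(** On both bases a functional is a constant plus a cosine of amplitude w.  If w = 0 the face
    is a base.  Otherwise it contains one vertex or one edge of each base and at least three
    points, so it contains an edge of some base, and the only vertex of the other base that
    can be added is the nearest one to the middle of this edge. *)
Lemma band_faces F : has_dim 3 (hull band) -> face_of_dim 2 (hull band) F ->
  [\/ F = hull (range bot), F = hull (range top),
      exists k : int, F = hull [set bot k; bot (k + 1); top k] |
      exists k : int, F = hull [set bot (k + 1); top k; top (k + 1)]].
Proof.
move=> d3 [d2 [l' [c' [lc FE]]]].
have t0 := th_gt0 R m3.
have hb k : dot l' (bot k) <= c' by apply: lc; apply: hull_sub; left; exists k.
have ht k : dot l' (top k) <= c' by apply: lc; apply: hull_sub; right; exists k.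
pose E := band `&` [set x | dot l' x = c'].
have FH : F = hull E.
  by rewrite FE face_hull // => x [] [k _ <-]; [exact: hb|exact: ht].
have [x0' Ex0'] : E !=set0.
  by have [[x xF _] _] := d2; have := xF ord0; rewrite FH; exact: hull_nonempty.
have [w [s [w0 hw wn]]] := harmonic (l' 0 2) (l' 0 3).
pose A := l' 0 0; pose A' := l' 0 0 * cos de + l' 0 1 * sin de.
have bE k : dot l' (bot k) = A + w * cos (th * k%:~R - s) by exact: dot_bot.
have tE k : dot l' (top k) = A' + w * cos (th * k%:~R - (s - ta)) by exact: dot_top.
have [wz|wnz] := eqVneq w 0.
  have bE' k : dot l' (bot k) = A by rewrite bE wz mul0r addr0.
  have tE' k : dot l' (top k) = A' by rewrite tE wz mul0r addr0.
  have [Ac|Ac] := eqVneq A c'; have [Ac'|Ac'] := eqVneq A' c'.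
  - exfalso; have EB : E = band.
      apply/seteqP; split=> [x []//|x Bx]; split=> //; case: Bx => -[k _ <-] /=.
        by rewrite bE'.
      by rewrite tE'.
    have [[x xB xI] _] := d3; have [_ d2'] := d2.
    by have := d2' x; rewrite FH EB => /(_ xB); rewrite xI.
  - constructor 1; rewrite FH; congr hull; apply/seteqP; split=> [x [[//|[k _ <-]] /= e]|_ [k _ <-]].
      by move: Ac'; rewrite -(tE' k) e eqxx.
    by split; [left; exists k|rewrite /= bE'].
  - constructor 2; rewrite FH; congr hull; apply/seteqP; split=> [x [[[k _ <-]|//] /= e]|_ [k _ <-]].
      by move: Ac; rewrite -(bE' k) e eqxx.
    by split; [right; exists k|rewrite /= tE'].
  - exfalso; case: Ex0' => -[[k _ <-]|[k _ <-]] /= e.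
      by move: Ac; rewrite -(bE' k) e eqxx.
    by move: Ac'; rewrite -(tE' k) e eqxx.
have wp : 0 < w by rewrite lt_neqAle eq_sym wnz.
pose Cb := (c' - A) / w; pose Ct := (c' - A') / w.
have eqw (x B : R) : (B + w * x = c') <-> (x = (c' - B) / w).
  split=> [<-|->]; first by rewrite addrAC subrr add0r mulrC mulKf.
  by rewrite mulrC divfK // addrC subrK.
have lew (x B : R) : B + w * x <= c' -> x <= (c' - B) / w.
  by move=> h; rewrite ler_pdivlMr // mulrC; lra.
have cb k : cos (th * k%:~R - s) <= Cb by apply: lew; rewrite -bE.
have ct k : cos (th * k%:~R - (s - ta)) <= Ct by apply: lew; rewrite -tE.
have Eb k : E (bot k) -> cos (th * k%:~R - s) = Cb by move=> [_ /=]; rewrite bE => /eqw.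
have Et k : E (top k) -> cos (th * k%:~R - (s - ta)) = Ct by move=> [_ /=]; rewrite tE => /eqw.
have Eb' k : cos (th * k%:~R - s) = Cb -> E (bot k).
  by move=> /eqw h; split; [left; exists k|rewrite /= bE].
have Et' k : cos (th * k%:~R - (s - ta)) = Ct -> E (top k).
  by move=> /eqw h; split; [right; exists k|rewrite /= tE].
have third x1 x2 : E x1 -> (forall x, E x -> x = x1 \/ x = x2) -> False.
  move=> E1 H; rewrite FH in d2; have [x Ex] := has_dim_third x2 d2 E1.
  by rewrite !inE => /norP[/eqP a /eqP b]; have [] := H x Ex.
have [[k0 one]|[k0 [sE CbE]]] := level_cases m3 cb; last first.
  (* two consecutive points of the lower base are on the face, and top k0 is the nearest
     point of the upper base to their middle *)
  have hbe := twist_bound.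
  have bot2 k : E (bot k) <-> bot k = bot k0 \/ bot k = bot (k0 + 1).
    have cE : cos (th * k%:~R - s) = cos (th * (k - k0)%:~R - th / 2).
      by rewrite sE intrD intrN; congr cos; ring.
    split=> [/Eb|].
      rewrite cE CbE => e; have [_ [/(_ e) [i hi] _]] := edge_level R m3 (k - k0).
      case: hi => hi; [left|right].
        by rewrite -(bot_period k0 i) -hi addrC subrK.
      by rewrite -(bot_period (k0 + 1) i) -addrA -hi addrC subrK.
    have b0 : E (bot k0).
      by apply: Eb'; rewrite sE CbE opprD addrA subrr sub0r cosN.
    have b1 : E (bot (k0 + 1)).
      by apply: Eb'; rewrite sE CbE intrD mulrDr mulr1; congr cos; field.
    by case=> ->.
  have top1 k : E (top k) -> top k = top k0 /\ E (top k0).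
    have cE (j : int) : cos (th * j%:~R - (s - ta)) = cos (th * (j - k0)%:~R + (ta - th / 2)).
      by rewrite sE intrD intrN; congr cos; ring.
    move=> Ek; have := Et _ Ek; rewrite cE => e.
    have [le0 [eq0 _]] := near_level m3 (k - k0) hbe.
    have := ct k0; rewrite cE subrr mulr0 add0r => le1.
    rewrite e in le0; have eC := le_anti (introT andP (conj le1 le0)).
    have [i hi] := eq0 (etrans e (esym eC)).
    split; first by rewrite -(top_period k0 i) -hi addrC subrK.
    apply: Et'; rewrite cE subrr mulr0 add0r; exact: eC.
  have b0 : E (bot k0) by apply/bot2; left.
  have [j Ej] : exists j, E (top j).
    apply: contrapT => H; apply: (third (bot k0) (bot (k0 + 1))) => // x Ex.
    case: (Ex) => -[[k _ ek]|[k _ ek]] _; last by exfalso; apply: H; exists k; rewrite ek.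
    by rewrite -ek; apply/bot2; rewrite ek.
  have [_ t1] := top1 j Ej.
  constructor 3; exists k0; rewrite FH; congr hull; apply/seteqP; split=> [x Ex|x].
    case: (Ex) => -[[k _ ek]|[k _ ek]] _; rewrite -ek in Ex *.
      by left; have /bot2[->|->] := Ex; [left|right].
    by right; have [] := top1 k Ex.
  by case=> [[->|->]|->] //; apply/bot2; right.
have [[k1 one']|[k1 [sE CtE]]] := level_cases m3 ct; last first.
  have hbe := twist_boundN.
  (* two consecutive points of the upper base, with bot (k1 + 1) as the nearest one below *)
  have sE' : s = th * k1%:~R + th / 2 + ta by rewrite -sE subrK.
  have top2 k : E (top k) <-> top k = top k1 \/ top k = top (k1 + 1).
    have cE : cos (th * k%:~R - (s - ta)) = cos (th * (k - k1)%:~R - th / 2).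
      by rewrite sE intrD intrN; congr cos; ring.
    split=> [/Et|].
      rewrite cE CtE => e; have [_ [/(_ e) [i hi] _]] := edge_level R m3 (k - k1).
      case: hi => hi; [left|right].
        by rewrite -(top_period k1 i) -hi addrC subrK.
      by rewrite -(top_period (k1 + 1) i) -addrA -hi addrC subrK.
    have b0 : E (top k1).
      by apply: Et'; rewrite sE CtE opprD addrA subrr sub0r cosN.
    have b1 : E (top (k1 + 1)).
      by apply: Et'; rewrite sE CtE intrD mulrDr mulr1; congr cos; field.
    by case=> ->.
  have bot1 k : E (bot k) -> bot k = bot (k1 + 1) /\ E (bot (k1 + 1)).
    have cE (j : int) : cos (th * j%:~R - s) = cos (th * (j - (k1 + 1))%:~R + (th / 2 - ta)).
      by rewrite sE' !(intrD, intrN); congr cos; field.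
    move=> Ek; have := Eb _ Ek; rewrite cE => e.
    have [le0 [eq0 _]] := near_level m3 (k - (k1 + 1)) hbe.
    have := cb (k1 + 1); rewrite cE subrr mulr0 add0r => le1.
    rewrite e in le0; have eC := le_anti (introT andP (conj le1 le0)).
    have [i hi] := eq0 (etrans e (esym eC)).
    split; first by rewrite -(bot_period (k1 + 1) i) -hi addrC subrK.
    apply: Eb'; rewrite cE subrr mulr0 add0r; exact: eC.
  have b0 : E (top k1) by apply/top2; left.
  have [j Ej] : exists j, E (bot j).
    apply: contrapT => H; apply: (third (top k1) (top (k1 + 1))) => // x Ex.
    case: (Ex) => -[[k _ ek]|[k _ ek]] _; first by exfalso; apply: H; exists k; rewrite ek.
    by rewrite -ek; apply/top2; rewrite ek.
  have [_ t1] := bot1 j Ej.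
  constructor 4; exists k1; rewrite FH; congr hull; apply/seteqP; split=> [x Ex|x].
    case: (Ex) => -[[k _ ek]|[k _ ek]] _; rewrite -ek in Ex *.
      by left; left; have [] := bot1 k Ex.
    by have /top2[->|->] := Ex; [left; right|right].
  by case=> [[->|->]|->] //; apply/top2; right.
(* one point of each base does not span a face *)
exfalso.
have H x : E x -> x = bot k0 \/ x = top k1.
  move=> Ex; case: (Ex) => -[[k _ ek]|[k _ ek]] _; rewrite -ek in Ex *.
    by left; have /one[j ->] := Eb _ Ex; rewrite bot_period.
  by right; have /one'[j ->] := Et _ Ex; rewrite top_period.
case: (H _ Ex0') => e; rewrite e in Ex0'; first exact: (third _ _ Ex0' H).
by apply: (third _ (bot k0) Ex0') => x /H; tauto.
Qed.

Theorem band_antiprism : has_dim 3 (hull band) -> is_antiprism m (hull band).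
Proof.
move=> d3.
exists (vec4 1 0 0 0), (vec4 (cos de) (sin de) 0 0), (e3 R), (e4 R), ta; split=> //.
- by rewrite !dot4 !vec4E; split; [ring|ring|rewrite !mul0r !add0r mulr1 addr0 ltr01].
- by rewrite range_bot range_top.
move=> F; rewrite range_bot range_top; split=> [/(band_faces d3) h|h].
  case: h => [->|->|[k ->]|[k ->]]; [by constructor 1|by constructor 2| |].
    constructor 3; have [i [j ->]] := nat_rep k; exists i.
    by rewrite !ngon_bot ngon_top addrAC !bot_period top_period intS (addrC 1).
  constructor 4; have [i [j ->]] := nat_rep k; exists i.
  by rewrite !ngon_bot !ngon_top addrAC bot_period !top_period intS (addrC 1).
case: h => [->|->|[k ->]|[k ->]]; [by have [] := base_face|by have [] := base_face| |].
  by rewrite !ngon_bot ngon_top intS (addrC 1); exact: up_triangle_face.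
by rewrite !ngon_bot !ngon_top intS (addrC 1); exact: down_triangle_face.
Qed.

End Antiprism.

(** * The cells of two columns *)

Lemma one_not_multiple (n k : int) : 2 < n -> 1 = n * k -> False.
Proof.
move=> n2 e; have n0 : 0 < n by apply: lt_trans n2.
by have := small_multiple n0 (esym e); clear - n2; lia.
Qed.

Section PrismCell.
Variable R : realType.
Local Notation step := (@angle_step R).

Section Lattice.
Variables (q p p' : int) (mu nu : nat).
Hypothesis g : good q p p' mu nu.
Let q0 : 0 < q := gq0 g.
Let mu0 : (0 < mu)%N := gmu0 g.
Let nu0 : (0 < nu)%N := gnu0 g.
Local Notation pt := (lattice_pt R q mu nu).
Local Notation prism := (@prism R q p mu nu).

Lemma prism_rows (r : int) : lat q p 1 r ->
  prism = [set pt 0 (q * k%:Z) | k in `I_nu] `|` [set pt 1 (r + q * k%:Z) | k in `I_nu].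
Proof.
move=> [k0 rE].
have red x c (k : int) : exists2 i : nat, (i < nu)%N & pt x (c + q * k) = pt x (c + q * i%:Z).
  have nz : nu%:Z != 0 by rewrite eqz_nat -lt0n.
  exists `|(k %% nu%:Z)%Z|%N.
    by rewrite -ltz_nat gez0_abs ?modz_ge0 // ltz_pmod.
  rewrite gez0_abs ?modz_ge0 //; apply/(pt_eqP R g).
  exists 0, (- (k %/ nu%:Z)%Z); split; first by ring.
  by rewrite {2}(divz_eq k nu%:Z); ring.
apply/seteqP; split=> [_ [x [y [[k ->] [->|->] ->]]]|_ [[k _ <-]|[k _ <-]]].
- by left; have [i hi e] := red 0 0 k; exists i => //; rewrite mulr0 e add0r.
- right; have [i hi e] := red 1 r (k - k0); exists i => //.
  by rewrite -e rE; congr pt; ring.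
- by exists 0, (q * k%:Z); split; [exists k%:Z; ring|left|].
- by exists 1, (r + q * k%:Z); split; [exists (k0 + k%:Z); rewrite rE; ring|right|].
Qed.

Lemma card_prism : (prism #= `I_(2 * nu))%card.
Proof.
have [r _ lr] := residue g; rewrite (prism_rows lr).
pose f (k : nat) := if (k < nu)%N then pt 0 (q * k%:Z) else pt 1 (r + q * (k - nu)%N%:Z).
have -> : [set pt 0 (q * k%:Z) | k in `I_nu] `|` [set pt 1 (r + q * k%:Z) | k in `I_nu] =
    f @` `I_(2 * nu).
  apply/seteqP; split=> [_ [[k kn <-]|[k kn <-]]|_ [k kn <-]].
  - by exists k; rewrite /f /= ?kn // mul2n -addnn ltn_addr.
  - exists (nu + k)%N; first by rewrite /= mul2n -addnn ltn_add2l.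
    by rewrite /f ltnNge leq_addr /= addnC addnK.
  - rewrite /f; case: ltnP => h; first by left; exists k.
    by right; exists (k - nu)%N => //=; rewrite ltn_subLR // addnn -mul2n.
apply: inj_card_eq => i j; rewrite !in_setE /= /f => hi hj.
have qmu : 2 < q * mu%:Z by have [] := g.
have row (c : int) (a b : nat) (l : int) : (a < nu)%N -> (b < nu)%N ->
    c + q * b%:Z = c + q * a%:Z + q * nu%:Z * l -> a = b.
  move=> an bn; rewrite -addrA -mulrA -mulrDr => /addrI /(mulfI (lt0r_neq0 q0)) e.
  have n0 : 0 < nu%:Z by rewrite ltz_nat.
  have e' : nu%:Z * l = b%:Z - a%:Z by rewrite e addrAC subrr add0r.
  by have := small_multiple n0 e'; clear - an bn; lia.
have col (l : int) : 1 = q * mu%:Z * l -> False by exact: (one_not_multiple qmu).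
case: ltnP => hi'; case: ltnP => hj' /(pt_eqP R g)[k [l [e1 e2]]].
- by apply: (row 0 i j l hi' hj'); rewrite !add0r.
- by case: (col k); move: e1; rewrite add0r.
- by case: (col (- k)); move: e1; clear; lia.
- have := row r (i - nu)%N (j - nu)%N l _ _ e2; clear - hi hj hi' hj'; lia.
Qed.

Lemma iota_prism (r : int) : lat q p 1 r -> (2 < nu)%N ->
  @iotaT R @` prism = band nu (step q mu) (step q nu * r%:~R).
Proof.
move=> lr nu3.
have e1 : step 1 nu = step q nu * q%:~R.
  by rewrite /angle_step; field; rewrite pnatr_eq0 -lt0n nu0 intr_eq0 lt0r_neq0.
have iota_bot (k : int) : iotaT (pt 0 (q * k)) = bot R nu k.
  by rewrite iota_pt // mulr0 cos0 sin0 /bot e1 intrM mulrA.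
have iota_top (k : int) : iotaT (pt 1 (r + q * k)) = top nu (step q mu) (step q nu * r%:~R) k.
  by rewrite iota_pt // mulr1 /top e1 intrD intrM mulrDr (addrC (_ * r%:~R)) mulrA.
rewrite (prism_rows lr) image_setU; congr (_ `|` _); apply/seteqP; split.
- by move=> _ [_ [k _ <-] <-]; exists k%:Z; rewrite ?iota_bot.
- move=> _ [k _ <-]; rewrite -iota_bot; have : prism (pt 0 (q * k)).
    by exists 0, (q * k); split; [exists k; ring|left|].
  rewrite (prism_rows lr) => -[h|[j _]]; first by exists (pt 0 (q * k)).
  move=> /(pt_eqP R g)[i [_ [e _]]]; exfalso; have [_ _ qmu _] := g.
  by apply: (@one_not_multiple _ (- i) qmu); clear - e; lia.
- by move=> _ [_ [k _ <-] <-]; exists k%:Z; rewrite ?iota_top.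
- move=> _ [k _ <-]; rewrite -iota_top; have : prism (pt 1 (r + q * k)).
    case: lr => k0 rE.
    by exists 1, (r + q * k); split; [exists (k0 + k); rewrite rE; ring|right|].
  rewrite (prism_rows lr) => -[[j _]|h]; last by exists (pt 1 (r + q * k)).
  move=> /(pt_eqP R g)[i [_ [e _]]]; exfalso; have [_ _ qmu _] := g.
  by apply: (@one_not_multiple _ i qmu); clear - e; lia.
Qed.

Lemma prism_antiprism : (2 < nu)%N -> is_antiprism nu (spanned_cell prism).
Proof.
move=> nu3; have [r /andP[r0 rq] lr] := residue g.
have [dP _] := prism_face R g (ltnW nu3).
have st := step_gt0 R q0 nu0; have [_ _ qmu _] := g.
have sm := step_gt0 R q0 mu0; have sp := step_le_pi R q0 mu0 qmu.
rewrite /spanned_cell (iota_prism lr nu3) in dP *.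
apply: band_antiprism => //; first by lra.
- by rewrite mulr_gt0 // ltr0z.
- have -> : step 1 nu = step q nu * q%:~R.
    by rewrite /angle_step; field; rewrite pnatr_eq0 -lt0n nu0 intr_eq0 lt0r_neq0.
  by rewrite ltr_pM2l // ltr_int.
Qed.

Lemma prism_tetrahedron : nu = 2%N -> is_tetrahedron (spanned_cell prism).
Proof.
move=> nu2; have [r rr lr] := residue g; have nu1 : (1 < nu)%N by rewrite nu2.
exists (pts4 (iotaT (pt 0 0)) (iotaT (pt 0 q)) (iotaT (pt 1 r)) (iotaT (pt 1 (r + q)))).
  exact: (prism_independent R g nu1 rr).
rewrite range_pts4 /spanned_cell (prism_rows lr); congr hull.
apply/seteqP; split=> [_ [_ [[k kn <-]|[k kn <-]] <-]|_ [[[->|->]|->]|->]].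
- move: kn; rewrite nu2 => /=; case: k => [|[|//]] _; first by rewrite mulr0; left; left; left.
  by rewrite mulr1; left; left; right.
- move: kn; rewrite nu2 => /=; case: k => [|[|//]] _; first by rewrite mulr0 addr0; left; right.
  by rewrite mulr1; right.
- by exists (pt 0 0) => //; left; exists 0%N => //=; rewrite ?mulr0 ?nu2.
- by exists (pt 0 q) => //; left; exists 1%N => //=; rewrite ?mulr1 ?nu2.
- by exists (pt 1 r) => //; right; exists 0%N => //=; rewrite ?mulr0 ?addr0 ?nu2.
- by exists (pt 1 (r + q)) => //; right; exists 1%N => //=; rewrite ?mulr1 ?nu2.
Qed.

End Lattice.

Lemma prism_cell q p p' mu nu : good q p p' mu nu ->
  antiprism_cell (@Gam R q p mu nu) nu (@prism R q p mu nu).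
Proof.
move=> g; split.
- by move=> _ [x [y [l _ ->]]]; exists x, y.
- split; last exact: vertices_spanned.
  by apply: card_eq_trans (card_spanned _) _; exact: card_prism g.
- exact: prism_antiprism g.
- exact: prism_tetrahedron g.
Qed.

Lemma prism2_cell q p p' mu nu : good q p p' mu nu ->
  antiprism_cell (@Gam R q p mu nu) mu (@prism2 R q p mu nu).
Proof.
move=> g; have [sub [card _] anti tetra] := prism_cell (goodC g).
have [U UU hU] := swap_isometry R; have hp := ghp g.
split.
- by move=> _ [x [y [l _ ->]]]; exists x, y.
- split; last exact: vertices_spanned.
  apply: card_eq_trans (card_spanned _) _; rewrite -(swap_prism _ _ _ hp).
  apply: card_eq_trans (card_prism (goodC g)).
  by apply: inj_card_eq => x y _ _; exact: (inv_inj (@swapTK R)).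
- move=> mu3; rewrite -(swap_prism _ _ _ hp) (spanned_swap _ hU).
  exact: (is_antiprism_lin UU (anti mu3)).
- move=> mu2; rewrite -(swap_prism _ _ _ hp) (spanned_swap _ hU).
  exact: (is_tetrahedron_lin UU (tetra mu2)).
Qed.

End PrismCell.

(** * Farey pairs and parallelograms *)

(** The Bezout relation makes the fraction reduced. *)
Lemma reduced_fraction (x a u v : int) : 0 < a -> a * u - v * x = 1 ->
  numq (x%:~R / a%:~R) = x /\ denq (x%:~R / a%:~R) = a.
Proof.
move=> a0 e; have co : coprime `|x| `|a|.
  by apply/(@coprimezP x a); exists (- v, u) => /=; rewrite -e; ring.
by rewrite coprimeq_num // coprimeq_den // gtr0_sg // mul1r gt_eqF // gtr0_norm.
Qed.

Lemma ltq_cross (x y : rat) : (x < y) = (numq x * denq y < numq y * denq x).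
Proof. exact: lt_ratE. Qed.

Section Farey.
Variables (Q : rat) (mu nu : nat).
Local Notation p := (numq Q).
Local Notation q := (denq Q).
Hypotheses (Q0 : 0 < Q) (Q1 : Q < 1).

(** The ordinate of the lattice point of abscissa denq A attached to A. *)
Definition height (A : rat) : int := denq A * p - numq A * q.

Definition cell_pair (A B : rat) : Prop :=
  [\/ admissible Q A B, (1 < nu)%N /\ (A = 0 /\ B = 1) | (1 < mu)%N /\ farey_parents Q A B].

Definition below_above (A B : rat) : Prop :=
  [/\ 0 < height A, height B < 0 & denq A * numq B - denq B * numq A = 1].

Definition fits (A B : rat) : Prop :=
  denq A + denq B < q * mu%:Z /\ height A - height B < q * nu%:Z.

Lemma height_gt0 A : (0 < height A) = (A < Q).
Proof. by rewrite subr_gt0 ltq_cross (mulrC p). Qed.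

Lemma height_lt0 A : (height A < 0) = (Q < A).
Proof. by rewrite subr_lt0 ltq_cross (mulrC p). Qed.

Lemma farey_height A : farey (Some A) (Some Q) = (`|height A| == 1).
Proof. by rewrite /farey /= distrC /height (mulrC (denq A)). Qed.

Lemma farey_infinity A : farey (Some A) None = (denq A == 1).
Proof. by rewrite /farey /= mulr0 mul1r sub0r normrN gtr0_norm ?denq_gt0. Qed.

Lemma p_range : 0 < p < q.
Proof.
by move: Q0 Q1; rewrite (ltq_cross Q) mulr1 mul1r numq_gt0 => -> ->.
Qed.

Lemma below_above_det A B : below_above A B -> denq A * - height B + denq B * height A = q.
Proof. by move=> [_ _ e]; rewrite -[RHS]mul1r -e /height; ring. Qed.

Lemma farey_order A B : A < Q < B -> farey (Some A) (Some B) -> below_above A B.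
Proof.
move=> /andP[hA hB]; rewrite /farey /= => h; split; rewrite ?height_gt0 ?height_lt0 //.
have AB : numq A * denq B < numq B * denq A by rewrite -ltq_cross; exact: lt_trans hA hB.
by move: h; rewrite distrC gtr0_norm ?subr_gt0 // => /eqP <-; ring.
Qed.

(** The mediant of Farey neighbors is reduced, so its numerator and denominator are those
    of Q. *)
Lemma parents_below_above A B : farey_parents Q A B ->
  [/\ numq A + numq B = p, denq A + denq B = q &
     (below_above A B /\ height A = 1) \/ (below_above B A /\ height B = 1)].
Proof.
move=> /andP[]; rewrite /farey /= => f /eqP e.
have a0 := denq_gt0 A; have b0 := denq_gt0 B.
have s0 : 0 < denq A + denq B by rewrite addr_gt0.
pose D := denq A * numq B - denq B * numq A.
have D1 : D = 1 \/ D = -1.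
  move: f; rewrite distrC (_ : _ - _ = D); last by rewrite /D; ring.
  by rewrite eqr_norml => /andP[/orP[] /eqP -> _]; [left|right].
have [nE dE] : numq A + numq B = p /\ denq A + denq B = q.
  rewrite -e; case: D1 => D1.
    have [||-> ->] // := @reduced_fraction (numq A + numq B) (denq A + denq B) (numq B) (denq B).
    by move: D1; rewrite /D; clear; lia.
  have [||-> ->] // := @reduced_fraction (numq A + numq B) (denq A + denq B) (numq A) (denq A).
  by move: D1; rewrite /D; clear; lia.
split=> //.
have hA : height A = D by rewrite /height -nE -dE /D; ring.
have hB : height B = - D by rewrite /height -nE -dE /D; ring.
by case: D1 => D1; [left|right]; rewrite /below_above hA hB D1 ?opprK; split=> //; split=> //;
  move: D1; rewrite /D; clear; lia.
Qed.

Hypotheses (mu0 : (0 < mu)%N) (nu0 : (0 < nu)%N).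
Hypotheses (qmu : 2 < q * mu%:Z) (qnu : 2 < q * nu%:Z).

Lemma below_above_bounds A B : below_above A B ->
  [/\ denq A + denq B <= q, height A - height B <= q,
      denq A + denq B = q -> height A = 1 /\ height B = -1 &
      height A - height B = q -> denq A = 1 /\ denq B = 1].
Proof.
move=> h; have D := below_above_det h; have [cA cB _] := h.
have a0 := denq_gt0 A; have b0 := denq_gt0 B.
have d0 : 0 < - height B by rewrite oppr_gt0.
have [l1 l2 e1 e2] := area_bounds a0 cA b0 d0 D.
by split=> // /e1[-> hB]; rewrite -[height B]opprK hB.
Qed.

Lemma q_le m : (0 < m)%N -> q <= q * m%:Z.
Proof. by move=> m0; rewrite ler_peMr ?(ltW (denq_gt0 Q)). Qed.

Lemma q_lt m : (1 < m)%N -> q < q * m%:Z.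
Proof. by move=> m1; rewrite ltr_pMr ?denq_gt0. Qed.

Lemma q_lt_inv m : q < q * m%:Z -> (1 < m)%N.
Proof. by rewrite ltr_pMr ?denq_gt0. Qed.

(** The bound on denq A + denq B can fail only if both fractions are neighbors of Q and
    mu = 1, the bound on the heights only if both are neighbors of infinity and nu = 1. *)
Lemma cell_pair_below_above A B : cell_pair A B ->
  (below_above A B /\ fits A B) \/ (below_above B A /\ fits B A).
Proof.
have adm A' B' : A' < Q < B' -> farey (Some A') (Some B') ->
    ~~ (farey (Some A') (Some Q) && farey (Some B') (Some Q)) ->
    ~~ (farey (Some A') None && farey (Some B') None) -> below_above A' B' /\ fits A' B'.
  move=> o f; rewrite !farey_height !farey_infinity => n1 n2.
  have h := farey_order o f; split=> //; have [l1 l2 e1 e2] := below_above_bounds h.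
  split.
    apply: lt_le_trans (q_le mu0); rewrite lt_neqAle l1 andbT.
    by apply: contra n1 => /eqP /e1[-> ->]; rewrite normrN1 normr1.
  apply: lt_le_trans (q_le nu0); rewrite lt_neqAle l2 andbT.
  by apply: contra n2 => /eqP /e2[-> ->].
case=> [/and5P[_ _ f o /andP[n1 n2]]|[nu1 [-> ->]]|[mu1 /parents_below_above[_ eq [[h e]|[h e]]]]].
- case/orP: o => o; first by left; exact: adm.
  by right; apply: adm; rewrite // 1?andbC // /farey distrC.
- left; have h : below_above 0 1 by apply: farey_order => //; rewrite Q0 Q1.
  split=> //; have [_ l2 _ _] := below_above_bounds h.
  by split=> //; exact: le_lt_trans l2 (q_lt nu1).
- left; split=> //; have [_ _ e1 _] := below_above_bounds h.
  by have [eA eB] := e1 eq; split; rewrite ?eq ?q_lt // eA eB opprK.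
- right; split=> //; have [_ _ e1 _] := below_above_bounds h.
  by rewrite addrC in eq; have [eA eB] := e1 eq; split; rewrite ?eq ?q_lt // eA eB opprK.
Qed.

(** Farey neighbors on both sides of a point of ]0, 1[ are in [0, 1]. *)
Lemma below_above_cell_pair A B : below_above A B -> fits A B -> cell_pair A B.
Proof.
move=> h [f1 f2]; have [cA cB e] := h; have [l1 l2 e1 e2] := below_above_bounds h.
have /andP[p0 pq] := p_range.
have AQ : A < Q by rewrite -height_gt0.
have QB : Q < B by rewrite -height_lt0.
have B0 : 0 < numq B by rewrite numq_gt0; exact: lt_trans Q0 QB.
have a0 := denq_gt0 A; have b0 := denq_gt0 B.
have A1 : numq A < denq A.
  by have := lt_trans AQ Q1; rewrite ltq_cross mulr1 mul1r.
have aB : 1 <= denq A * numq B by rewrite -gtz0_ge1 mulr_gt0.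
have A0 : 0 <= numq A.
  rewrite leNgt; apply/negP => A0.
  have : 0 < denq B * - numq A by rewrite mulr_gt0 // oppr_gt0.
  by clear - e aB; lia.
have B1 : numq B <= denq B.
  rewrite leNgt; apply/negP => B1.
  have : 0 < denq B * (denq A - numq A) by rewrite mulr_gt0 // subr_gt0.
  have : 0 < denq A * (numq B - denq B) by rewrite mulr_gt0 // subr_gt0.
  by clear - e; lia.
have [ab|nab] := boolP ((denq A == 1) && (denq B == 1)).
  have /andP[/eqP a1 /eqP b1] := ab.
  have nA : numq A = 0 by clear - A0 A1 a1; lia.
  have nB : numq B = 1 by clear - B0 B1 b1; lia.
  constructor 2; split.
    apply: q_lt_inv; move: f2; rewrite /height a1 b1 nA nB; congr (_ < _); ring.
  by split; rewrite -[LHS]divq_num_den ?nA ?a1 ?nB ?b1 ?divr1.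
have [cd|ncd] := boolP ((`|height A| == 1) && (`|height B| == 1)).
  move: cd; rewrite gtr0_norm // ltr0_norm // eqr_oppLR => /andP[/eqP c1 /eqP d1].
  have D := below_above_det h; rewrite c1 d1 opprK !mulr1 in D.
  constructor 3; split; first by apply: q_lt_inv; rewrite -{1}D.
  apply/andP; split.
    by rewrite /farey /= distrC mulrC (mulrC (numq A)) e normr1.
  have -> : numq A + numq B = p.
    have q0 := denq_gt0 Q; apply: (mulIf (lt0r_neq0 q0)).
    by move: c1 d1; rewrite /height -D; clear; lia.
  by rewrite D divq_num_den.
constructor 1; apply/and5P; split.
- rewrite -numq_ge0 A0 /=; exact: (ltW (lt_trans AQ Q1)).
- rewrite (ltW (lt_trans Q0 QB)) /=.
  by rewrite leNgt ltq_cross mul1r mulr1 -leNgt.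
- by rewrite /farey /= distrC mulrC (mulrC (numq A)) e normr1.
- by rewrite AQ QB.
- by rewrite !farey_height !farey_infinity ncd nab.
Qed.

End Farey.

(** * The cells of the subgroup *)

Lemma good_of_data (Q : rat) (mu nu : nat) (p' : int) : 0 < Q -> Q < 1 -> (0 < mu)%N -> (0 < nu)%N ->
  (numq Q * p' = 1 %[mod denq Q])%Z -> (1 < mu)%N || (1 < nu)%N ->
  (mu = 1%N \/ nu = 1%N -> Q <> 1 / 2) -> good (denq Q) (numq Q) p' mu nu.
Proof.
move=> Q0 Q1 mu0 nu0 hp' hmunu hhalf; have /andP[p0 pq] := p_range Q0 Q1.
have bound m : (0 < m)%N -> (m = 1%N -> Q <> 1 / 2) -> 2 < denq Q * m%:Z.
  move=> m0 h; case: m m0 h => [//|[_ /(_ erefl) h|m _ _]]; last by clear - p0 pq; nia.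
  rewrite mulr1 ltNge; apply/negP => q2; apply: h.
  by rewrite -[LHS]divq_num_den (_ : numq Q = 1) 1?(_ : denq Q = 2) //; clear - p0 pq q2; lia.
split.
- split=> //; first by clear - p0 pq; lia.
  move/eqP: hp'; rewrite eqz_mod_dvd => /dvdzP[k e].
  by exists (- k); move: e; clear; lia.
- exact/orP.
- by apply: bound => // e; apply: hhalf; left.
- by apply: bound => // e; apply: hhalf; right.
Qed.

Section Data.
Variables (R : realType) (Q : rat) (mu nu : nat).
Local Notation p := (numq Q).
Local Notation q := (denq Q).
Local Notation step := (@angle_step R).
Local Notation pt := (lattice_pt R q mu nu).
Hypotheses (mu0 : (0 < mu)%N) (nu0 : (0 < nu)%N).
Let muR : mu%:R != 0 :> R. Proof. by rewrite pnatr_eq0 -lt0n. Qed.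
Let nuR : nu%:R != 0 :> R. Proof. by rewrite pnatr_eq0 -lt0n. Qed.
Let qR : q%:~R != 0 :> R. Proof. by rewrite intr_eq0 denq_eq0. Qed.

Lemma psi_proj (s t : R) : psi mu nu (Defs.proj (s, t)) = Defs.proj (s * mu%:R, t * nu%:R).
Proof. by rewrite /psi /Defs.proj /angle /= -!raddfMn !mulr_natr. Qed.

Lemma data_Gam (G : set (torus R)) : has_data G Q mu nu -> G = Gam q p mu nu.
Proof.
move=> [_ _ _ ->]; have q0 := denq_gt0 Q.
apply/seteqP; split=> [h /= [k kq]|_ [x [y [[j ->] ->]]]].
  have [s [t ->]] := projP h; rewrite psi_proj => /(@proj_eqP R _ _ _ _)[[i es] [j et]].
  exists (k - q * i), (k * p - q * j); split; first by exists (p * i - j); ring.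
  rewrite /lattice_pt; congr (Defs.proj (_, _)); rewrite /angle_step !intrB !intrM.
    apply: (mulIf muR); rewrite -[LHS](addrK (2 * pi * i%:~R)) -es; field; by rewrite ?muR ?qR.
  apply: (mulIf nuR); rewrite -[LHS](addrK (2 * pi * j%:~R)) -et intrM; field; by rewrite ?nuR ?qR.
have [i [r [-> rq]]] : exists i r, x = i * q + r /\ 0 <= r < q.
  by exists (x %/ q)%Z, (x %% q)%Z; rewrite -divz_eq modz_ge0 ?denq_eq0 //= ltz_pmod.
exists r => //; rewrite /preimage /= /lattice_pt psi_proj; apply/(@proj_eqP R); split.
  exists (- i); rewrite /angle_step !(intrD, intrM, intrN); field; by rewrite ?muR ?qR.
exists (- (p * i + j)); rewrite /angle_step !(intrD, intrM, intrN); field; by rewrite ?nuR ?qR.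
Qed.

Lemma lift_ptE (x a : int) :
  lift_pt R Q mu nu x a = (step q mu * a%:~R, step q nu * (a * p - x * q)%:~R).
Proof.
rewrite /lift_pt /angle_step intrB !intrM; congr (_, _); field; by rewrite ?muR ?nuR ?qR.
Qed.

Lemma heightD A B : (denq A + denq B) * p - (numq A + numq B) * q = height Q A + height Q B.
Proof. rewrite /height; ring. Qed.

Lemma tetra_ptsE A B : tetra_pts R Q mu nu A B =
  [set pt 0 0; pt (denq A) (height Q A); pt (denq B) (height Q B);
       pt (denq A + denq B) (height Q A + height Q B)].
Proof.
by rewrite /tetra_pts /lift_pt_frac /lift_pt_mediant !lift_ptE heightD /lattice_pt !mulr0.
Qed.

Lemma tetra_ptsC A B : tetra_pts R Q mu nu A B = tetra_pts R Q mu nu B A.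
Proof. by rewrite !tetra_ptsE [X in X `|` _ = _]setUAC (addrC (denq A)) (addrC (height Q A)). Qed.

Lemma tetra_pts_lattice A B :
  tetra_pts R Q mu nu A B = tetra q mu nu (denq A) (height Q A) (denq B) (- height Q B).
Proof. by rewrite tetra_ptsE /tetra !opprK. Qed.

Variable p' : int.
Hypothesis g : good q p p' mu nu.

Lemma nu_ptsE : nu_pts R Q mu nu = prism q p mu nu.
Proof.
rewrite (@prism_rows R q p p' mu nu g p); last by exists 0; ring.
rewrite /nu_pts; congr (_ `|` _); apply: eq_imagel => k _; rewrite /lattice_pt /angle_step;
  congr (Defs.proj (_, _)); rewrite ?mulr0 // ?intrD ?intrM; field; by rewrite ?muR ?nuR ?qR.
Qed.

Lemma mu_ptsE : mu_pts R Q mu nu p' = prism2 q p mu nu.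
Proof.
rewrite -(swap_prism R mu nu (ghp g)) (@prism_rows R q p' p nu mu (goodC g) p'); last by exists 0; ring.
rewrite /swapset image_setU !image_comp /mu_pts; congr (_ `|` _);
  apply: eq_imagel => k _; rewrite [RHS]swap_pt /lattice_pt /angle_step;
  congr (Defs.proj (_, _)); rewrite ?mulr0 // ?intrD ?intrM; field; by rewrite ?muR ?nuR ?qR.
Qed.

Hypotheses (Q0 : 0 < Q) (Q1 : Q < 1).
Let qmu : 2 < q * mu%:Z. Proof. by have [] := g. Qed.
Let qnu : 2 < q * nu%:Z. Proof. by have [] := g. Qed.

(** The parallelogram with sides (a, c) and (b, - d) comes from the fractions of
    denominators a and b and numerators (a p - c) / q and (b p + d) / q. *)
Lemma cell_ptsP (S : set (torus R)) : cell_pts Q mu nu p' S <-> lattice_cell q p mu nu S.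
Proof.
have low A B : below_above Q A B -> fits Q mu nu A B ->
    lattice_cell q p mu nu (tetra_pts R Q mu nu A B).
  move=> h [f1 f2]; have [cA cB _] := h; rewrite tetra_pts_lattice.
  constructor 1; exists (denq A), (height Q A), (denq B), (- height Q B).
  split=> //; first by rewrite oppr_gt0 !denq_gt0.
  split; last exact: below_above_det h.
    by exists (- numq A); rewrite /height; ring.
  by exists (- numq B); rewrite /height; ring.
have pair A B : cell_pair Q mu nu A B -> lattice_cell q p mu nu (tetra_pts R Q mu nu A B).
  move=> /(cell_pair_below_above Q0 Q1 mu0 nu0 qmu qnu)[[h f]|[h f]]; first exact: low.
  by rewrite tetra_ptsC; exact: low.
split.
  case=> [A B h ->|nu1 ->|A B mu1 h ->|nu1 ->|mu1 ->].
  - by apply: pair; constructor 1.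
  - by apply: pair; constructor 2.
  - by apply: pair; constructor 3.
  - by constructor 2; rewrite nu_ptsE.
  - by constructor 3; rewrite mu_ptsE.
case=> [[a [c [b [d [[a0 c0 b0 d0] [[k ec] [l ed] D] f ->]]]]]|[nu1 ->]|[mu1 ->]]; last first.
- by rewrite -mu_ptsE; exact: Cell_mu.
- by rewrite -nu_ptsE; exact: Cell_nu.
have q0 := denq_gt0 Q.
have det : a * - l - b * - k = 1.
  by apply: (mulfI (lt0r_neq0 q0)); rewrite mulr1 -[RHS]D ec -[d]opprK ed; ring.
have [nA dA] := reduced_fraction a0 det.
have [|nB dB] := @reduced_fraction (- l) b k (- a) b0; first by rewrite -det; ring.
set A := (- k)%:~R / a%:~R in nA dA; set B := (- l)%:~R / b%:~R in nB dB.
have hA : height Q A = c by rewrite /height nA dA ec; ring.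
have hB : height Q B = - d by rewrite /height nB dB ed; ring.
have low' : below_above Q A B by rewrite /below_above hA hB nA dA nB dB oppr_lt0.
have fit : fits Q mu nu A B by rewrite /fits hA hB dA dB opprK.
have -> : tetra q mu nu a c b d = tetra_pts R Q mu nu A B.
  by rewrite tetra_pts_lattice hA hB dA dB opprK.
have [h|[nu1 [-> ->]]|[mu1 h]] := below_above_cell_pair Q0 Q1 low' fit.
- exact: Cell_admissible h _.
- exact: Cell_tetra_nu.
- exact: Cell_tetra_mu mu1 h _.
Qed.

Lemma pair_tetra_cell A B : cell_pair Q mu nu A B -> tetra_cell (@Gam R q p mu nu) Q mu nu A B.
Proof.
move=> h; have [sub tet] : tetra_pts R Q mu nu A B `<=` Gam q p mu nu /\
    is_tetrahedron (spanned_cell (tetra_pts R Q mu nu A B)).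
  have low A' B' : below_above Q A' B' -> fits Q mu nu A' B' ->
      tetra_pts R Q mu nu A' B' `<=` Gam q p mu nu /\
      is_tetrahedron (spanned_cell (tetra_pts R Q mu nu A' B')).
    move=> ba [f1 f2]; have [cA cB _] := ba.
    have l C : lat q p (denq C) (height Q C) by exists (- numq C); rewrite /height; ring.
    split.
      rewrite tetra_ptsE => _ [[[->|->]|->]|->].
      - by exists 0, 0; split=> //; exact: lat0.
      - by exists (denq A'), (height Q A').
      - by exists (denq B'), (height Q B').
      - by exists (denq A' + denq B'), (height Q A' + height Q B'); split=> //; exact: latD.
    rewrite tetra_pts_lattice.
    have d0 : 0 < - height Q B' by rewrite oppr_gt0.
    have lB : lat q p (denq B') (- - height Q B') by rewrite opprK.
    exact: (tetra_face R g (denq_gt0 A') cA (denq_gt0 B') d0 (l A') lB (below_above_det ba) f1 f2).2.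
  have [[ba f]|[ba f]] := cell_pair_below_above Q0 Q1 mu0 nu0 qmu qnu h; first exact: low.
  by rewrite tetra_ptsC; exact: low.
split=> //.
have det : denq A * height Q B - height Q A * denq B != 0.
  have q0 := denq_gt0 Q.
  have [[/below_above_det ba _]|[/below_above_det ba _]] :=
    cell_pair_below_above Q0 Q1 mu0 nu0 qmu qnu h.
    by apply: contraTneq q0 => e; rewrite -ba -leNgt; move: e; clear; lia.
  by apply: contraTneq q0 => e; rewrite -ba -leNgt; move: e; clear; lia.
rewrite /lift_pt_frac /lift_pt_mediant !lift_ptE heightD.
split.
- rewrite mulr2n /tetra_center /angle_step /height !(intrD, intrB, intrM, intrN); congr (_, _) => /=;
    field; by rewrite ?muR ?nuR ?qR.
- rewrite mulr2n /tetra_center /angle_step /height !(intrD, intrB, intrM, intrN); congr (_, _) => /=;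
    field; by rewrite ?muR ?nuR ?qR.
- rewrite /= !subr0 -/(height Q A) -/(height Q B).
  have area (s t : R) (a b x y : int) :
      s * a%:~R * (t * y%:~R) - t * x%:~R * (s * b%:~R) = s * t * (a * y - x * b)%:~R.
    by rewrite intrB !intrM; ring.
  have smu := lt0r_neq0 (step_gt0 R (denq_gt0 Q) mu0).
  have snu := lt0r_neq0 (step_gt0 R (denq_gt0 Q) nu0).
  by rewrite area mulf_neq0 ?intr_eq0 // (mulf_neq0 smu snu).
Qed.

End Data.

(** The parent below Q has height 1, so its denominator is the inverse of numq Q modulo
    denq Q, which is unique below denq Q; the other parent is the complement to Q. *)
Lemma farey_parents_exist (Q : rat) (p' : int) : 0 < Q -> Q < 1 ->
  (numq Q * p' = 1 %[mod denq Q])%Z ->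
  exists A B, [/\ farey_parents Q A B, below_above Q A B &
    forall A' B', farey_parents Q A' B' -> (A' = A /\ B' = B) \/ (A' = B /\ B' = A)].
Proof.
move=> Q0 Q1 hp'; have /andP[p0 pq] := p_range Q0 Q1; have q0 := denq_gt0 Q.
set p := numq Q in p0 pq hp'; set q := denq Q in pq hp' q0.
have [k ek] : exists k, p * p' = 1 + q * k.
  move/eqP: hp'; rewrite eqz_mod_dvd => /dvdzP[k e].
  by exists k; move: e; clear; lia.
pose a := (p' %% q)%Z.
have [al eal] : exists al, p * a = 1 + q * al.
  have e := divz_eq p' q; exists (k - p * (p' %/ q)%Z).
  have ea : a = p' - (p' %/ q)%Z * q by rewrite {1}e addrAC subrr add0r.
  by rewrite ea mulrBr ek; ring.
have a0 : 0 < a.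
  rewrite lt_neqAle modz_ge0 ?denq_eq0 // andbT; apply/eqP => a0.
  by have := @small_multiple q (- al) 1 q0; move: eal; rewrite -a0; clear - p0 pq; lia.
have aq : a < q by exact: ltz_pmod.
have b0 : 0 < q - a by rewrite subr_gt0.
have det : a * (p - al) - (q - a) * al = 1 by rewrite -[RHS](addrK (q * al)) -eal; ring.
have [nA dA] := reduced_fraction a0 det.
have [|nB dB] := @reduced_fraction (p - al) (q - a) (- al) (- a) b0; first by rewrite -det; ring.
set A := al%:~R / a%:~R in nA dA; set B := (p - al)%:~R / (q - a)%:~R in nB dB.
have hA : height Q A = 1 by rewrite /height nA dA -/p -/q (mulrC a) eal; ring.
have hB : height Q B = -1 by rewrite /height nB dB -/p -/q mulrBl (mulrC a) eal; ring.
exists A, B; split.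
- apply/andP; split; first by rewrite /farey /= nA dA nB dB distrC mulrC (mulrC al) det normr1.
  by rewrite nA nB dA dB (addrC al) (addrC a) !subrK divq_num_den.
- by rewrite /below_above hA hB nA dA nB dB.
have one C : denq C < q -> height Q C = 1 -> C = A.
  move=> Cq hC; have e : denq C = a.
    have c0 := denq_gt0 C.
    have e : q * (numq C * p' - al * p' - (denq C - a) * k) = denq C - a.
      have f : (denq C - a) * p = q * (numq C - al).
        by move: hC hA; rewrite /height nA dA -/p -/q; clear; lia.
      transitivity ((denq C - a) * p * p' - (denq C - a) * q * k); first by rewrite f; ring.
      by rewrite -mulrA ek; ring.
    have := small_multiple q0 e; clear - c0 Cq a0 aq; lia.
  have n : numq C = al.
    apply: (mulfI (lt0r_neq0 q0)).
    by move: hC hA; rewrite /height e nA dA -/p -/q; clear; lia.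
  by rewrite -(divq_num_den C) e n.
have other C D : numq C + numq D = p -> denq C + denq D = q -> C = A -> D = B.
  move=> en ed eC; rewrite eC nA dA in en ed; rewrite -(divq_num_den D) /B -en -ed.
  by rewrite !(addrC al, addrC a) !addrK.
move=> A' B' /(parents_below_above)[en ed [[_ h]|[_ h]]].
  left; have eA : A' = A by apply: one => //; rewrite /q -ed ltrDl denq_gt0.
  by split=> //; exact: other eA.
right; have eA : B' = A by apply: one => //; rewrite /q -ed ltrDr denq_gt0.
by split=> //; apply: (other B') => //; rewrite addrC.
Qed.

Theorem mainTheorem3 (R : realType) (G : set (torus R)) (Q : rat) (mu nu : nat)
    (p' : int)
    (hG : finite_subgroup G)
    (hdata : has_data G Q mu nu)
    (hQ : Q != 0)
    (hp' : (numq Q * p' = 1 %[mod denq Q])%Z)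
    (hmunu : (1 < mu)%N || (1 < nu)%N)
    (hhalf : mu = 1%N \/ nu = 1%N -> Q <> 1 / 2) :
  (forall F : set 'rV[R]_4,
     face_of_dim 3 (hull (@iotaT R @` G)) F <->
     exists (S : set (torus R)) (g : torus R),
       [/\ cell_pts Q mu nu p' S, G g & F = act g @` spanned_cell S]) /\
  (forall A B : rat, admissible Q A B -> tetra_cell G Q mu nu A B) /\
  ((1 < nu)%N -> tetra_cell G Q mu nu 0 1) /\
  (exists A B : rat,
     [/\ farey_parents Q A B,
         forall A' B' : rat, farey_parents Q A' B' ->
           (A' = A /\ B' = B) \/ (A' = B /\ B' = A),
         (1 < mu)%N -> tetra_cell G Q mu nu A B &
         Q = 1 / 2 -> (1 < mu)%N -> (1 < nu)%N ->
           spanned_cell (tetra_pts R Q mu nu A B) =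
           spanned_cell (tetra_pts R Q mu nu 0 1)]) /\
  ((1 < nu)%N -> antiprism_cell G nu (nu_pts R Q mu nu)) /\
  ((1 < mu)%N -> antiprism_cell G mu (mu_pts R Q mu nu p')).
Proof.
have [/andP[Q0 Q1] mu0 nu0 _] := hdata.
have {}Q0 : 0 < Q by rewrite lt_neqAle eq_sym hQ.
have g := good_of_data Q0 Q1 mu0 nu0 hp' hmunu hhalf.
have tet := pair_tetra_cell R mu0 nu0 g Q0 Q1.
rewrite (data_Gam mu0 nu0 hdata); split.
  move=> F; rewrite -/(polytope _ _ _ _) (facetsP g); split=> -[S [h [l Gh ->]]]; exists S, h.
    by split=> //; [apply/(cell_ptsP mu0 nu0 g Q0 Q1)|rewrite act_spanned].
  by split=> //; [apply/(cell_ptsP mu0 nu0 g Q0 Q1)|rewrite act_spanned].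
split; first by move=> A B h; apply: tet; constructor 1.
split; first by move=> nu1; apply: tet; constructor 2.
split; last first.
  by rewrite (nu_ptsE R mu0 nu0 g) (mu_ptsE R mu0 nu0 g); split=> _; [exact: prism_cell g|exact: prism2_cell g].
have [A [B [AB low un]]] := farey_parents_exist Q0 Q1 hp'.
exists A, B; split=> // [mu1|Q2 mu1 nu1]; first by apply: tet; constructor 3.
have [en ed _] := parents_below_above AB; have [_ _ det] := low.
have a0 := denq_gt0 A; have b0 := denq_gt0 B.
have [nQ dQ] : numq Q = 1 /\ denq Q = 2 by rewrite Q2.
rewrite nQ in en; rewrite dQ in ed.
have a1 : denq A = 1 by clear - a0 b0 ed; lia.
have b1 : denq B = 1 by clear - a0 b0 ed; lia.
rewrite a1 b1 !mul1r in det.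
have -> : A = 0 by rewrite -(divq_num_den A) a1 (_ : numq A = 0) ?mul0r //; clear - en det; lia.
by have -> : B = 1 by rewrite -(divq_num_den B) b1 (_ : numq B = 1) //; clear - en det; lia.
Qed.
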